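(* Let $\beta>0$ and let $a,b\in C^\infty(\mathbb T;\mathbb R)$ satisfy $a,b\ge0$, $a\not\equiv0$, $b\not\equiv0$. Let $S_d(t)$ be the contraction semigroup generated by $\mathcal A_d$ on $\mathcal H$. Then $$\lim_{t\to\infty}\|S_d(t)Z_0\|_{\mathcal H}=0\qquad\text{for every }Z_0\in\mathcal H.$$
   Context: $\mathbb T=\mathbb R/(2\pi\mathbb Z)$; functions are complex valued. Fourier convention: $\widehat v(k)=\frac1{2\pi}\int_{\mathbb T}v(x)e^{-ikx}dx$, $k\in\mathbb Z$. $\langle k\rangle=(1+k^2)^{1/2}$ and $\|v\|_{H^s}^2=2\pi\sum_k\langle k\rangle^{2s}|\widehat v(k)|^2$. Fourier multipliers: $\widehat{T_\beta v}(k)=-im_\beta(k)\widehat v(k)$ with $m_\beta(k)=\tanh(\beta k)/\beta$; $\widehat{P_\beta v}(k)=p_\beta(k)\widehat v(k)$ with $p_\beta(k)=\frac{\tanh(\beta k)}{\beta k}$ for $k\ne0$ and $p_\beta(0)=1$. Energy space: $\mathcal H=L^2(\mathbb T)\times H^{-1/2}(\mathbb T)$ with inner product $\langle(h,u),(\varphi,\psi)\rangle_{\mathcal H}=\langle h,\varphi\rangle_{L^2}+\langle P_\beta u,\psi\rangle_{H^{1/2},H^{-1/2}}=2\pi\sum_k\widehat h(k)\overline{\widehat\varphi(k)}+2\pi\sum_kp_\beta(k)\widehat u(k)\overline{\widehat\psi(k)}$. Damped generator: $\mathcal A_d(h,u)=(T_\beta u-a^2h,\,-h_x-b^2P_\beta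 u)$ with domain $D(\mathcal A_d)=H^{1/2}(\mathbb T)\times L^2(\mathbb T)$; it generates a $C_0$-semigroup of contractions on $\mathcal H$. *)

(* Defs.v *)
From Stdlib Require Import Reals Lra Lia ZArith.
From Coquelicot Require Import Coquelicot.
Open Scope R_scope.

Definition smooth_periodic (f : R -> R) : Prop :=
  (forall (n : nat) (x : R), ex_derive_n f n x) /\
  (forall x : R, f (x + 2 * PI) = f x).

Record smoothT := MkSmoothT {
  sfun :> R -> R;
  sfunP : smooth_periodic sfun
}.

Lemma smooth_ex_derive (f : R -> R) (x : R) :
  (forall n y, ex_derive_n f n y) -> ex_derive f x.
Proof. intros H; exact (H 1%nat x). Qed.

Lemma smooth_derive (f : R -> R) :
  (forall n y, ex_derive_n f n y) -> forall n y, ex_derive_n (Derive f) n y.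
Proof.
  intros H [|n] y; [exact I|].
  simpl. apply ex_derive_ext with (Derive_n f (n + 1)).
  - intros t. rewrite <- Derive_n_comp. reflexivity.
  - rewrite Nat.add_1_r. exact (H (S (S n)) y).
Qed.

Lemma smooth_of_derive (f : R -> R) (n : nat) :
  (forall x, ex_derive f x) ->
  (forall y, ex_derive_n (Derive f) n y) -> forall y, ex_derive_n f (S n) y.
Proof.
  intros H0 H y. destruct n as [|n]; [exact (H0 y)|].
  simpl. apply ex_derive_ext with (Derive_n (Derive f) n).
  - intros t. change (Derive_n (Derive_n f 1) n t = Derive_n f (S n) t).
    rewrite Derive_n_comp, Nat.add_1_r. reflexivity.
  - exact (H y).
Qed.

Lemma smooth_plus (f g : R -> R) :
  (forall n x, ex_derive_n f n x) -> (forall n x, ex_derive_n g n x) ->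
  forall n x, ex_derive_n (fun t => f t + g t) n x.
Proof.
  intros Hf Hg n x; apply ex_derive_n_plus; exists (mkposreal 1 Rlt_0_1); auto.
Qed.

Lemma smooth_mult (f g : R -> R) :
  (forall n x, ex_derive_n f n x) -> (forall n x, ex_derive_n g n x) ->
  forall n x, ex_derive_n (fun t => f t * g t) n x.
Proof.
  intros Hf Hg n. revert f g Hf Hg.
  induction n as [n IH] using lt_wf_ind; intros f g Hf Hg.
  destruct n as [|n]; [intros; exact I|].
  apply smooth_of_derive.
  - intros x. apply ex_derive_mult; now apply smooth_ex_derive.
  - intros y.
    apply ex_derive_n_ext with (fun t => Derive f t * g t + f t * Derive g t).
    + intros t. symmetry. apply Derive_mult; now apply smooth_ex_derive.
    + apply ex_derive_n_plus; exists (mkposreal 1 Rlt_0_1); intros z _ k Hk;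
        apply IH; auto using smooth_derive; lia.
Qed.

Lemma smooth_trig (n : nat) : forall k A B x : R,
  ex_derive_n (fun t => A * cos (k * t) + B * sin (k * t)) n x.
Proof.
  induction n as [|n IH]; intros k A B; [intros; exact I|].
  apply smooth_of_derive.
  - intros x. auto_derive. exact I.
  - intros y.
    apply ex_derive_n_ext
      with (fun t => (B * k) * cos (k * t) + (- A * k) * sin (k * t)).
    + intros t. symmetry. apply is_derive_unique. auto_derive; [exact I|ring].
    + apply IH.
Qed.

Lemma cos_sin_2kPI (k : Z) (x : R) :
  cos (x + 2 * IZR k * PI) = cos x /\ sin (x + 2 * IZR k * PI) = sin x.
Proof.
  destruct (Z_le_dec 0 k) as [Hk|Hk].
  - rewrite <- (Z2Nat.id k Hk), <- INR_IZR_INZ.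
    split; [apply cos_period | apply sin_period].
  - assert (Hk' : (0 <= - k)%Z) by lia.
    assert (E : IZR k = - INR (Z.to_nat (- k))).
    { rewrite INR_IZR_INZ, Z2Nat.id by exact Hk'. rewrite opp_IZR. ring. }
    rewrite E. set (n := Z.to_nat (- k)).
    rewrite <- (cos_period (x + 2 * - INR n * PI) n),
            <- (sin_period (x + 2 * - INR n * PI) n).
    split; f_equal; ring.
Qed.

Lemma smooth_periodic_plus (f g : smoothT) :
  smooth_periodic (fun x => f x + g x).
Proof.
  destruct f as [f [Hf Pf]], g as [g [Hg Pg]]; split; simpl.
  - now apply smooth_plus.
  - intros x; now rewrite Pf, Pg.
Qed.

Lemma smooth_periodic_mult (f g : smoothT) :
  smooth_periodic (fun x => f x * g x).
Proof.
  destruct f as [f [Hf Pf]], g as [g [Hg Pg]]; split; simpl.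
  - now apply smooth_mult.
  - intros x; now rewrite Pf, Pg.
Qed.

Lemma smooth_periodic_scal (c : R) (f : smoothT) :
  smooth_periodic (fun x => c * f x).
Proof.
  destruct f as [f [Hf Pf]]; split; simpl.
  - intros n x; now apply ex_derive_n_scal_l.
  - intros x; now rewrite Pf.
Qed.

Lemma smooth_periodic_Derive (f : smoothT) : smooth_periodic (Derive f).
Proof.
  destruct f as [f [Hf Pf]]; split; simpl.
  - now apply smooth_derive.
  - intros x. change (Derive_n f 1 (x + 2 * PI) = Derive_n f 1 x).
    rewrite <- Derive_n_comp_trans. now apply Derive_n_ext.
Qed.

Lemma smooth_periodic_cos (k : Z) : smooth_periodic (fun x => cos (IZR k * x)).
Proof.
  split.
  - intros n x.
    apply ex_derive_n_ext
      with (fun t => 1 * cos (IZR k * t) + 0 * sin (IZR k * t)).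
    + intros t; ring.
    + apply smooth_trig.
  - intros x. rewrite <- (proj1 (cos_sin_2kPI k (IZR k * x))). f_equal; ring.
Qed.

Lemma smooth_periodic_sin (k : Z) : smooth_periodic (fun x => sin (IZR k * x)).
Proof.
  split.
  - intros n x.
    apply ex_derive_n_ext
      with (fun t => 0 * cos (IZR k * t) + 1 * sin (IZR k * t)).
    + intros t; ring.
    + apply smooth_trig.
  - intros x. rewrite <- (proj2 (cos_sin_2kPI k (IZR k * x))). f_equal; ring.
Qed.

Definition s_plus (f g : smoothT) : smoothT :=
  MkSmoothT _ (smooth_periodic_plus f g).
Definition s_mult (f g : smoothT) : smoothT :=
  MkSmoothT _ (smooth_periodic_mult f g).
Definition s_scal (c : R) (f : smoothT) : smoothT :=
  MkSmoothT _ (smooth_periodic_scal c f).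
Definition s_deriv (f : smoothT) : smoothT :=
  MkSmoothT _ (smooth_periodic_Derive f).
Definition s_cos (k : Z) : smoothT := MkSmoothT _ (smooth_periodic_cos k).
Definition s_sin (k : Z) : smoothT := MkSmoothT _ (smooth_periodic_sin k).

(* An element of C^infty(T; C), by its real and imaginary parts. *)
Record testT := MkTestT { t_re : smoothT; t_im : smoothT }.

Definition t_plus (phi psi : testT) : testT :=
  MkTestT (s_plus (t_re phi) (t_re psi)) (s_plus (t_im phi) (t_im psi)).

Definition t_scal (c : C) (phi : testT) : testT :=
  MkTestT
    (s_plus (s_scal (Re c) (t_re phi)) (s_scal (- Im c) (t_im phi)))
    (s_plus (s_scal (Re c) (t_im phi)) (s_scal (Im c) (t_re phi))).

Definition t_mult (f : smoothT) (phi : testT) : testT :=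
  MkTestT (s_mult f (t_re phi)) (s_mult f (t_im phi)).

Definition t_deriv (phi : testT) : testT :=
  MkTestT (s_deriv (t_re phi)) (s_deriv (t_im phi)).

Definition t_Derive_n (phi : testT) (j : nat) (x : R) : C :=
  (Derive_n (t_re phi) j x, Derive_n (t_im phi) j x).

(* e^{-ikx} *)
Definition t_expN (k : Z) : testT := MkTestT (s_cos k) (s_scal (-1) (s_sin k)).

Definition functional := testT -> C.

(* An element of D'(T): linear, and bounded by a multiple of a norm
   max_{j <= N} sup |phi^(j)|. *)
Definition is_distribution (v : functional) : Prop :=
  (forall phi psi, v (t_plus phi psi) = Cplus (v phi) (v psi)) /\
  (forall c phi, v (t_scal c phi) = Cmult c (v phi)) /\
  (exists (N : nat) (M : R), forall (phi : testT) (B : R),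
     (forall (j : nat) (x : R), (j <= N)%nat -> Cmod (t_Derive_n phi j x) <= B) ->
     Cmod (v phi) <= M * B).

Definition d_plus (v w : functional) : functional :=
  fun phi => Cplus (v phi) (w phi).
Definition d_minus (v w : functional) : functional :=
  fun phi => Cminus (v phi) (w phi).
Definition d_scal (c : C) (v : functional) : functional :=
  fun phi => Cmult c (v phi).
Definition d_opp (v : functional) : functional := fun phi => Copp (v phi).
Definition d_mult (f : smoothT) (v : functional) : functional :=
  fun phi => v (t_mult f phi).
Definition d_deriv (v : functional) : functional :=
  fun phi => Copp (v (t_deriv phi)).

(* A function v acts by phi |-> int_T v phi (no conjugation), so this is
   (1 / 2pi) int_T v(x) e^{-ikx} dx. *)
Definition fourier (v : functional) (k : Z) : C :=
  Cmult (RtoC (/ (2 * PI))) (v (t_expN k)).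

Definition ex_seriesZ (f : Z -> R) : Prop :=
  ex_series (fun n : nat => f (Z.of_nat n)) /\
  ex_series (fun n : nat => f (- Z.of_nat (S n))%Z).

Definition SeriesZ (f : Z -> R) : R :=
  Series (fun n : nat => f (Z.of_nat n)) +
  Series (fun n : nat => f (- Z.of_nat (S n))%Z).

Definition CSeriesZ (f : Z -> C) : C :=
  (SeriesZ (fun k => Re (f k)), SeriesZ (fun k => Im (f k))).

Definition japanese (k : Z) : R := sqrt (1 + IZR k ^ 2).

Definition in_Hs (s : R) (v : functional) : Prop :=
  is_distribution v /\
  ex_seriesZ (fun k => Rpower (japanese k) (2 * s) * Cmod (fourier v k) ^ 2).

(* An L^2 function is identified with the distribution it defines; by Parseval
   and Riesz-Fischer, L^2(T) = H^0(T). *)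
Definition in_L2 (v : functional) : Prop := in_Hs 0 v.

(* As a graph: a distribution w is determined by its Fourier coefficients. *)
Definition is_multiplier (sigma : Z -> C) (v w : functional) : Prop :=
  is_distribution w /\
  forall k : Z, fourier w k = Cmult (sigma k) (fourier v k).

Definition m_sym (beta : R) (k : Z) : R := tanh (beta * IZR k) / beta.

Definition p_sym (beta : R) (k : Z) : R :=
  if Z.eq_dec k 0 then 1 else tanh (beta * IZR k) / (beta * IZR k).

Definition is_T (beta : R) : functional -> functional -> Prop :=
  is_multiplier (fun k => Copp (Cmult Ci (RtoC (m_sym beta k)))).

Definition is_P (beta : R) : functional -> functional -> Prop :=
  is_multiplier (fun k => RtoC (p_sym beta k)).

Definition state := (functional * functional)%type.

Definition st_plus (Z W : state) : state :=
  (d_plus (fst Z) (fst W), d_plus (snd Z) (snd W)).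
Definition st_minus (Z W : state) : state :=
  (d_minus (fst Z) (fst W), d_minus (snd Z) (snd W)).
Definition st_scal (c : C) (Z : state) : state :=
  (d_scal c (fst Z), d_scal c (snd Z)).

Definition in_H (Z : state) : Prop := in_L2 (fst Z) /\ in_Hs (- (1 / 2)) (snd Z).

Definition H_inner (beta : R) (Z W : state) : C :=
  Cplus
    (Cmult (RtoC (2 * PI))
       (CSeriesZ (fun k => Cmult (fourier (fst Z) k) (Cconj (fourier (fst W) k)))))
    (Cmult (RtoC (2 * PI))
       (CSeriesZ (fun k => Cmult (RtoC (p_sym beta k))
          (Cmult (fourier (snd Z) k) (Cconj (fourier (snd W) k)))))).

Definition H_norm (beta : R) (Z : state) : R := sqrt (Re (H_inner beta Z Z)).

Definition in_dom_Ad (Z : state) : Prop := in_Hs (1 / 2) (fst Z) /\ in_L2 (snd Z).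

(* Graph of the generator: W is the image of Z, where
   Z = (h, u) and W = (T u - a^2 h, - h_x - b^2 P u). *)
Definition Ad (beta : R) (a b : smoothT) (Z W : state) : Prop :=
  in_dom_Ad Z /\
  exists Tu Pu : functional,
    is_T beta (snd Z) Tu /\ is_P beta (snd Z) Pu /\
    W = (d_minus Tu (d_mult (s_mult a a) (fst Z)),
         d_minus (d_opp (d_deriv (fst Z))) (d_mult (s_mult b b) Pu)).

Definition is_C0_contraction_semigroup (beta : R) (S : R -> state -> state) : Prop :=
  (forall t Z, 0 <= t -> in_H Z -> in_H (S t Z)) /\
  (forall t Z W, 0 <= t -> in_H Z -> in_H W ->
     S t (st_plus Z W) = st_plus (S t Z) (S t W)) /\
  (forall t c Z, 0 <= t -> in_H Z -> S t (st_scal c Z) = st_scal c (S t Z)) /\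
  (forall Z, in_H Z -> S 0 Z = Z) /\
  (forall t s Z, 0 <= t -> 0 <= s -> in_H Z -> S (t + s) Z = S t (S s Z)) /\
  (forall Z, in_H Z ->
     filterlim (fun t => H_norm beta (st_minus (S t Z) Z)) (at_right 0) (locally 0)) /\
  (forall t Z, 0 <= t -> in_H Z -> H_norm beta (S t Z) <= H_norm beta Z).

(* G is the graph of the generator of S:
   (S(t)Z - Z)/t -> W in H as t -> 0+ if and only if (Z, W) is in G. *)
Definition is_generator (beta : R) (S : R -> state -> state)
    (G : state -> state -> Prop) : Prop :=
  forall Z W, in_H Z -> in_H W ->
    (filterlim
       (fun t => H_norm beta
          (st_minus (st_scal (RtoC (/ t)) (st_minus (S t Z) Z)) W))
       (at_right 0) (locally 0)
     <-> G Z W).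

(* Main.v *)
Require Import Defs.
From Stdlib Require Import Reals.
From Stdlib Require Import Lra Lia ZArith Classical FunctionalExtensionality ProofIrrelevance.
From Coquelicot Require Import Coquelicot.
From Stdlib Require Import List.
Open Scope R_scope.

(** The energy is a Lyapunov function whose dissipation is [|a h|^2 + |b P u|^2], and the
    undamped system has no nonzero solution along which this vanishes: such a solution
    splits into modes [e^{ikx}] with frequencies [+- omega(k)],
    [omega(k)^2 = k tanh(beta k) / beta], which are distinct for distinct [|k|], so that
    [a h = 0] forces a combination of [e^{ikx}] and [e^{-ikx}] to vanish where [a] does
    not; only the mean of [u] then remains, and [b P u = 0] removes it.  The resolvent is
    compact, so this is enough.  The proof below makes the argument quantitative on
    Fourier coefficients, without limit points of orbits.

    Contractivity and density of trigonometric states ([trig_dense]) reduce the claim to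
    initial data in the domain.  There the difference quotients of the orbit converge
    uniformly in time ([classical_orbit]).  Since the energy converges, comparing it at
    times [t] and [t + s] for a short step [s] shows that the coefficients of [a^2 h(t)]
    and [b^2 P u(t)] tend to 0 in [l^2] ([damping_vanishes]); the form inequality
    [|f v|^2 <= sup f <f v, v>] used there is [mult_coercive], which rests on Fourier
    inversion of test functions, needed to act on products with a distribution
    ([distribution_inversion]).

    Hence each mode satisfies the undamped equation up to an error vanishing at infinity,
    and its two eigencoordinates have frequencies [+- omega(k)] in the sense of [freq].
    Each coefficient of [a^2 h] is an absolutely convergent combination of these
    oscillations and tends to 0; averaging over well chosen time shifts isolates one
    frequency ([frequency_separation]).  What is left is a 2 by 2 linear system for the
    modes [k] and [-k], with positive determinant because the nonzero Fourier
    coefficients of [a^2] are strictly smaller than its mean ([fcoef_lt]).  So every mode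
    tends to 0 ([hhat_vanish], [uhat_vanish]).

    Finally the time derivative of the orbit stays bounded in energy, which bounds the
    tails of the Fourier series uniformly in time ([smoothing_bound]), and turns
    the decay of every mode into decay of the norm ([orbit_decay]). *)

(** * Two-sided sums and complex arithmetic *)

(** The window [-N, N), rather than a symmetric one, is what truncating
    both halves of [SeriesZ] at the same index gives. *)
Fixpoint zsum (f : Z -> R) (N : nat) : R :=
  match N with
  | O => 0
  | S n => zsum f n + (f (Z.of_nat n) + f (- Z.of_nat (S n))%Z)
  end.

Definition csum (f : Z -> C) (N : nat) : C :=
  (zsum (fun k => fst (f k)) N, zsum (fun k => snd (f k)) N).

Definition inwin (N : nat) (k : Z) : Prop := (- Z.of_nat N <= k < Z.of_nat N)%Z.

Ltac cpair := apply injective_projections; simpl.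

Lemma zsum_ext (f g : Z -> R) N :
  (forall k, inwin N k -> f k = g k) -> zsum f N = zsum g N.
Proof.
  induction N as [|N IH]; intros H; simpl; [reflexivity|].
  rewrite IH by (intros k Hk; apply H; unfold inwin in *; lia).
  rewrite !H by (unfold inwin; lia). reflexivity.
Qed.

Lemma zsum_le (f g : Z -> R) N : (forall k, f k <= g k) -> zsum f N <= zsum g N.
Proof.
  intros H; induction N as [|N IH]; cbn [zsum]; [lra|].
  pose proof (H (Z.of_nat N)); pose proof (H (- Z.of_nat (S N))%Z); lra.
Qed.

Lemma zsum_plus (f g : Z -> R) N :
  zsum (fun k => f k + g k) N = zsum f N + zsum g N.
Proof. induction N as [|N IH]; simpl; [lra|rewrite IH; ring]. Qed.

Lemma zsum_scal c (f : Z -> R) N : zsum (fun k => c * f k) N = c * zsum f N.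
Proof. induction N as [|N IH]; simpl; [lra|rewrite IH; ring]. Qed.

Lemma zsum_opp (f : Z -> R) N : zsum (fun k => - f k) N = - zsum f N.
Proof. induction N as [|N IH]; simpl; [lra|rewrite IH; ring]. Qed.

Lemma zsum_minus (f g : Z -> R) N :
  zsum (fun k => f k - g k) N = zsum f N - zsum g N.
Proof. induction N as [|N IH]; simpl; [lra|rewrite IH; ring]. Qed.

Lemma zsum_zero N : zsum (fun _ => 0) N = 0.
Proof. induction N as [|N IH]; simpl; [lra|rewrite IH; ring]. Qed.

Lemma zsum_nonneg (f : Z -> R) N : (forall k, 0 <= f k) -> 0 <= zsum f N.
Proof. intros H; rewrite <- (zsum_zero N); now apply zsum_le. Qed.

Lemma zsum_mono (f : Z -> R) N L :
  (forall k, 0 <= f k) -> (N <= L)%nat -> zsum f N <= zsum f L.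
Proof.
  intros H HL; induction HL as [|L HL IH]; [lra|]. cbn [zsum].
  pose proof (H (Z.of_nat L)); pose proof (H (- Z.of_nat (S L))%Z); lra.
Qed.

Lemma zsum_term (f : Z -> R) k :
  (forall k, 0 <= f k) -> exists N, f k <= zsum f N.
Proof.
  intros H. destruct (Z_lt_dec k 0) as [Hk|Hk].
  - exists (S (Z.to_nat (- k - 1))). cbn [zsum].
    replace (- Z.of_nat (S (Z.to_nat (- k - 1))))%Z with k by lia.
    pose proof (H (Z.of_nat (Z.to_nat (- k - 1)))).
    pose proof (zsum_nonneg f (Z.to_nat (- k - 1)) H). lra.
  - exists (S (Z.to_nat k)). cbn [zsum].
    replace (Z.of_nat (Z.to_nat k)) with k by lia.
    pose proof (H (- Z.of_nat (S (Z.to_nat k)))%Z).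
    pose proof (zsum_nonneg f (Z.to_nat k) H). lra.
Qed.

(** Truncation to a window, so that sums of different lengths can be compared
    over the longer one. *)
Definition trunc {A : Type} (z : A) (N : nat) (f : Z -> A) (k : Z) : A :=
  if Z_le_dec (- Z.of_nat N) k
  then (if Z_lt_dec k (Z.of_nat N) then f k else z) else z.

Lemma trunc_in {A} (z : A) N f k : inwin N k -> trunc z N f k = f k.
Proof.
  intros [H1 H2]; unfold trunc.
  destruct Z_le_dec; [destruct Z_lt_dec|]; tauto.
Qed.

Lemma trunc_out {A} (z : A) N f k : ~ inwin N k -> trunc z N f k = z.
Proof.
  unfold inwin, trunc; intros H.
  destruct Z_le_dec; [destruct Z_lt_dec|]; tauto.
Qed.

Lemma inwin_dec N k : {inwin N k} + {~ inwin N k}.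
Proof.
  unfold inwin.
  destruct (Z_le_dec (- Z.of_nat N) k); [destruct (Z_lt_dec k (Z.of_nat N))|];
    [left|right|right]; tauto.
Qed.

Lemma zsum_vanish_out (f : Z -> R) N L :
  (forall k, ~ inwin N k -> f k = 0) -> (N <= L)%nat -> zsum f L = zsum f N.
Proof.
  intros H HL; induction HL as [|L HL IH]; [reflexivity|]. cbn [zsum].
  rewrite IH, !H by (unfold inwin; lia). ring.
Qed.

Lemma zsum_trunc (f : Z -> R) N L :
  (N <= L)%nat -> zsum (trunc 0 N f) L = zsum f N.
Proof.
  intros HL. rewrite (zsum_vanish_out _ N L); auto using trunc_out.
  apply zsum_ext; intros k Hk; now apply trunc_in.
Qed.

Lemma csum_ext (f g : Z -> C) N :
  (forall k, inwin N k -> f k = g k) -> csum f N = csum g N.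
Proof.
  intros H; unfold csum; f_equal; apply zsum_ext; intros k Hk; now rewrite H.
Qed.

Lemma csum_0 (f : Z -> C) : csum f 0 = RtoC 0.
Proof. reflexivity. Qed.

Lemma csum_S (f : Z -> C) N :
  csum f (S N) =
  Cplus (csum f N) (Cplus (f (Z.of_nat N)) (f (- Z.of_nat (S N))%Z)).
Proof. reflexivity. Qed.

Lemma csum_plus (f g : Z -> C) N :
  csum (fun k => Cplus (f k) (g k)) N = Cplus (csum f N) (csum g N).
Proof. unfold csum, Cplus; simpl; now rewrite !zsum_plus. Qed.

Lemma csum_scal c (f : Z -> C) N :
  csum (fun k => Cmult c (f k)) N = Cmult c (csum f N).
Proof.
  unfold csum, Cmult; simpl. rewrite zsum_minus, zsum_plus, !zsum_scal.
  reflexivity.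
Qed.

Lemma csum_minus (f g : Z -> C) N :
  csum (fun k => Cminus (f k) (g k)) N = Cminus (csum f N) (csum g N).
Proof.
  unfold csum; cpair;
    [apply (zsum_minus (fun k => fst (f k)) (fun k => fst (g k)))
    |apply (zsum_minus (fun k => snd (f k)) (fun k => snd (g k)))].
Qed.

Lemma csum_conj (f : Z -> C) N : csum (fun k => Cconj (f k)) N = Cconj (csum f N).
Proof. unfold csum, Cconj; simpl; now rewrite zsum_opp. Qed.

Lemma csum_vanish_out (f : Z -> C) N L :
  (forall k, ~ inwin N k -> f k = RtoC 0) -> (N <= L)%nat -> csum f L = csum f N.
Proof.
  intros H HL; unfold csum; f_equal; apply zsum_vanish_out; auto;
    intros k Hk; now rewrite H.
Qed.

Lemma csum_single (f : Z -> C) j N :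
  (forall k, k <> j -> f k = RtoC 0) ->
  csum f N = trunc (RtoC 0) N f j.
Proof.
  intros H; induction N as [|N IH].
  - rewrite trunc_out by (unfold inwin; lia). reflexivity.
  - rewrite csum_S, IH.
    destruct (Z.eq_dec (Z.of_nat N) j) as [E1|E1].
    { rewrite (H (- Z.of_nat (S N))%Z) by lia. rewrite E1.
      rewrite trunc_out by (unfold inwin; lia).
      rewrite trunc_in by (unfold inwin; lia). ring. }
    rewrite (H _ E1).
    destruct (Z.eq_dec (- Z.of_nat (S N)) j) as [E2|E2].
    { rewrite E2. rewrite trunc_out by (unfold inwin; lia).
      rewrite trunc_in by (unfold inwin; lia). ring. }
    rewrite (H _ E2).
    destruct (inwin_dec N j) as [Hj|Hj].
    + rewrite !trunc_in by (unfold inwin in *; lia). ring.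
    + rewrite !trunc_out by (unfold inwin in *; lia). ring.
Qed.

Lemma Cmod2 (z : C) : Cmod z ^ 2 = fst z ^ 2 + snd z ^ 2.
Proof.
  unfold Cmod. rewrite <- Rsqr_pow2, Rsqr_sqrt; [ring|].
  apply Rplus_le_le_0_compat; apply pow2_ge_0.
Qed.

Lemma Cmod2_ge_0 (z : C) : 0 <= Cmod z ^ 2.
Proof. apply pow2_ge_0. Qed.

Lemma Cmod2_plus (z w : C) : Cmod (Cplus z w) ^ 2 <= 2 * Cmod z ^ 2 + 2 * Cmod w ^ 2.
Proof.
  rewrite !Cmod2; simpl.
  pose proof (pow2_ge_0 (fst z - fst w)); pose proof (pow2_ge_0 (snd z - snd w)).
  nra.
Qed.

Lemma Cmod2_mult (z w : C) : Cmod (Cmult z w) ^ 2 = Cmod z ^ 2 * Cmod w ^ 2.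
Proof. rewrite Cmod_mult; ring. Qed.

Lemma Cmult_conj_re (z w : C) :
  fst (Cmult z (Cconj w)) = fst z * fst w + snd z * snd w.
Proof. simpl; ring. Qed.

Lemma Cmult_conj_self (z : C) : Cmult z (Cconj z) = RtoC (Cmod z ^ 2).
Proof. rewrite Cmod2; cpair; ring. Qed.

Lemma Cmod_le_of_sq (z : C) B : 0 <= B -> Cmod z ^ 2 <= B ^ 2 -> Cmod z <= B.
Proof.
  intros HB H. apply Rsqr_incr_0_var; [|exact HB]. rewrite !Rsqr_pow2. exact H.
Qed.

Lemma fst_le_Cmod (z : C) : Rabs (fst z) <= Cmod z.
Proof. exact (re_le_Cmod z). Qed.

Lemma snd_le_Cmod (z : C) : Rabs (snd z) <= Cmod z.
Proof.
  eapply Rle_trans; [|apply Rmax_Cmod]. apply Rmax_r.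
Qed.

Lemma Cmod_le_sum (z : C) : Cmod z <= Rabs (fst z) + Rabs (snd z).
Proof.
  apply Cmod_le_of_sq.
  - pose proof (Rabs_pos (fst z)); pose proof (Rabs_pos (snd z)); lra.
  - rewrite Cmod2, <- (pow2_abs (fst z)), <- (pow2_abs (snd z)).
    pose proof (Rabs_pos (fst z)); pose proof (Rabs_pos (snd z)); nra.
Qed.

Lemma Cmod_triangle_minus (z w : C) : Cmod (Cminus z w) <= Cmod z + Cmod w.
Proof. rewrite <- (Cmod_opp w). apply Cmod_triangle. Qed.

Lemma IZR_ne0 (k : Z) : k <> 0%Z -> IZR k <> 0.
Proof. intros H; now apply not_0_IZR. Qed.

Lemma IZR_abs_ge1 (k : Z) : k <> 0%Z -> 1 <= Rabs (IZR k).
Proof.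
  intros H. rewrite <- abs_IZR. apply IZR_le. lia.
Qed.

Lemma tail_outside (N : nat) (k : Z) : ~ inwin N k -> INR N <= Rabs (IZR k).
Proof.
  intros H. rewrite INR_IZR_INZ, <- abs_IZR. apply IZR_le. unfold inwin in H. lia.
Qed.

(** Comparison with the telescoping series of [1/n - 1/(n+1)]. *)
Lemma decay_tail (f : Z -> R) C N L :
  0 <= C ->
  (forall k, k <> 0%Z -> f k <= C / IZR k ^ 2) -> (1 <= N)%nat -> (N <= L)%nat ->
  zsum f L - zsum f N <= 4 * C / INR N.
Proof.
  intros HC H HN HL.
  assert (G : zsum f L - zsum f N <= 4 * C * (/ INR N - / INR L)).
  { induction HL as [|L HL IH]; [lra|]. cbn [zsum].
    pose proof (H (Z.of_nat L) ltac:(lia)) as H1.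
    pose proof (H (- Z.of_nat (S L))%Z ltac:(lia)) as H2.
    rewrite opp_IZR in H2. rewrite <- !INR_IZR_INZ in *.
    rewrite S_INR in *.
    assert (HLp : 1 <= INR L) by (apply (le_INR 1); lia).
    assert (K1 : C / INR L ^ 2 <= 2 * C * (/ INR L - / (INR L + 1))).
    { replace (2 * C * (/ INR L - / (INR L + 1))) with (C * (2 * / (INR L * (INR L + 1))))
        by (field; lra).
      apply Rmult_le_compat_l; [exact HC|].
      replace (2 * / (INR L * (INR L + 1))) with (/ (INR L * (INR L + 1) / 2))
        by (field; lra).
      apply Rinv_le_contravar; nra. }
    assert (K2 : C / (- (INR L + 1)) ^ 2 <= 2 * C * (/ INR L - / (INR L + 1))).
    { eapply Rle_trans; [|exact K1].
      apply Rmult_le_compat_l; [exact HC|].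
      apply Rinv_le_contravar; nra. }
    lra. }
  eapply Rle_trans; [exact G|].
  assert (0 < / INR L) by (apply Rinv_0_lt_compat, lt_0_INR; lia).
  unfold Rdiv. nra.
Qed.

Lemma decay_bounded (f : Z -> R) C :
  0 <= C -> (forall k, 0 <= f k) ->
  (forall k, k <> 0%Z -> f k <= C / IZR k ^ 2) ->
  exists B, forall N, zsum f N <= B.
Proof.
  intros HC H0 H. exists (zsum f 1 + 4 * C). intros N.
  destruct (le_lt_dec 1 N) as [HN|HN].
  - pose proof (decay_tail f C 1 N HC H (le_n _) HN) as K.
    simpl (INR 1) in K. lra.
  - replace N with 0%nat by lia. pose proof (zsum_nonneg f 1 H0).
    simpl (zsum f 0). lra.
Qed.

Lemma Rmax_le_l x y t : Rmax x y <= t -> x <= t.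
Proof. apply Rle_trans, Rmax_l. Qed.

Lemma Rmax_le_r x y t : Rmax x y <= t -> y <= t.
Proof. apply Rle_trans, Rmax_r. Qed.

Lemma archimedean_mult (C eps : R) : 0 < eps -> exists n, C < INR n * eps.
Proof.
  intros He. destruct (INR_unbounded (C / eps)) as [n Hn]. exists n.
  apply Rmult_gt_compat_r with (r := eps) in Hn; [|exact He].
  unfold Rdiv in Hn. rewrite Rmult_assoc, Rinv_l in Hn by lra. lra.
Qed.

Lemma div_succ_le_1 (x : R) : 0 <= x -> x / (x + 1) <= 1.
Proof.
  intros Hx. apply Rmult_le_reg_r with (x + 1); [lra|].
  unfold Rdiv. rewrite Rmult_assoc, Rinv_l by lra. lra.
Qed.

Lemma eps_over_INR (C eps : R) :
  0 < eps -> exists N, (1 <= N)%nat /\ forall n, (N <= n)%nat -> C / INR n <= eps.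
Proof.
  intros He. destruct (archimedean_mult (Rabs C) eps He) as [N HN].
  exists (S N). split; [lia|]. intros n Hn.
  assert (Hn' : INR N < INR n) by (apply lt_INR; lia). pose proof (pos_INR N).
  apply Rmult_le_reg_r with (INR n); [lra|].
  unfold Rdiv. rewrite Rmult_assoc, Rinv_l, Rmult_1_r by lra.
  pose proof (Rle_abs C). nra.
Qed.

(** Otherwise there would be infinitely many increments larger than [eps]. *)
Lemma zsum_cauchy (f : Z -> R) B eps :
  (forall k, 0 <= f k) -> (forall N, zsum f N <= B) -> 0 < eps ->
  exists N, forall L, (N <= L)%nat -> zsum f L - zsum f N <= eps.
Proof.
  intros H0 HB He. apply NNPP. intros Hn.
  assert (Hn' : forall N, exists L, (N <= L)%nat /\ eps < zsum f L - zsum f N).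
  { intros N. apply NNPP. intros H. apply Hn. exists N. intros L HL.
    apply Rnot_lt_le. intros HH. apply H. now exists L. }
  assert (G : forall n : nat, exists N, INR n * eps <= zsum f N).
  { induction n as [|n [N IH]]; [exists 0%nat; simpl; lra|].
    destruct (Hn' N) as [L [_ HL]]. exists L. rewrite S_INR. lra. }
  destruct (archimedean_mult B eps He) as [n Hn2].
  destruct (G n) as [N HN]. pose proof (HB N). lra.
Qed.

Lemma zsum_sum_n (f : Z -> R) N : zsum f (S N) =
  sum_n (fun n => f (Z.of_nat n)) N + sum_n (fun n => f (- Z.of_nat (S n))%Z) N.
Proof.
  induction N as [|N IH].
  - rewrite !sum_O. cbn [zsum]. ring.
  - rewrite !sum_Sn. cbn [zsum] in *. cbn in *. lra.
Qed.

Lemma ex_seriesZ_zsum (f : Z -> R) :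
  (forall k, 0 <= f k) -> ex_seriesZ f ->
  (forall N, zsum f N <= SeriesZ f) /\
  (forall B, (forall N, zsum f N <= B) -> SeriesZ f <= B).
Proof.
  intros H0 [H1 H2].
  pose proof (Series_correct _ H1) as L1. pose proof (Series_correct _ H2) as L2.
  assert (L : is_lim_seq (fun N => zsum f (S N)) (SeriesZ f)).
  { apply is_lim_seq_ext with (fun N => sum_n (fun n => f (Z.of_nat n)) N
      + sum_n (fun n => f (- Z.of_nat (S n))%Z) N).
    - intros N; now rewrite zsum_sum_n.
    - apply (is_lim_seq_plus' _ _ _ _ L1 L2). }
  split.
  - intros N.
    apply Rle_trans with (zsum f (S N)); [apply zsum_mono; auto|].
    apply (is_lim_seq_incr_compare _ _ L).
    intros n. apply zsum_mono; auto.
  - intros B HB.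
    apply (is_lim_seq_le _ _ (SeriesZ f) B (fun n => HB (S n)) L).
    apply is_lim_seq_const.
Qed.

Lemma zsum_ex_seriesZ (f : Z -> R) B :
  (forall k, 0 <= f k) -> (forall N, zsum f N <= B) -> ex_seriesZ f.
Proof.
  intros H0 HB.
  assert (K : forall g : nat -> R, (forall n, 0 <= g n) ->
     (forall n, sum_n g n <= B) -> ex_series g).
  { intros g Hg Hb.
    destruct (ex_finite_lim_seq_incr (sum_n g) B) as [l Hl].
    - intros n. rewrite sum_Sn. unfold plus; simpl. pose proof (Hg (S n)); lra.
    - exact Hb.
    - exists l. exact Hl. }
  assert (P : forall g : nat -> R, (forall n, 0 <= g n) -> forall n, 0 <= sum_n g n).
  { intros g Hg n; induction n as [|n IH]; [rewrite sum_O; auto|].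
    rewrite sum_Sn. unfold plus; simpl. pose proof (Hg (S n)); lra. }
  split; apply K; auto; intros n; pose proof (HB (S n)) as Hb; rewrite zsum_sum_n in Hb.
  - pose proof (P (fun n => f (- Z.of_nat (S n))%Z) (fun n => H0 _) n). lra.
  - pose proof (P (fun n => f (Z.of_nat n)) (fun n => H0 _) n). lra.
Qed.

Lemma csum_diff_le (f : Z -> C) N L : (N <= L)%nat ->
  Cmod (Cminus (csum f L) (csum f N)) <=
  zsum (fun k => Cmod (f k)) L - zsum (fun k => Cmod (f k)) N.
Proof.
  intros HL; induction HL as [|L HL IH].
  - replace (Cminus (csum f N) (csum f N)) with (RtoC 0) by ring. rewrite Cmod_0. lra.
  - rewrite csum_S. cbn [zsum].
    set (t := Cplus (f (Z.of_nat L)) (f (- Z.of_nat (S L))%Z)).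
    assert (Ht : Cmod t <= Cmod (f (Z.of_nat L)) + Cmod (f (- Z.of_nat (S L))%Z))
      by apply Cmod_triangle.
    replace (Cminus (Cplus (csum f L) t) (csum f N)) with
      (Cplus (Cminus (csum f L) (csum f N)) t) by ring.
    eapply Rle_trans; [apply Cmod_triangle|]. lra.
Qed.

Definition clim (u : nat -> C) (l : C) : Prop :=
  is_lim_seq (fun n => fst (u n)) (fst l) /\ is_lim_seq (fun n => snd (u n)) (snd l).

Lemma is_lim_seq_eps (u : nat -> R) (l : R) :
  (forall eps, 0 < eps -> exists N0, forall N, (N0 <= N)%nat -> Rabs (u N - l) <= eps) ->
  is_lim_seq u l.
Proof.
  intros H. apply is_lim_seq_Reals. intros eps He.
  destruct (H (eps / 2) ltac:(lra)) as [N0 H0]. exists N0. intros n Hn.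
  unfold Rdist. specialize (H0 n Hn). lra.
Qed.

Lemma is_lim_seq_eps_inv (u : nat -> R) (l : R) eps :
  is_lim_seq u l -> 0 < eps -> exists N0, forall N, (N0 <= N)%nat -> Rabs (u N - l) <= eps.
Proof.
  intros H He. apply is_lim_seq_Reals in H. destruct (H eps He) as [N0 H0].
  exists N0. intros n Hn. left. now apply H0.
Qed.

Lemma clim_eps (u : nat -> C) (l : C) :
  (forall eps, 0 < eps -> exists N0, forall N, (N0 <= N)%nat -> Cmod (Cminus (u N) l) <= eps) ->
  clim u l.
Proof.
  intros H; split; apply is_lim_seq_eps; intros eps He;
    destruct (H eps He) as [N0 H0]; exists N0; intros N HN; specialize (H0 N HN);
    (eapply Rle_trans; [|exact H0]).
  - apply (fst_le_Cmod (Cminus (u N) l)).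
  - apply (snd_le_Cmod (Cminus (u N) l)).
Qed.

Lemma clim_eps_inv (u : nat -> C) (l : C) eps : clim u l -> 0 < eps ->
  exists N0, forall N, (N0 <= N)%nat -> Cmod (Cminus (u N) l) <= eps.
Proof.
  intros [H1 H2] He.
  destruct (is_lim_seq_eps_inv _ _ (eps / 2) H1 ltac:(lra)) as [N1 K1].
  destruct (is_lim_seq_eps_inv _ _ (eps / 2) H2 ltac:(lra)) as [N2 K2].
  exists (N1 + N2)%nat. intros N HN.
  specialize (K1 N ltac:(lia)). specialize (K2 N ltac:(lia)).
  eapply Rle_trans; [apply Cmod_le_sum|].
  change (Rabs (fst (u N) - fst l) + Rabs (snd (u N) - snd l) <= eps). lra.
Qed.

Lemma series_tail_bound (c g : Z -> C) (l : C) B N tail :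
  0 <= B -> (forall j, Cmod (g j) <= B) ->
  clim (fun N => csum (fun j => Cmult (c j) (g j)) N) l ->
  (forall L, (N <= L)%nat -> zsum (fun j => Cmod (c j)) L - zsum (fun j => Cmod (c j)) N <= tail) ->
  Cmod (Cminus l (csum (fun j => Cmult (c j) (g j)) N)) <= B * tail.
Proof.
  intros HB Hg Hl Ht. apply Rnot_lt_le. intros Hlt.
  set (S := csum (fun j => Cmult (c j) (g j))) in *.
  set (d := Cmod (Cminus l (S N)) - B * tail).
  destruct (clim_eps_inv _ _ (d / 2) Hl) as [N0 H0]; [unfold d; lra|].
  set (L := (N + N0)%nat). specialize (H0 L ltac:(unfold L; lia)).
  assert (K : Cmod (Cminus (S L) (S N)) <= B * tail).
  { eapply Rle_trans; [apply csum_diff_le; unfold L; lia|].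
    eapply Rle_trans; [|apply Rmult_le_compat_l; [exact HB|apply (Ht L); unfold L; lia]].
    set (D := fun j => B * Cmod (c j) - Cmod (Cmult (c j) (g j))).
    assert (HD : zsum D N <= zsum D L).
    { apply zsum_mono; [|unfold L; lia]. intros j. unfold D. rewrite Cmod_mult.
      pose proof (Hg j). pose proof (Cmod_ge_0 (c j)). nra. }
    unfold D in HD. rewrite !zsum_minus, !zsum_scal in HD. lra. }
  assert (T : Cmod (Cminus l (S N)) <= Cmod (Cminus (S L) l) + Cmod (Cminus (S L) (S N))).
  { replace (Cminus l (S N)) with (Cplus (Copp (Cminus (S L) l)) (Cminus (S L) (S N))) by ring.
    eapply Rle_trans; [apply Cmod_triangle|]. rewrite Cmod_opp. lra. }
  unfold d in *. lra.
Qed.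

(** * Normalised integrals over one period *)

(** Continuity is only asked on [-pi, pi]: the quotient in Dirichlet's argument
    is singular at the other points of 2 pi Z. *)
Definition cont (f : R -> R) : Prop :=
  forall x, - PI <= x <= PI -> continuous f x.

Definition ccont (F : R -> C) : Prop :=
  cont (fun x => fst (F x)) /\ cont (fun x => snd (F x)).

Definition mean (f : R -> R) : R := RInt f (- PI) PI / (2 * PI).

Definition cmean (F : R -> C) : C :=
  (mean (fun x => fst (F x)), mean (fun x => snd (F x))).

Lemma cont_const c : cont (fun _ => c).
Proof. intros x _; apply continuous_const. Qed.

Lemma cont_plus f g : cont f -> cont g -> cont (fun x => f x + g x).
Proof. intros Hf Hg x Hx; apply (continuous_plus f g); auto. Qed.

Lemma cont_mult f g : cont f -> cont g -> cont (fun x => f x * g x).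
Proof. intros Hf Hg x Hx; apply (continuous_mult f g); auto. Qed.

Lemma cont_opp f : cont f -> cont (fun x => - f x).
Proof. intros Hf x Hx; apply (continuous_opp f); auto. Qed.

Lemma cont_minus f g : cont f -> cont g -> cont (fun x => f x - g x).
Proof. intros Hf Hg; apply cont_plus; auto using cont_opp. Qed.

Lemma cont_pow2 f : cont f -> cont (fun x => f x ^ 2).
Proof. intros Hf. simpl. apply cont_mult; auto. apply cont_mult; auto using cont_const. Qed.

Lemma cont_derivable f : (forall x, ex_derive f x) -> cont f.
Proof. intros H x _. now apply (ex_derive_continuous f). Qed.

Lemma cont_ext f g : (forall x, f x = g x) -> cont f -> cont g.
Proof.
  intros H Hf. replace g with f; [exact Hf|]. now apply functional_extensionality.
Qed.

Lemma cont_zsum (f : Z -> R -> R) N :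
  (forall k, cont (f k)) -> cont (fun x => zsum (fun k => f k x) N).
Proof.
  intros H; induction N as [|N IH]; cbn [zsum]; auto using cont_const, cont_plus.
Qed.

Lemma ccont_const c : ccont (fun _ => c).
Proof. split; apply cont_const. Qed.

Lemma ccont_plus F G : ccont F -> ccont G -> ccont (fun x => Cplus (F x) (G x)).
Proof. intros [] []; split; simpl; auto using cont_plus. Qed.

Lemma ccont_mult F G : ccont F -> ccont G -> ccont (fun x => Cmult (F x) (G x)).
Proof. intros [] []; split; simpl; auto using cont_plus, cont_mult, cont_minus. Qed.

Lemma ccont_conj F : ccont F -> ccont (fun x => Cconj (F x)).
Proof. intros []; split; simpl; auto using cont_opp. Qed.

Lemma ccont_real f : cont f -> ccont (fun x => RtoC (f x)).
Proof. intros; split; simpl; auto using cont_const. Qed.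

Lemma ccont_csum (F : Z -> R -> C) N :
  (forall k, ccont (F k)) -> ccont (fun x => csum (fun k => F k x) N).
Proof.
  intros H; split; simpl; apply cont_zsum; intros k; apply H.
Qed.

Lemma cont_Cmod2 F : ccont F -> cont (fun x => Cmod (F x) ^ 2).
Proof.
  intros [H1 H2].
  apply cont_ext with (fun x => fst (F x) ^ 2 + snd (F x) ^ 2).
  - intros x; now rewrite Cmod2.
  - auto using cont_plus, cont_pow2.
Qed.

Create HintDb cont.
#[local] Hint Resolve cont_const cont_plus cont_mult cont_opp cont_minus cont_pow2 cont_zsum
  ccont_const ccont_plus ccont_mult ccont_conj ccont_real ccont_csum cont_Cmod2 : cont.

Lemma twoPI_pos : 0 < 2 * PI.
Proof. pose proof PI_RGT_0; lra. Qed.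

Lemma cont_ex_RInt f : cont f -> ex_RInt f (- PI) PI.
Proof.
  intros H. apply (@ex_RInt_continuous R_CompleteNormedModule f). intros z.
  pose proof PI_RGT_0. rewrite Rmin_left, Rmax_right by lra. apply H.
Qed.

Lemma mean_plus f g : cont f -> cont g -> mean (fun x => f x + g x) = mean f + mean g.
Proof.
  intros Hf Hg. unfold mean.
  rewrite (RInt_plus f g) by now apply cont_ex_RInt.
  unfold plus; simpl. field. pose proof PI_RGT_0; lra.
Qed.

Lemma mean_scal c f : cont f -> mean (fun x => c * f x) = c * mean f.
Proof.
  intros Hf. unfold mean.
  replace (RInt (fun x => c * f x) (- PI) PI) with (c * RInt f (- PI) PI)
    by (symmetry; apply (RInt_scal (V := R_CompleteNormedModule) f);
        now apply cont_ex_RInt).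
  field. pose proof PI_RGT_0; lra.
Qed.

Lemma mean_const c : mean (fun _ => c) = c.
Proof.
  unfold mean. rewrite RInt_const. unfold scal; simpl; unfold mult; simpl.
  field. pose proof PI_RGT_0; lra.
Qed.

Lemma mean_opp f : cont f -> mean (fun x => - f x) = - mean f.
Proof.
  intros Hf. replace (- mean f) with (-1 * mean f) by ring. rewrite <- mean_scal by exact Hf.
  f_equal. apply functional_extensionality; intros; ring.
Qed.

Lemma mean_minus f g : cont f -> cont g -> mean (fun x => f x - g x) = mean f - mean g.
Proof.
  intros Hf Hg. unfold Rminus. rewrite (mean_plus f (fun x => - g x)), mean_opp;
  auto with cont.
Qed.

Lemma mean_ext f g : (forall x, - PI <= x <= PI -> f x = g x) -> mean f = mean g.
Proof.
  intros H. unfold mean. f_equal. apply RInt_ext. intros x.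
  pose proof PI_RGT_0. rewrite Rmin_left, Rmax_right by lra.
  intros Hx; apply H; lra.
Qed.

Lemma mean_le f g : cont f -> cont g ->
  (forall x, - PI <= x <= PI -> f x <= g x) -> mean f <= mean g.
Proof.
  intros Hf Hg H. unfold mean. pose proof PI_RGT_0.
  apply Rmult_le_compat_r; [left; apply Rinv_0_lt_compat; lra|].
  apply RInt_le; auto using cont_ex_RInt; [lra|].
  intros x Hx; apply H; lra.
Qed.

Lemma mean_zsum (f : Z -> R -> R) N :
  (forall k, cont (f k)) ->
  mean (fun x => zsum (fun k => f k x) N) = zsum (fun k => mean (f k)) N.
Proof.
  intros H; induction N as [|N IH]; cbn [zsum]; [apply mean_const|].
  rewrite mean_plus, mean_plus, IH; auto with cont.
Qed.

Lemma mean_abs_le f B : cont f -> (forall x, - PI <= x <= PI -> Rabs (f x) <= B) ->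
  Rabs (mean f) <= B.
Proof.
  intros Hf H. apply Rabs_le. split.
  - rewrite <- (mean_const (- B)). apply mean_le; auto with cont.
    intros x Hx. specialize (H x Hx). apply Rabs_le_between in H. lra.
  - rewrite <- (mean_const B). apply mean_le; auto with cont.
    intros x Hx. specialize (H x Hx). apply Rabs_le_between in H. lra.
Qed.

Lemma cmean_plus F G : ccont F -> ccont G ->
  cmean (fun x => Cplus (F x) (G x)) = Cplus (cmean F) (cmean G).
Proof. intros [] []; cpair; apply mean_plus; auto. Qed.

Lemma cmean_scal c F : ccont F -> cmean (fun x => Cmult c (F x)) = Cmult c (cmean F).
Proof.
  intros [H1 H2]; cpair.
  - rewrite mean_minus, !mean_scal; auto with cont.
  - rewrite mean_plus, !mean_scal; auto with cont.
Qed.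

Lemma cmean_ext F G : (forall x, - PI <= x <= PI -> F x = G x) -> cmean F = cmean G.
Proof. intros H; cpair; apply mean_ext; intros x Hx; now rewrite H. Qed.

Lemma cmean_csum (F : Z -> R -> C) N :
  (forall k, ccont (F k)) ->
  cmean (fun x => csum (fun k => F k x) N) = csum (fun k => cmean (F k)) N.
Proof.
  intros H; cpair;
  [apply (mean_zsum (fun k x => fst (F k x)))|apply (mean_zsum (fun k x => snd (F k x)))];
  intros k; apply H.
Qed.

Lemma cmean_mod_le F B : ccont F -> (forall x, - PI <= x <= PI -> Cmod (F x) <= B) ->
  Cmod (cmean F) <= 2 * B.
Proof.
  intros [H1 H2] HB. eapply Rle_trans; [apply Cmod_le_sum|]. simpl.
  assert (Rabs (mean (fun x => fst (F x))) <= B).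
  { apply mean_abs_le; auto. intros x Hx.
    eapply Rle_trans; [apply fst_le_Cmod|auto]. }
  assert (Rabs (mean (fun x => snd (F x))) <= B).
  { apply mean_abs_le; auto. intros x Hx.
    eapply Rle_trans; [apply snd_le_Cmod|auto]. }
  lra.
Qed.

(** * Exponentials and trigonometric polynomials *)

Definition expi (k : Z) (x : R) : C := (cos (IZR k * x), sin (IZR k * x)).

Lemma expi_plus k j x : Cmult (expi k x) (expi j x) = expi (k + j) x.
Proof.
  unfold expi, Cmult; simpl. rewrite plus_IZR, Rmult_plus_distr_r, cos_plus, sin_plus.
  f_equal; ring.
Qed.

Lemma expi_conj k x : Cconj (expi k x) = expi (- k) x.
Proof.
  unfold expi, Cconj; simpl. rewrite opp_IZR.
  replace (- IZR k * x) with (- (IZR k * x)) by ring.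
  now rewrite cos_neg, sin_neg.
Qed.

Lemma expi_0 x : expi 0 x = RtoC 1.
Proof. unfold expi. rewrite Rmult_0_l, cos_0, sin_0. reflexivity. Qed.

Lemma expi_mod2 k x : Cmod (expi k x) ^ 2 = 1.
Proof.
  rewrite Cmod2; simpl. pose proof (sin2_cos2 (IZR k * x)) as H.
  unfold Rsqr in H. lra.
Qed.

Lemma expi_mod k x : Cmod (expi k x) = 1.
Proof.
  pose proof (expi_mod2 k x) as H. pose proof (Cmod_ge_0 (expi k x)). nra.
Qed.

Lemma cont_cos c : cont (fun x => cos (c * x)).
Proof. apply cont_derivable. intros x. auto_derive. exact I. Qed.
#[local] Hint Resolve cont_cos : cont.

Lemma cont_sin c : cont (fun x => sin (c * x)).
Proof. apply cont_derivable. intros x. auto_derive. exact I. Qed.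
#[local] Hint Resolve cont_sin : cont.

Lemma ccont_expi k : ccont (expi k).
Proof. split; [apply cont_cos|apply cont_sin]. Qed.
#[local] Hint Resolve ccont_expi : cont.

Lemma sin_IZR_PI k : sin (IZR k * PI) = 0.
Proof. apply sin_eq_0_1. now exists k. Qed.

Lemma mean_is_derive (f df : R -> R) :
  (forall x, is_derive f x (df x)) -> cont df ->
  mean df = (f PI - f (- PI)) / (2 * PI).
Proof.
  intros H Hc. unfold mean. f_equal.
  apply is_RInt_unique. apply (is_RInt_derive f df); intros x; auto.
  pose proof PI_RGT_0. rewrite Rmin_left, Rmax_right by lra. auto.
Qed.

Lemma cmean_expi k : cmean (expi k) = if Z.eq_dec k 0 then RtoC 1 else RtoC 0.
Proof.
  destruct (Z.eq_dec k 0) as [->|Hk].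
  - cpair.
    + transitivity (mean (fun _ => 1)); [|apply mean_const]. apply mean_ext.
      intros x _. now rewrite Rmult_0_l, cos_0.
    + transitivity (mean (fun _ => 0)); [|apply mean_const]. apply mean_ext.
      intros x _. now rewrite Rmult_0_l, sin_0.
  - apply IZR_ne0 in Hk. pose proof PI_RGT_0. cpair.
    + rewrite (mean_is_derive (fun x => sin (IZR k * x) / IZR k)).
      * replace (IZR k * - PI) with (IZR (- k) * PI) by (rewrite opp_IZR; ring).
        rewrite !sin_IZR_PI. field. lra.
      * intros x. auto_derive; auto. now field.
      * apply cont_cos.
    + rewrite (mean_is_derive (fun x => - cos (IZR k * x) / IZR k)).
      * replace (IZR k * - PI) with (- (IZR k * PI)) by ring.
        rewrite cos_neg. field. lra.
      * intros x. auto_derive; auto. now field.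
      * apply cont_sin.
Qed.

Definition trigpoly (c : Z -> C) (N : nat) (x : R) : C :=
  csum (fun j => Cmult (c j) (expi j x)) N.

Definition fhat (F : R -> C) (k : Z) : C := cmean (fun x => Cmult (F x) (expi (- k) x)).

Lemma ccont_trigpoly c N : ccont (trigpoly c N).
Proof. apply ccont_csum. intros k. apply ccont_mult; auto with cont. Qed.
#[local] Hint Resolve ccont_trigpoly : cont.

Lemma cmean_conj_trigpoly F g N : ccont F ->
  cmean (fun x => Cmult (F x) (Cconj (trigpoly g N x))) =
  csum (fun k => Cmult (fhat F k) (Cconj (g k))) N.
Proof.
  intros HF.
  transitivity (cmean (fun x => csum (fun k => Cmult (Cconj (g k)) (Cmult (F x) (expi (- k) x))) N)).
  - apply cmean_ext. intros x _. unfold trigpoly. rewrite <- csum_conj, <- csum_scal.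
    apply csum_ext. intros k _. rewrite <- expi_conj. cpair; ring.
  - rewrite (cmean_csum (fun k x => Cmult (Cconj (g k)) (Cmult (F x) (expi (- k) x)))).
    + apply csum_ext. intros k _.
      rewrite (cmean_scal (Cconj (g k)) (fun x => Cmult (F x) (expi (- k) x))).
      * fold (fhat F k). apply Cmult_comm.
      * auto with cont.
    + intros k. auto with cont.
Qed.

Lemma fhat_trigpoly c N k : fhat (trigpoly c N) k = trunc (RtoC 0) N c k.
Proof.
  unfold fhat, trigpoly.
  transitivity (cmean (fun x => csum (fun j => Cmult (c j) (expi (j - k) x)) N)).
  - apply cmean_ext. intros x _. rewrite Cmult_comm, <- csum_scal. apply csum_ext.
    intros j _. 
    replace (j - k)%Z with (j + - k)%Z by lia. rewrite <- expi_plus. ring.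
  - rewrite (cmean_csum (fun j x => Cmult (c j) (expi (j - k) x)))
      by (intros; auto with cont).
    rewrite (csum_ext _ (fun j => Cmult (c j) (if Z.eq_dec (j - k) 0 then RtoC 1 else RtoC 0))).
    2:{ intros j _. rewrite (cmean_scal (c j) (expi (j - k))), cmean_expi by apply ccont_expi. reflexivity. }
    rewrite (csum_single _ k).
    + destruct (inwin_dec N k) as [Hk|Hk].
      * rewrite !trunc_in by exact Hk. destruct Z.eq_dec; [ring|lia].
      * now rewrite !trunc_out.
    + intros j Hj. destruct Z.eq_dec; [lia|ring].
Qed.

Lemma Parseval_trigpoly c N : mean (fun x => Cmod (trigpoly c N x) ^ 2) = zsum (fun k => Cmod (c k) ^ 2) N.
Proof.
  transitivity (fst (cmean (fun x => Cmult (trigpoly c N x) (Cconj (trigpoly c N x))))).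
  - unfold cmean; cbn [fst]. apply mean_ext. intros x _. rewrite Cmult_conj_re, Cmod2. ring.
  - rewrite cmean_conj_trigpoly by apply ccont_trigpoly. unfold csum; cbn [fst].
    apply zsum_ext. intros k Hk.
    rewrite fhat_trigpoly, trunc_in, Cmult_conj_re, Cmod2 by exact Hk. ring.
Qed.

(** Weighted Bessel inequality.  Let [T] be the trigonometric polynomial built from
    the Fourier coefficients of [f F] itself.  The left-hand side is both the pairing
    of [f F] with [T] and the mean of [|T|^2]; since [f^2 <= M f], pointwise
    [2 f Re(F conj T) <= M f |F|^2 + |T|^2], so it is at most half of the right-hand
    side plus half of itself. *)
Lemma weighted_Bessel (f : R -> R) (F : R -> C) M K :
  cont f -> ccont F -> 0 < M ->
  (forall x, - PI <= x <= PI -> 0 <= f x <= M) ->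
  zsum (fun k => Cmod (fhat (fun x => Cmult (RtoC (f x)) (F x)) k) ^ 2) K
  <= M * mean (fun x => f x * Cmod (F x) ^ 2).
Proof.
  intros Hf HF HM HfM. set (w := fhat (fun x => Cmult (RtoC (f x)) (F x))).
  assert (HfF : ccont (fun x => Cmult (RtoC (f x)) (F x)))
    by auto with cont.
  assert (S1 : zsum (fun k => Cmod (w k) ^ 2) K =
    fst (cmean (fun x => Cmult (Cmult (RtoC (f x)) (F x)) (Cconj (trigpoly w K x))))).
  { rewrite cmean_conj_trigpoly by exact HfF. unfold csum; cbn [fst]. apply zsum_ext.
    intros k _. fold w. rewrite Cmult_conj_re, Cmod2. ring. }
  assert (HT := ccont_trigpoly w K).
  assert (S2 : fst (cmean (fun x => Cmult (Cmult (RtoC (f x)) (F x)) (Cconj (trigpoly w K x))))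
    <= / 2 * (M * mean (fun x => f x * Cmod (F x) ^ 2) + zsum (fun k => Cmod (w k) ^ 2) K)).
  { unfold cmean; cbn [fst]. rewrite <- Parseval_trigpoly.
    rewrite <- mean_scal by auto with cont.
    rewrite <- mean_plus by auto with cont.
    rewrite <- mean_scal by auto with cont.
    apply mean_le.
    - exact (proj1 (ccont_mult _ _ HfF (ccont_conj _ HT))).
    - auto 12 with cont.
    - intros x Hx. destruct (HfM x Hx) as [f0 fM]. rewrite !Cmod2.
      generalize (F x) (trigpoly w K x); intros [p q] [r s]; simpl.
      set (a := f x) in *.
      (* expand (a F - T)^2 >= 0 componentwise, then use a^2 <= M a *)
      assert (H1 : a * a <= M * a) by nra.
      pose proof (pow2_ge_0 (a * p - r)). pose proof (pow2_ge_0 (a * q - s)).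
      assert (a * a * (p * p) <= M * a * (p * p)) by (apply Rmult_le_compat_r; nra).
      assert (a * a * (q * q) <= M * a * (q * q)) by (apply Rmult_le_compat_r; nra).
      nra. }
  lra.
Qed.

Lemma Bessel (F : R -> C) K : ccont F ->
  zsum (fun k => Cmod (fhat F k) ^ 2) K <= mean (fun x => Cmod (F x) ^ 2).
Proof.
  intros HF.
  pose proof (weighted_Bessel (fun _ => 1) F 1 K (cont_const 1) HF Rlt_0_1) as H.
  cbv beta in H.
  replace (fun x => Cmult (RtoC 1) (F x)) with F in H
    by (apply functional_extensionality; intros; ring).
  rewrite Rmult_1_l in H.
  replace (fun x => 1 * Cmod (F x) ^ 2) with (fun x => Cmod (F x) ^ 2) in H
    by (apply functional_extensionality; intros; ring).
  apply H. intros; lra.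
Qed.

(** The coefficients are square summable by Bessel, hence tend to 0. *)
Lemma Riemann_Lebesgue (q : R -> R) eps : cont q -> 0 < eps ->
  exists N0, forall N, (N0 <= N)%nat -> Rabs (mean (fun x => q x * sin (INR N * x))) <= eps.
Proof.
  intros Hq He.
  set (f := fun k => Cmod (fhat (fun x => RtoC (q x)) k) ^ 2).
  destruct (zsum_cauchy f (mean (fun x => Cmod (RtoC (q x)) ^ 2)) (eps ^ 2)) as [N0 H0].
  - intros; apply Cmod2_ge_0.
  - intros N. apply (Bessel (fun x => RtoC (q x))). now apply ccont_real.
  - now apply pow_lt.
  - exists N0. intros N HN.
    pose proof (H0 (S N) ltac:(lia)) as H1. cbn [zsum] in H1.
    pose proof (zsum_mono f N0 N (fun _ => Cmod2_ge_0 _) HN) as H2.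
    assert (H3 : f (Z.of_nat N) <= eps ^ 2).
    { pose proof (Cmod2_ge_0 (fhat (fun x => RtoC (q x)) (- Z.of_nat (S N)))) as H4.
      unfold f in *. lra. }
    unfold f in H3. apply Cmod_le_of_sq in H3; [|lra].
    eapply Rle_trans; [|exact H3].
    eapply Rle_trans; [|apply snd_le_Cmod]. simpl.
    rewrite <- (Rabs_Ropp (mean (fun x => q x * sin (INR N * x)))).
    rewrite <- mean_opp by (apply cont_mult; auto with cont).
    apply Req_le. f_equal. apply mean_ext. intros x _.
    rewrite opp_IZR, <- INR_IZR_INZ.
    replace (- INR N * x) with (- (INR N * x)) by ring. rewrite sin_neg. ring.
Qed.

Lemma mean_pos f x0 : cont f -> (forall x, - PI <= x <= PI -> 0 <= f x) ->
  - PI < x0 < PI -> 0 < f x0 -> 0 < mean f.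
Proof.
  intros Hf H0 Hx0 Hp. unfold mean. apply Rdiv_lt_0_compat; [|apply twoPI_pos].
  pose proof (Hf x0 ltac:(lra)) as Hc.
  assert (Hl : locally x0 (fun x => f x0 / 2 < f x)).
  { apply (Hc (fun y => f x0 / 2 < y)). apply (open_gt (f x0 / 2)). simpl. lra. }
  destruct Hl as [d Hd].
  set (r := Rmin (d / 2) (Rmin (x0 + PI) (PI - x0))).
  assert (Hr : 0 < r).
  { unfold r. destruct d as [d Hd']; simpl. repeat apply Rmin_glb_lt; lra. }
  assert (r <= d / 2) by apply Rmin_l.
  assert (r <= x0 + PI) by (eapply Rle_trans; [apply Rmin_r|apply Rmin_l]).
  assert (r <= PI - x0) by (eapply Rle_trans; [apply Rmin_r|apply Rmin_r]).
  assert (Hex : forall u v, - PI <= u -> u <= v -> v <= PI -> ex_RInt f u v).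
  { intros u v Hu Huv Hv. apply (@ex_RInt_continuous R_CompleteNormedModule f). intros z.
    rewrite Rmin_left, Rmax_right by lra. intros; apply Hf; lra. }
  rewrite <- (RInt_Chasles f (- PI) (x0 - r) PI) by (apply Hex; lra).
  rewrite <- (RInt_Chasles f (x0 - r) (x0 + r) PI) by (apply Hex; lra).
  unfold plus; simpl.
  assert (0 <= RInt f (- PI) (x0 - r)).
  { apply RInt_ge_0; [lra|apply Hex; lra|]. intros; apply H0; lra. }
  assert (0 <= RInt f (x0 + r) PI).
  { apply RInt_ge_0; [lra|apply Hex; lra|]. intros; apply H0; lra. }
  assert (0 < RInt f (x0 - r) (x0 + r)).
  { apply RInt_gt_0; [lra| |intros; apply Hf; lra].
    intros x Hx. apply Rlt_trans with (f x0 / 2); [lra|]. apply Hd.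
    unfold ball; simpl; unfold AbsRing_ball, abs, minus, plus, opp; simpl.
    apply Rabs_def1; destruct d as [d Hd']; simpl in *; lra. }
  lra.
Qed.

(** * Fourier inversion for test functions *)

(** Hadamard quotient at 0, extended by the derivative so that it is continuous. *)
Definition slope (f : R -> R) (y : R) : R :=
  if Req_EM_T y 0 then Derive f 0 else (f y - f 0) / y.

Lemma slope_eq f y : f y - f 0 = y * slope f y.
Proof.
  unfold slope. destruct Req_EM_T as [->|H]; [ring|now field].
Qed.

Lemma slope_continuous f y : (forall x, ex_derive f x) -> continuous (slope f) y.
Proof.
  intros Hf. destruct (Req_EM_T y 0) as [->|Hy].
  - apply continuity_pt_filterlim.
    intros eps He.
    assert (D : derivable_pt_lim f 0 (Derive f 0))
      by (apply is_derive_Reals, Derive_correct, Hf).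
    destruct (D eps He) as [d Hd].
    exists d. split; [apply d|]. intros x [_ Hx].
    simpl in *. unfold Rdist in *. rewrite Rminus_0_r in Hx.
    unfold slope. destruct (Req_EM_T 0 0) as [_|n]; [|lra].
    destruct (Req_EM_T x 0) as [->|Hx0].
    + rewrite Rminus_diag. now rewrite Rabs_R0.
    + specialize (Hd x Hx0 Hx). now rewrite Rplus_0_l in Hd.
  - apply continuous_ext_loc with (fun y => (f y - f 0) / y).
    + assert (Hp : 0 < Rabs y) by now apply Rabs_pos_lt.
      exists (mkposreal _ Hp). intros z Hz.
      unfold ball in Hz; simpl in Hz; unfold AbsRing_ball, abs, minus, plus, opp in Hz;
        simpl in Hz.
      unfold slope. destruct Req_EM_T as [->|]; [|reflexivity].
      exfalso. rewrite Rplus_0_l, Rabs_Ropp in Hz. lra.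
    + apply (ex_derive_continuous (fun y => (f y - f 0) / y)).
      auto_derive. repeat split; auto.
Qed.

Lemma cont_div f g : cont f -> cont g -> (forall x, - PI <= x <= PI -> g x <> 0) ->
  cont (fun x => f x / g x).
Proof.
  intros Hf Hg Hn x Hx. apply (continuous_mult f (fun x => / g x)); [auto|].
  apply (continuous_Rinv_comp g); auto.
Qed.

Lemma Dirichlet_cos N y :
  zsum (fun j => cos (IZR j * y)) N * sin (y / 2) = cos (y / 2) * sin (INR N * y).
Proof.
  induction N as [|N IH]; [cbn [zsum]; replace (INR 0 * y) with 0 by (simpl; ring); rewrite sin_0; ring|].
  cbn [zsum]. rewrite Rmult_plus_distr_r, IH, opp_IZR, <- !INR_IZR_INZ, !S_INR.
  replace (- (INR N + 1) * y) with (- (INR N * y + y)) by ring.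
  replace ((INR N + 1) * y) with (INR N * y + y) by ring.
  rewrite cos_neg, sin_plus, cos_plus.
  replace (cos y) with (cos (2 * (y / 2))) by (f_equal; field).
  replace (sin y) with (sin (2 * (y / 2))) by (f_equal; field).
  rewrite cos_2a, sin_2a. pose proof (sin2_cos2 (y / 2)) as H. unfold Rsqr in H.
  set (s := sin (y / 2)) in *. set (c := cos (y / 2)) in *.
  set (p := sin (INR N * y)). set (q := cos (INR N * y)).
  apply Rminus_diag_uniq.
  transitivity ((1 - (s * s + c * c)) * (c * p + q * s)); [ring|rewrite H; ring].
Qed.

Lemma Dirichlet_sin N y : zsum (fun j => sin (IZR j * y)) N = - sin (INR N * y).
Proof.
  induction N as [|N IH]; [cbn [zsum]; replace (INR 0 * y) with 0 by (simpl; ring); rewrite sin_0; ring|].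
  cbn [zsum]. rewrite IH, opp_IZR, <- !INR_IZR_INZ.
  replace (- INR (S N) * y) with (- (INR (S N) * y)) by ring.
  rewrite sin_neg. ring.
Qed.

Lemma cont_Dcos N : cont (fun y => zsum (fun j => cos (IZR j * y)) N).
Proof. apply cont_zsum. intros; apply cont_cos. Qed.
#[local] Hint Resolve cont_Dcos : cont.

Lemma mean_Dcos N : (1 <= N)%nat -> mean (fun y => zsum (fun j => cos (IZR j * y)) N) = 1.
Proof.
  intros HN. rewrite (mean_zsum (fun j y => cos (IZR j * y))) by (intros; apply cont_cos).
  change (fst (csum (fun j => cmean (expi j)) N) = 1).
  rewrite (csum_single _ 0%Z).
  - rewrite trunc_in by (unfold inwin; lia). rewrite cmean_expi. reflexivity.
  - intros k Hk. rewrite cmean_expi. destruct Z.eq_dec; [lia|reflexivity].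
Qed.

Lemma slope_half_sine_ne0 y : - PI <= y <= PI -> slope (fun z => sin (z / 2)) y <> 0.
Proof.
  intros Hy. unfold slope. destruct Req_EM_T as [->|Hn].
  - assert (H : Derive (fun z => sin (z / 2)) 0 = / 2).
    { apply is_derive_unique. auto_derive; [exact I|].
      replace (0 * / 2) with 0 by ring. rewrite cos_0. field. }
    rewrite H. lra.
  - replace (0 / 2) with 0 by field. rewrite sin_0, Rminus_0_r.
    intros H. apply Rmult_integral in H. destruct H as [H|H].
    + destruct (Rtotal_order y 0) as [Hl|[He|Hg]]; [|lra|].
      * assert (0 < sin (- y / 2)) by (apply sin_gt_0; lra).
        replace (- y / 2) with (- (y / 2)) in H0 by field. rewrite sin_neg in H0. lra.
      * assert (0 < sin (y / 2)) by (apply sin_gt_0; lra). lra.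
    + revert H. now apply Rinv_neq_0_compat.
Qed.

(** Dirichlet's argument: the kernel is [cos (y/2) sin (N y) / sin (y/2)] up to a
    sine, and [(F y - F 0) / sin (y/2)], a quotient of two slopes, is continuous on
    [-pi, pi]; so the Riemann-Lebesgue lemma applies. *)
Lemma Dirichlet_limit (F : R -> R) eps : (forall x, ex_derive F x) -> 0 < eps ->
  exists N0, forall N, (N0 <= N)%nat ->
    Rabs (mean (fun y => F y * zsum (fun j => cos (IZR j * y)) N) - F 0) <= eps.
Proof.
  intros HF He. set (hs := fun z => sin (z / 2)).
  assert (Hhs : forall x, ex_derive hs x) by (intros x; unfold hs; auto_derive; exact I).
  set (q := fun y => slope F y / slope hs y * cos (y / 2)).
  assert (Hq : cont q).
  { apply (cont_mult (fun y => slope F y / slope hs y)).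
    - apply cont_div.
      + intros x _; now apply slope_continuous.
      + intros x _; now apply slope_continuous.
      + apply slope_half_sine_ne0.
    - apply cont_derivable. intros x. auto_derive. exact I. }
  destruct (Riemann_Lebesgue q eps Hq He) as [N0 H0].
  exists (S N0). intros N HN.
  assert (HcF := cont_derivable F HF).
  replace (F 0) with (mean (fun y => F 0 * zsum (fun j => cos (IZR j * y)) N)).
  2:{ rewrite mean_scal by apply cont_Dcos. rewrite mean_Dcos by lia. ring. }
  rewrite <- mean_minus by auto with cont.
  rewrite (mean_ext _ (fun y => q y * sin (INR N * y))).
  - apply H0. lia.
  - intros y Hy. rewrite <- Rmult_minus_distr_r, slope_eq. unfold q.
    pose proof (slope_half_sine_ne0 y Hy) as Hn.
    pose proof (slope_eq hs y) as Hs. unfold hs at 1 2 in Hs.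
    replace (0 / 2) with 0 in Hs by field. rewrite sin_0, Rminus_0_r in Hs.
    pose proof (Dirichlet_cos N y) as HD. rewrite Hs in HD. fold hs in Hn.
    apply Rmult_eq_reg_r with (slope hs y); [|exact Hn].
    transitivity (slope F y * (zsum (fun j => cos (IZR j * y)) N * (y * slope hs y)));
      [ring|rewrite HD; field; exact Hn].
Qed.

Lemma mean_shift (f : R -> R) x0 :
  (forall x, continuous f x) -> (forall x, f (x + 2 * PI) = f x) ->
  mean (fun y => f (x0 + y)) = mean f.
Proof.
  intros Hc Hp. unfold mean. f_equal.
  assert (Hex : forall u v, ex_RInt f u v)
    by (intros; apply (@ex_RInt_continuous R_CompleteNormedModule f); auto).
  assert (L : forall v a b, RInt (fun y => f (y + v)) a b = RInt f (a + v) (b + v)).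
  { intros v a b.
    pose proof (RInt_comp_lin (V := R_CompleteNormedModule) f 1 v a b (Hex _ _)) as H.
    rewrite !Rmult_1_l in H. rewrite <- H. apply RInt_ext. intros x _.
    unfold scal; simpl; unfold mult; simpl. now rewrite !Rmult_1_l. }
  transitivity (RInt (fun y => f (y + x0)) (- PI) PI).
  { apply RInt_ext. intros; f_equal; ring. }
  rewrite L.
  pose proof (L (2 * PI) (- PI) (- PI + x0)) as H1.
  rewrite (RInt_ext (fun y => f (y + 2 * PI)) f) in H1 by (intros; apply Hp).
  replace (- PI + 2 * PI) with PI in H1 by ring.
  replace (- PI + x0 + 2 * PI) with (PI + x0) in H1 by ring.
  pose proof (RInt_Chasles f (- PI) (- PI + x0) (PI + x0) (Hex _ _) (Hex _ _)) as C1.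
  pose proof (RInt_Chasles f (- PI) PI (PI + x0) (Hex _ _) (Hex _ _)) as C2.
  unfold plus in C1, C2; simpl in C1, C2. lra.
Qed.

Definition tfun (phi : testT) (x : R) : C := (t_re phi x, t_im phi x).

(** Coefficient of [e^{-ijx}] in the Fourier series of [phi]; the sign makes it
    pair with [t_expN j]. *)
Definition tcoef (phi : testT) (j : Z) : C := cmean (fun x => Cmult (tfun phi x) (expi j x)).

Lemma sfun_ex_derive (f : smoothT) x : ex_derive f x.
Proof. apply smooth_ex_derive, (sfunP f). Qed.

Lemma sfun_continuous (f : smoothT) x : continuous f x.
Proof. apply (ex_derive_continuous (sfun f)), sfun_ex_derive. Qed.

Lemma cont_sfun (f : smoothT) : cont f.
Proof. intros x _; apply sfun_continuous. Qed.
#[local] Hint Resolve cont_sfun : cont.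

Lemma ccont_tfun phi : ccont (tfun phi).
Proof. split; apply cont_sfun. Qed.
#[local] Hint Resolve ccont_tfun : cont.

Lemma expi_shift j x0 y : expi j (x0 + y) = Cmult (expi j x0) (expi j y).
Proof.
  unfold expi, Cmult; simpl. rewrite Rmult_plus_distr_l, cos_plus, sin_plus.
  f_equal; ring.
Qed.

(** By periodicity the Dirichlet kernel can be centred at [x0]. *)
Lemma partial_sum_kernel (f : smoothT) x0 N :
  csum (fun j => Cmult (cmean (fun x => Cmult (RtoC (f x)) (expi j x))) (expi (- j) x0)) N =
  (mean (fun y => f (x0 + y) * zsum (fun j => cos (IZR j * y)) N),
   mean (fun y => f (x0 + y) * zsum (fun j => sin (IZR j * y)) N)).
Proof.
  assert (Cf := sfun_continuous f).
  assert (S : forall g : smoothT, mean (fun y => f (x0 + y) * g (x0 + y)) = mean (fun y => f y * g y)).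
  { intros g. apply (mean_shift (s_mult f g)); [apply sfun_continuous|apply (sfunP (s_mult f g))]. }
  assert (Sc := fun j => S (s_cos j)). assert (Ss := fun j => S (s_sin j)).
  cbn [sfun s_cos s_sin] in Sc, Ss.
  assert (Hf : cont (fun y => f (x0 + y))).
  { intros y _. apply (continuous_comp (fun y => x0 + y) f); [|apply Cf].
    apply (ex_derive_continuous (fun y => x0 + y)). auto_derive. exact I. }
  transitivity (csum (fun j => cmean (fun y => Cmult (RtoC (f (x0 + y))) (expi j y))) N).
  - apply csum_ext. intros j _.
    transitivity (Cmult (cmean (fun y => Cmult (RtoC (f (x0 + y))) (expi j (x0 + y)))) (expi (- j) x0)).
    + f_equal. cpair.
      * rewrite (mean_ext _ (fun y => f y * cos (IZR j * y))) by (intros; ring).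
        rewrite <- Sc. apply mean_ext. intros; ring.
      * rewrite (mean_ext _ (fun y => f y * sin (IZR j * y))) by (intros; ring).
        rewrite <- Ss. apply mean_ext. intros; ring.
    + rewrite Cmult_comm.
      assert (Hs : ccont (fun y => Cmult (RtoC (f (x0 + y))) (expi j (x0 + y)))).
      { apply ccont_mult; [now apply ccont_real|].
        split; apply cont_derivable; intros y; simpl; auto_derive; exact I. }
      rewrite <- cmean_scal by exact Hs. apply cmean_ext. intros y _.
      rewrite expi_shift.
      transitivity (Cmult (Cmult (expi (- j) x0) (expi j x0))
                      (Cmult (RtoC (f (x0 + y))) (expi j y))); [ring|].
      rewrite expi_plus. replace (- j + j)%Z with 0%Z by lia. rewrite expi_0. ring.
  - cpair.
    + rewrite <- (mean_zsum (fun j y => f (x0 + y) * cos (IZR j * y) - 0 * sin (IZR j * y))).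
      * apply mean_ext. intros y _. rewrite <- zsum_scal. apply zsum_ext. intros; ring.
      * intros j. auto with cont.
    + rewrite <- (mean_zsum (fun j y => f (x0 + y) * sin (IZR j * y) + 0 * cos (IZR j * y))).
      * apply mean_ext. intros y _. rewrite <- zsum_scal. apply zsum_ext. intros; ring.
      * intros j. auto with cont.
Qed.

Lemma real_pointwise (f : smoothT) x0 eps : 0 < eps ->
  exists N0, forall N, (N0 <= N)%nat ->
   Cmod (Cminus (csum (fun j => Cmult (cmean (fun x => Cmult (RtoC (f x)) (expi j x))) (expi (- j) x0)) N)
                (RtoC (f x0))) <= eps.
Proof.
  intros He. set (F := fun y => f (x0 + y)).
  assert (HF : forall y, ex_derive F y).
  { intros y. unfold F. apply (ex_derive_comp f (fun y => x0 + y)).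
    - apply sfun_ex_derive.
    - auto_derive. exact I. }
  destruct (Dirichlet_limit F (eps / 2) HF ltac:(lra)) as [N1 H1].
  destruct (Riemann_Lebesgue F (eps / 2) (cont_derivable F HF) ltac:(lra)) as [N2 H2].
  exists (N1 + N2)%nat. intros N HN. rewrite partial_sum_kernel.
  eapply Rle_trans; [apply Cmod_le_sum|]. simpl.
  specialize (H1 N ltac:(lia)). specialize (H2 N ltac:(lia)).
  replace (F 0) with (f x0) in H1 by (unfold F; f_equal; ring).
  unfold F in *.
  rewrite (mean_ext (fun y => f (x0 + y) * zsum (fun j => sin (IZR j * y)) N)
    (fun y => (-1) * (f (x0 + y) * sin (INR N * y)))).
  2:{ intros y _. rewrite Dirichlet_sin. ring. }
  rewrite mean_scal by (apply (cont_mult F); [exact (cont_derivable F HF)|apply cont_sin]).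
  replace (-1 * mean (fun x => f (x0 + x) * sin (INR N * x)) + -0)
    with (- mean (fun x => f (x0 + x) * sin (INR N * x))) by ring.
  rewrite Rabs_Ropp. unfold Rminus in H1. lra.
Qed.

Lemma tcoef_split phi j : tcoef phi j =
  Cplus (cmean (fun x => Cmult (RtoC (t_re phi x)) (expi j x)))
        (Cmult Ci (cmean (fun x => Cmult (RtoC (t_im phi x)) (expi j x)))).
Proof.
  unfold tcoef.
  rewrite <- cmean_scal by (apply ccont_mult; [apply ccont_real, cont_sfun|apply ccont_expi]).
  rewrite <- cmean_plus.
  - apply cmean_ext. intros x _. cpair; ring.
  - apply ccont_mult; [apply ccont_real, cont_sfun|apply ccont_expi].
  - apply ccont_mult; [apply ccont_const|].
    apply ccont_mult; [apply ccont_real, cont_sfun|apply ccont_expi].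
Qed.

Lemma pointwise_inversion phi x0 eps : 0 < eps ->
  exists N0, forall N, (N0 <= N)%nat ->
   Cmod (Cminus (csum (fun j => Cmult (tcoef phi j) (expi (- j) x0)) N) (tfun phi x0)) <= eps.
Proof.
  intros He.
  destruct (real_pointwise (t_re phi) x0 (eps / 2) ltac:(lra)) as [N1 H1].
  destruct (real_pointwise (t_im phi) x0 (eps / 2) ltac:(lra)) as [N2 H2].
  exists (N1 + N2)%nat. intros N HN.
  specialize (H1 N ltac:(lia)). specialize (H2 N ltac:(lia)).
  set (A := csum _ N) in H1. set (B := csum _ N) in H2.
  replace (csum (fun j => Cmult (tcoef phi j) (expi (- j) x0)) N) with (Cplus A (Cmult Ci B)).
  2:{ unfold A, B. rewrite <- csum_scal, <- csum_plus. apply csum_ext. intros j _.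
      rewrite tcoef_split. ring. }
  replace (Cminus (Cplus A (Cmult Ci B)) (tfun phi x0))
    with (Cplus (Cminus A (RtoC (t_re phi x0))) (Cmult Ci (Cminus B (RtoC (t_im phi x0))))).
  2:{ unfold tfun. cpair; ring. }
  eapply Rle_trans; [apply Cmod_triangle|]. rewrite Cmod_mult.
  replace (Cmod Ci) with 1.
  2:{ symmetry. unfold Cmod, Ci; simpl. replace (0 * (0 * 1) + 1 * (1 * 1)) with 1 by ring.
      apply sqrt_1. }
  lra.
Qed.

Lemma cont_bounded f : cont f -> exists B, 0 < B /\ forall x, - PI <= x <= PI -> Rabs (f x) <= B.
Proof.
  intros Hf.
  destruct (continuity_ab_maj (fun x => f x ^ 2) (- PI) PI) as [M [HM _]].
  - pose proof PI_RGT_0; lra.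
  - intros c Hc. apply continuity_pt_filterlim. now apply (cont_pow2 f).
  - exists (f M ^ 2 + 1). split; [pose proof (pow2_ge_0 (f M)); lra|].
    intros x Hx. specialize (HM x Hx). simpl in HM |- *.
    unfold Rabs; destruct Rcase_abs; nra.
Qed.

Lemma ccont_bounded F : ccont F ->
  exists B, 0 < B /\ forall x, - PI <= x <= PI -> Cmod (F x) <= B.
Proof.
  intros [H1 H2]. destruct (cont_bounded _ H1) as [B1 [P1 K1]].
  destruct (cont_bounded _ H2) as [B2 [P2 K2]].
  exists (B1 + B2). split; [lra|]. intros x Hx.
  eapply Rle_trans; [apply Cmod_le_sum|].
  specialize (K1 x Hx). specialize (K2 x Hx). lra.
Qed.

Lemma tcoef_deriv phi j :
  tcoef (t_deriv phi) j = Cmult (Copp (Cmult Ci (RtoC (IZR j)))) (tcoef phi j).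
Proof.
  assert (D0 : forall (g : smoothT) dg, (forall x, is_derive g x (dg x)) -> cont dg -> mean dg = 0).
  { intros g dg Hg Hc. rewrite (mean_is_derive g dg Hg Hc).
    replace (g PI) with (g (- PI)).
    - field. apply PI_neq0.
    - rewrite <- (proj2 (sfunP g) (- PI)). f_equal. ring. }
  assert (H0 : cmean (fun x => Cplus (Cmult (tfun (t_deriv phi) x) (expi j x))
     (Cmult (Cmult Ci (RtoC (IZR j))) (Cmult (tfun phi x) (expi j x)))) = RtoC 0).
  { assert (Cc : ccont (fun x => Cplus (Cmult (tfun (t_deriv phi) x) (expi j x))
     (Cmult (Cmult Ci (RtoC (IZR j))) (Cmult (tfun phi x) (expi j x))))) by auto 12 with cont.
    destruct Cc as [C1 C2].
    set (u := t_re phi). set (v := t_im phi).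
    cpair.
    - apply (D0 (s_plus (s_mult u (s_cos j)) (s_scal (-1) (s_mult v (s_sin j))))); [|exact C1].
      intros x. simpl. auto_derive; [repeat split; apply sfun_ex_derive|].
      change (fun y : R => u y) with (sfun u). change (fun y : R => v y) with (sfun v).
      simpl. fold u v. ring.
    - apply (D0 (s_plus (s_mult u (s_sin j)) (s_mult v (s_cos j)))); [|exact C2].
      intros x. simpl. auto_derive; [repeat split; apply sfun_ex_derive|].
      change (fun y : R => u y) with (sfun u). change (fun y : R => v y) with (sfun v).
      simpl. fold u v. ring. }
  rewrite cmean_plus, cmean_scal in H0
    by auto 12 with cont.
  fold (tcoef (t_deriv phi) j) (tcoef phi j) in H0.
  transitivity (Cminus (Cplus (tcoef (t_deriv phi) j)
     (Cmult (Cmult Ci (RtoC (IZR j))) (tcoef phi j)))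
     (Cmult (Cmult Ci (RtoC (IZR j))) (tcoef phi j))); [ring|].
  rewrite H0. ring.
Qed.

(** Two integrations by parts suffice for absolute summability. *)
Lemma tcoef_decay phi : exists C, 0 <= C /\
  forall j, j <> 0%Z -> Cmod (tcoef phi j) <= C / IZR j ^ 2.
Proof.
  destruct (ccont_bounded _ (ccont_tfun (t_deriv (t_deriv phi)))) as [B [HB H]].
  exists (2 * B). split; [lra|]. intros j Hj. apply IZR_ne0 in Hj.
  assert (H2 : Cmod (tcoef (t_deriv (t_deriv phi)) j) <= 2 * B).
  { apply cmean_mod_le; [auto with cont|].
    intros x Hx. rewrite Cmod_mult, expi_mod, Rmult_1_r. auto. }
  rewrite !tcoef_deriv in H2.
  replace (Cmult (Copp (Cmult Ci (RtoC (IZR j)))) (Cmult (Copp (Cmult Ci (RtoC (IZR j)))) (tcoef phi j)))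
    with (Cmult (RtoC (- IZR j ^ 2)) (tcoef phi j)) in H2 by (cpair; ring).
  rewrite Cmod_mult, Cmod_R, Rabs_Ropp, Rabs_pos_eq in H2 by apply pow2_ge_0.
  assert (0 < IZR j ^ 2) by now apply pow2_gt_0.
  apply Rmult_le_reg_l with (IZR j ^ 2); [exact H0|].
  replace (IZR j ^ 2 * (2 * B / IZR j ^ 2)) with (2 * B) by (field; exact Hj).
  exact H2.
Qed.

(** Pointwise convergence identifies the limit; the absolutely summable coefficients
    make the convergence uniform. *)
Lemma uniform_inversion phi : exists C, 0 <= C /\ forall N x, (1 <= N)%nat ->
  Cmod (Cminus (csum (fun j => Cmult (tcoef phi j) (expi (- j) x)) N) (tfun phi x)) <= C / INR N.
Proof.
  destruct (tcoef_decay phi) as [C [HC H]]. exists (4 * C). split; [lra|].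
  intros N x HN. rewrite <- Cmod_opp.
  replace (Copp (Cminus (csum (fun j => Cmult (tcoef phi j) (expi (- j) x)) N) (tfun phi x)))
    with (Cminus (tfun phi x) (csum (fun j => Cmult (tcoef phi j) (expi (- j) x)) N)) by ring.
  rewrite <- (Rmult_1_l (4 * C / INR N)).
  apply (series_tail_bound (tcoef phi) (fun j => expi (- j) x)); [lra| | |].
  - intros j. rewrite expi_mod. lra.
  - apply clim_eps. intros eps He. now apply pointwise_inversion.
  - intros L HL. apply decay_tail; auto.
Qed.

Lemma testT_ext (phi psi : testT) :
  (forall x, t_re phi x = t_re psi x) -> (forall x, t_im phi x = t_im psi x) -> phi = psi.
Proof.
  assert (S : forall f g : smoothT, (forall x, f x = g x) -> f = g).
  { intros [f Hf] [g Hg] H. simpl in H.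
    assert (f = g) by now apply functional_extensionality. subst g.
    f_equal. apply proof_irrelevance. }
  destruct phi as [f g], psi as [f' g']; simpl; intros H1 H2. f_equal; now apply S.
Qed.

Definition t_zero : testT := t_scal (RtoC 0) (t_expN 0).

(** Partial sums are needed as test functions, for distributions to act on them. *)
Fixpoint tsum (c : Z -> C) (N : nat) : testT :=
  match N with
  | O => t_zero
  | S n => t_plus (tsum c n)
             (t_plus (t_scal (c (Z.of_nat n)) (t_expN (Z.of_nat n)))
                (t_scal (c (- Z.of_nat (S n))%Z) (t_expN (- Z.of_nat (S n)))))
  end.

Lemma tfun_plus phi psi x : tfun (t_plus phi psi) x = Cplus (tfun phi x) (tfun psi x).
Proof. reflexivity. Qed.

Lemma tfun_scal c phi x : tfun (t_scal c phi) x = Cmult c (tfun phi x).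
Proof. cpair; unfold Re, Im; ring. Qed.

Lemma tfun_expN k x : tfun (t_expN k) x = expi (- k) x.
Proof. rewrite <- expi_conj. cpair; ring. Qed.

Lemma tfun_tsum c N x : tfun (tsum c N) x = csum (fun j => Cmult (c j) (expi (- j) x)) N.
Proof.
  induction N as [|N IH].
  - cbn [tsum]. unfold t_zero. rewrite tfun_scal, csum_0. ring.
  - cbn [tsum]. rewrite csum_S, !tfun_plus, IH, !tfun_scal, !tfun_expN. reflexivity.
Qed.

Lemma tfun_inj phi psi : (forall x, tfun phi x = tfun psi x) -> phi = psi.
Proof.
  intros H. apply testT_ext; intros x.
  - exact (f_equal fst (H x)).
  - exact (f_equal snd (H x)).
Qed.

Lemma t_deriv_plus phi psi : t_deriv (t_plus phi psi) = t_plus (t_deriv phi) (t_deriv psi).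
Proof.
  apply testT_ext; intros x; simpl; apply (Derive_plus _ _ x); apply sfun_ex_derive.
Qed.

Lemma t_deriv_scal c phi : t_deriv (t_scal c phi) = t_scal c (t_deriv phi).
Proof.
  apply testT_ext; intros x; simpl.
  - rewrite (Derive_plus (fun x => Re c * t_re phi x) (fun x => - Im c * t_im phi x)),
      !Derive_scal; [reflexivity| |];
    auto_derive; auto; apply sfun_ex_derive.
  - rewrite (Derive_plus (fun x => Re c * t_im phi x) (fun x => Im c * t_re phi x)),
      !Derive_scal; [reflexivity| |];
    auto_derive; auto; apply sfun_ex_derive.
Qed.

Lemma t_deriv_expN k :
  t_deriv (t_expN k) = t_scal (Copp (Cmult Ci (RtoC (IZR k)))) (t_expN k).
Proof.
  apply testT_ext; intros x; simpl; apply is_derive_unique; auto_derive; auto; simpl; ring.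
Qed.

Lemma t_scal_scal c d phi : t_scal c (t_scal d phi) = t_scal (Cmult c d) phi.
Proof. apply tfun_inj; intros x. rewrite !tfun_scal. ring. Qed.

Lemma t_deriv_tsum c N :
  t_deriv (tsum c N) = tsum (fun j => Cmult (Copp (Cmult Ci (RtoC (IZR j)))) (c j)) N.
Proof.
  induction N as [|N IH]; cbn [tsum].
  - unfold t_zero. rewrite t_deriv_scal, t_deriv_expN, t_scal_scal. f_equal. ring.
  - rewrite !t_deriv_plus, IH, !t_deriv_scal, !t_deriv_expN, !t_scal_scal.
    f_equal. f_equal; f_equal; ring.
Qed.

Lemma t_deriv_partial phi N : t_deriv (tsum (tcoef phi) N) = tsum (tcoef (t_deriv phi)) N.
Proof.
  rewrite t_deriv_tsum. f_equal. apply functional_extensionality; intros j.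
  now rewrite tcoef_deriv.
Qed.

Lemma t_Derive_n_S phi n x : t_Derive_n phi (S n) x = t_Derive_n (t_deriv phi) n x.
Proof.
  assert (H : forall f : R -> R, Derive_n f (S n) x = Derive_n (Derive f) n x).
  { intros f. change (Derive f) with (Derive_n f 1).
    rewrite <- (Nat.add_1_r n). symmetry. apply (Derive_n_comp f n 1). }
  unfold t_Derive_n. now rewrite !H.
Qed.

Definition t_sub (phi psi : testT) : testT := t_plus phi (t_scal (RtoC (-1)) psi).

(** Since differentiation commutes with partial sums, the convergence holds in
    every [C^n] norm. *)
Lemma C_n_inversion n : forall phi, exists C, 0 <= C /\ forall N x, (1 <= N)%nat ->
  Cmod (t_Derive_n (t_sub (tsum (tcoef phi) N) phi) n x) <= C / INR N.
Proof.
  induction n as [|n IH]; intros phi.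
  - destruct (uniform_inversion phi) as [C [HC H]]. exists C. split; [exact HC|].
    intros N x HN. specialize (H N x HN).
    replace (t_Derive_n (t_sub (tsum (tcoef phi) N) phi) 0 x) with
      (Cminus (csum (fun j => Cmult (tcoef phi j) (expi (- j) x)) N) (tfun phi x)); [exact H|].
    change (t_Derive_n ?p 0 x) with (tfun p x). unfold t_sub.
    rewrite tfun_plus, tfun_scal, tfun_tsum. unfold Cminus. f_equal. cpair; ring.
  - destruct (IH (t_deriv phi)) as [C [HC H]]. exists C. split; [exact HC|].
    intros N x HN. rewrite t_Derive_n_S. unfold t_sub.
    rewrite t_deriv_plus, t_deriv_scal, t_deriv_partial. now apply H.
Qed.

Lemma distribution_tsum v c N : is_distribution v ->
  v (tsum c N) = csum (fun j => Cmult (c j) (v (t_expN j))) N.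
Proof.
  intros [Hp [Hs _]]. induction N as [|N IH]; cbn [tsum].
  - unfold t_zero. rewrite Hs, csum_0. ring.
  - rewrite csum_S, !Hp, IH, !Hs. reflexivity.
Qed.

(** Linearity moves [v] inside the partial sums of [phi] and continuity of [v] in a
    [C^n] norm passes to the limit; so a distribution is known from its Fourier
    coefficients. *)
Lemma distribution_inversion v phi eps : is_distribution v -> 0 < eps ->
  exists N0, forall N, (N0 <= N)%nat ->
    Cmod (Cminus (csum (fun j => Cmult (tcoef phi j) (v (t_expN j))) N) (v phi)) <= eps.
Proof.
  intros Hv He. pose proof Hv as [Hp [Hs [n [M HM]]]].
  assert (HC : exists C, 0 <= C /\ forall N x j, (1 <= N)%nat -> (j <= n)%nat ->
    Cmod (t_Derive_n (t_sub (tsum (tcoef phi) N) phi) j x) <= C / INR N).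
  { clear HM. induction n as [|n [C [HC IH]]].
    - destruct (C_n_inversion 0 phi) as [C [HC H]]. exists C. split; auto.
      intros N x j HN Hj. replace j with 0%nat by lia. auto.
    - destruct (C_n_inversion (S n) phi) as [C' [HC' H]]. exists (C + C').
      split; [lra|]. intros N x j HN Hj.
      assert (0 < / INR N) by (apply Rinv_0_lt_compat, lt_0_INR; lia).
      destruct (Nat.eq_dec j (S n)) as [->|Hne].
      + eapply Rle_trans; [apply H; auto|]. unfold Rdiv. nra.
      + eapply Rle_trans; [apply IH; auto; lia|]. unfold Rdiv. nra. }
  destruct HC as [C [HC HCn]].
  destruct (eps_over_INR (M * C) eps He) as [N0 [HN0 H0]].
  exists N0. intros N HN.
  rewrite <- distribution_tsum by exact Hv.
  replace (Cminus (v (tsum (tcoef phi) N)) (v phi)) with (v (t_sub (tsum (tcoef phi) N) phi)).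
  2:{ unfold t_sub. rewrite Hp, Hs. unfold Cminus. f_equal. cpair; ring. }
  eapply Rle_trans.
  - apply HM. intros j x Hj. apply HCn; [lia|exact Hj].
  - eapply Rle_trans; [|apply (H0 N HN)]. unfold Rdiv. lra.
Qed.

(** * Multiplication by a nonnegative function *)

Lemma zsum_lim (u : nat -> Z -> R) (l : Z -> R) K :
  (forall k, is_lim_seq (fun n => u n k) (l k)) ->
  is_lim_seq (fun n => zsum (u n) K) (zsum l K).
Proof.
  intros H; induction K as [|K IH]; cbn [zsum]; [apply is_lim_seq_const|].
  apply is_lim_seq_plus'; [exact IH|apply is_lim_seq_plus'; apply H].
Qed.

Lemma clim_Cmod2 u l : clim u l -> is_lim_seq (fun n => Cmod (u n) ^ 2) (Cmod l ^ 2).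
Proof.
  intros [H1 H2]. rewrite Cmod2.
  apply is_lim_seq_ext with (fun n => fst (u n) * fst (u n) + snd (u n) * snd (u n)).
  - intros n; rewrite Cmod2; ring.
  - replace (fst l ^ 2 + snd l ^ 2) with (fst l * fst l + snd l * snd l) by ring.
    apply is_lim_seq_plus'; apply is_lim_seq_mult'; auto.
Qed.

Lemma clim_conj_re u l (c : C) : clim u l ->
  is_lim_seq (fun n => fst (Cmult (u n) (Cconj c))) (fst (Cmult l (Cconj c))).
Proof.
  intros [H1 H2]. rewrite Cmult_conj_re.
  apply is_lim_seq_ext with (fun n => fst (u n) * fst c + snd (u n) * snd c).
  - intros n; now rewrite Cmult_conj_re.
  - apply is_lim_seq_plus'; apply is_lim_seq_mult'; auto using is_lim_seq_const.
Qed.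

(** Matrix of multiplication by [f] in the basis of exponentials: the entry [(k, j)]
    is the Fourier coefficient of [f] at [k - j]. *)
Definition mcoef (f : smoothT) (k j : Z) : C := tcoef (t_mult f (t_expN k)) j.

Lemma mcoefE (f : smoothT) k j :
  mcoef f k j = cmean (fun x => Cmult (RtoC (f x)) (expi (j - k) x)).
Proof.
  unfold mcoef, tcoef. apply cmean_ext. intros x _.
  replace (tfun (t_mult f (t_expN k)) x) with (Cmult (RtoC (f x)) (tfun (t_expN k) x))
    by (unfold tfun; cpair; ring).
  rewrite tfun_expN. replace (j - k)%Z with (- k + j)%Z by lia.
  rewrite <- expi_plus. ring.
Qed.

Lemma fhat_mult_trigpoly (f : smoothT) c N k :
  fhat (fun x => Cmult (RtoC (f x)) (trigpoly c N x)) k = csum (fun j => Cmult (mcoef f k j) (c j)) N.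
Proof.
  assert (Hf := ccont_real f (cont_sfun f)).
  unfold fhat, trigpoly.
  transitivity (cmean (fun x => csum (fun j => Cmult (c j) (Cmult (RtoC (f x)) (expi (j - k) x))) N)).
  - apply cmean_ext. intros x _.
    rewrite <- csum_scal, Cmult_comm, <- csum_scal.
    apply csum_ext. intros j _. replace (j - k)%Z with (j + - k)%Z by lia.
    rewrite <- expi_plus. ring.
  - rewrite (cmean_csum (fun j x => Cmult (c j) (Cmult (RtoC (f x)) (expi (j - k) x))))
      by auto with cont.
    apply csum_ext. intros j _.
    rewrite (cmean_scal (c j) (fun x => Cmult (RtoC (f x)) (expi (j - k) x)))
      by auto with cont.
    rewrite <- mcoefE. ring.
Qed.

Lemma mult_coef_lim (f : smoothT) v k : is_distribution v ->
  clim (fun N => csum (fun j => Cmult (mcoef f k j) (fourier v j)) N)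
       (fourier (d_mult f v) k).
Proof.
  intros Hv. apply clim_eps. intros eps He.
  destruct (distribution_inversion v (t_mult f (t_expN k)) (2 * PI * eps) Hv) as [N0 H0].
  { apply Rmult_lt_0_compat; [apply twoPI_pos|exact He]. }
  exists N0. intros N HN. specialize (H0 N HN).
  unfold fourier at 2, d_mult.
  replace (csum (fun j => Cmult (mcoef f k j) (fourier v j)) N) with
    (Cmult (RtoC (/ (2 * PI)))
       (csum (fun j => Cmult (tcoef (t_mult f (t_expN k)) j) (v (t_expN j))) N)).
  2:{ rewrite <- csum_scal. apply csum_ext. intros j _. unfold fourier, mcoef. ring. }
  match goal with |- Cmod (Cminus (Cmult ?a ?b) (Cmult ?a ?c)) <= _ =>
    replace (Cminus (Cmult a b) (Cmult a c)) with (Cmult a (Cminus b c)) by ring end.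
  pose proof twoPI_pos.
  rewrite Cmod_mult, Cmod_R, Rabs_pos_eq by (left; now apply Rinv_0_lt_compat).
  apply Rmult_le_reg_l with (2 * PI); [lra|].
  rewrite <- Rmult_assoc, Rinv_r, Rmult_1_l by lra. exact H0.
Qed.

Definition bounded_by (f : smoothT) (M : R) : Prop :=
  0 < M /\ forall x, - PI <= x <= PI -> 0 <= f x <= M.

Lemma trigpoly_minus c N L x : (N <= L)%nat ->
  Cminus (trigpoly c L x) (trigpoly c N x) = trigpoly (fun k => Cminus (c k) (trunc (RtoC 0) N c k)) L x.
Proof.
  intros HL. unfold trigpoly.
  replace (csum (fun j => Cmult (c j) (expi j x)) N)
    with (csum (fun j => Cmult (trunc (RtoC 0) N c j) (expi j x)) L).
  - rewrite <- csum_minus. apply csum_ext. intros; ring.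
  - rewrite (csum_vanish_out _ N L); auto.
    + apply csum_ext. intros j Hj. now rewrite trunc_in.
    + intros j Hj. rewrite trunc_out by exact Hj. ring.
Qed.

Lemma zsum_tail_sq (c : Z -> C) N L : (N <= L)%nat ->
  zsum (fun k => Cmod (Cminus (c k) (trunc (RtoC 0) N c k)) ^ 2) L =
  zsum (fun k => Cmod (c k) ^ 2) L - zsum (fun k => Cmod (c k) ^ 2) N.
Proof.
  intros HL. rewrite <- (zsum_trunc (fun k => Cmod (c k) ^ 2) N L HL).
  rewrite <- zsum_minus. apply zsum_ext. intros k _.
  destruct (inwin_dec N k) as [Hk|Hk].
  - rewrite !trunc_in by exact Hk. replace (Cminus (c k) (c k)) with (RtoC 0) by ring.
    rewrite Cmod_0. ring.
  - rewrite !trunc_out by exact Hk. replace (Cminus (c k) (RtoC 0)) with (c k) by ring. ring.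
Qed.

Definition mtrunc (f : smoothT) (v : functional) (N : nat) (k : Z) : C :=
  fhat (fun x => Cmult (RtoC (f x)) (trigpoly (fourier v) N x)) k.

Lemma mtrunc_lim f v k : is_distribution v ->
  clim (fun N => mtrunc f v N k) (fourier (d_mult f v) k).
Proof.
  intros Hv.
  pose proof (mult_coef_lim f v k Hv) as [H1 H2].
  split; (eapply is_lim_seq_ext; [|first [exact H1|exact H2]]);
    intros N; unfold mtrunc; now rewrite fhat_mult_trigpoly.
Qed.

(** With [Q(u, v) = <f u, v>] and truncations [v_N], [v_L]: the right-hand side is
    [Q(v_L, v_N) = Q(v_N, v_N) + Q(v_L - v_N, v_N)].  Weighted Bessel bounds the first
    term below, Young's inequality with weight [delta] the second. *)
Lemma form_lower_bound f M v B N L K delta :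
  bounded_by f M -> is_distribution v ->
  (forall N, zsum (fun k => Cmod (fourier v k) ^ 2) N <= B) ->
  (N <= L)%nat -> 0 < delta ->
  / M * zsum (fun k => Cmod (mtrunc f v N k) ^ 2) K
  - M / 2 * ((zsum (fun k => Cmod (fourier v k) ^ 2) L - zsum (fun k => Cmod (fourier v k) ^ 2) N) / delta
             + delta * B)
  <= zsum (fun k => fst (Cmult (mtrunc f v L k) (Cconj (fourier v k)))) N.
Proof.
  intros Hf Hv HB HL Hd. set (c := fourier v). set (wN := mtrunc f v). pose proof Hf as [HM HfM]. pose proof (cont_sfun f) as Cf.
  set (D := trigpoly (fun k => Cminus (c k) (trunc (RtoC 0) N c k)) L).
  assert (CD : ccont D) by apply ccont_trigpoly.
  assert (CG : ccont (trigpoly c N)) by apply ccont_trigpoly.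
  assert (E1 : zsum (fun k => fst (Cmult (wN L k) (Cconj (c k)))) N =
    mean (fun x => fst (Cmult (Cmult (RtoC (f x)) (trigpoly c L x)) (Cconj (trigpoly c N x))))).
  { change (fst (csum (fun k => Cmult (wN L k) (Cconj (c k))) N) =
            fst (cmean (fun x => Cmult (Cmult (RtoC (f x)) (trigpoly c L x)) (Cconj (trigpoly c N x))))).
    rewrite cmean_conj_trigpoly; [reflexivity|].
    apply ccont_mult; [now apply ccont_real|apply ccont_trigpoly]. }
  assert (E2 : mean (fun x => f x * Cmod (trigpoly c N x) ^ 2
       - (M / (2 * delta) * Cmod (D x) ^ 2 + M * delta / 2 * Cmod (trigpoly c N x) ^ 2))
     <= mean (fun x => fst (Cmult (Cmult (RtoC (f x)) (trigpoly c L x)) (Cconj (trigpoly c N x))))).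
  { apply mean_le.
    - auto 12 with cont.
    - refine (proj1 (ccont_mult _ _ (ccont_mult _ _ (ccont_real _ Cf) (ccont_trigpoly c L))
                (ccont_conj _ CG))).
    - intros x Hx. destruct (HfM x Hx) as [f0 fM].
      replace (trigpoly c L x) with (Cplus (D x) (trigpoly c N x)).
      2:{ unfold D. rewrite <- (trigpoly_minus c N L x HL). ring. }
      rewrite !Cmod2. rewrite Cmult_conj_re.
      generalize (D x) (trigpoly c N x); intros [p q] [r s]; simpl.
      (* Young's inequality with weight delta, applied to both components *)
      assert (Y : forall a b, - (M / (2 * delta) * (a * a) + M * delta / 2 * (b * b)) <= f x * (a * b)).
      { intros a b. apply Rmult_le_reg_l with (2 * delta); [lra|].
        replace (2 * delta * - (M / (2 * delta) * (a * a) + M * delta / 2 * (b * b)))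
          with (- (M * (a * a + (delta * b) * (delta * b)))) by (field; lra).
        pose proof (Rmult_le_pos _ _ f0 (Rle_0_sqr (a + delta * b))) as Y1.
        assert (Y2 : 0 <= (M - f x) * (Rsqr a + Rsqr (delta * b)))
          by (apply Rmult_le_pos; [lra|apply Rplus_le_le_0_compat; apply Rle_0_sqr]).
        unfold Rsqr in Y1, Y2.
        lra. }
      pose proof (Y p r). pose proof (Y q s). nra. }
  rewrite mean_minus, mean_plus, !mean_scal in E2
    by auto 12 with cont.
  unfold D in E2. rewrite !Parseval_trigpoly, zsum_tail_sq in E2 by exact HL.
  pose proof (weighted_Bessel f (trigpoly c N) M K Cf CG HM HfM) as WB. fold (mtrunc f v N) in WB. fold wN in WB.
  rewrite E1. eapply Rle_trans; [|exact E2].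
  assert (H1 : / M * zsum (fun k => Cmod (wN N k) ^ 2) K <= mean (fun x => f x * Cmod (trigpoly c N x) ^ 2)).
  { apply Rmult_le_reg_l with M; [exact HM|].
    rewrite <- Rmult_assoc, Rinv_r, Rmult_1_l by lra. exact WB. }
  pose proof (HB N) as HBN. fold c in HBN.
  assert (H2 : M * delta / 2 * zsum (fun k => Cmod (c k) ^ 2) N <= M * delta / 2 * B)
    by (apply Rmult_le_compat_l; [nra|exact HBN]).
  assert (H3 : forall t, M / 2 * (t / delta + delta * B) = M / (2 * delta) * t + M * delta / 2 * B)
    by (intros; field; lra).
  rewrite H3. lra.
Qed.

(** Multiplication by [f] is a nonnegative form [Q] bounded by [M], hence
    [|f v|^2 <= M Q(v)].  The energy balance only gives the partial sums of
    [Q(v) = <f v, v>], hence the loss of [eps].  Let [L], then [N], go to infinity in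
    the previous bound, with [delta] of order [eps]. *)
Lemma mult_coercive f M v B K eps :
  bounded_by f M -> is_distribution v ->
  (forall N, zsum (fun k => Cmod (fourier v k) ^ 2) N <= B) ->
  0 < eps ->
  exists N0, forall N, (N0 <= N)%nat ->
    / M * zsum (fun k => Cmod (fourier (d_mult f v) k) ^ 2) K - eps
    <= zsum (fun k => fst (Cmult (fourier (d_mult f v) k) (Cconj (fourier v k)))) N.
Proof.
  intros Hf Hv HB He.
  set (c := fourier v). set (w := fourier (d_mult f v)). set (wN := mtrunc f v).
  pose proof Hf as [HM HfM].
  assert (HB0 : 0 <= B) by exact (HB 0%nat).
  set (delta := eps / (2 * M * (B + 1))).
  assert (Hden : 0 < 2 * M * (B + 1)) by nra.
  assert (Hd : 0 < delta) by (unfold delta; apply Rdiv_lt_0_compat; lra).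
  set (tau := eps * delta / (2 * M)).
  assert (Ht : 0 < tau) by (unfold tau; apply Rdiv_lt_0_compat; nra).
  destruct (zsum_cauchy (fun k => Cmod (c k) ^ 2) B tau) as [N1 H1]; auto.
  { intros; apply Cmod2_ge_0. }
  assert (HeM : 0 < eps * M / 2) by nra.
  destruct (is_lim_seq_eps_inv (fun N => zsum (fun k => Cmod (wN N k) ^ 2) K)
    (zsum (fun k => Cmod (w k) ^ 2) K) (eps * M / 2)) as [N2 H2]; auto.
  { apply (zsum_lim (fun N k => Cmod (wN N k) ^ 2)). intros k. apply clim_Cmod2, mtrunc_lim, Hv. }
  exists (N1 + N2)%nat. intros N HN.
  specialize (H2 N ltac:(lia)). apply Rabs_le_between in H2.
  assert (G : / M * zsum (fun k => Cmod (w k) ^ 2) K - eps / 2 <=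
              / M * zsum (fun k => Cmod (wN N k) ^ 2) K).
  { apply Rmult_le_reg_l with M; [exact HM|].
    rewrite Rmult_minus_distr_l, <- !Rmult_assoc, Rinv_r, !Rmult_1_l by lra. lra. }
  apply (is_lim_seq_le_loc (fun _ => / M * zsum (fun k => Cmod (w k) ^ 2) K - eps)
    (fun L => zsum (fun k => fst (Cmult (wN L k) (Cconj (c k)))) N)
    (/ M * zsum (fun k => Cmod (w k) ^ 2) K - eps)
    (zsum (fun k => fst (Cmult (w k) (Cconj (c k)))) N)).
  - exists N. intros L HL. eapply Rle_trans; [|apply (form_lower_bound f M v B N L K delta Hf Hv HB HL Hd)].
    assert (Hc1 : zsum (fun k => Cmod (c k) ^ 2) L - zsum (fun k => Cmod (c k) ^ 2) N <= tau).
    { pose proof (H1 L ltac:(lia)).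
      pose proof (zsum_mono (fun k => Cmod (c k) ^ 2) N1 N (fun _ => Cmod2_ge_0 _) ltac:(lia)).
      lra. }
    assert (Hc2 : M / 2 * ((zsum (fun k => Cmod (c k) ^ 2) L - zsum (fun k => Cmod (c k) ^ 2) N) / delta
             + delta * B) <= eps / 2).
    { apply Rle_trans with (M / 2 * (tau / delta + delta * B)).
      - apply Rmult_le_compat_l; [lra|]. apply Rplus_le_compat_r.
        apply Rmult_le_compat_r; [left; now apply Rinv_0_lt_compat|exact Hc1].
      - replace (M / 2 * (tau / delta + delta * B)) with (eps / 4 * (1 + B / (B + 1)))
          by (unfold tau, delta; field; repeat split; lra).
        assert (B / (B + 1) <= 1) by now apply div_succ_le_1.
        nra. }
    fold c wN. lra.
  - apply is_lim_seq_const.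
  - apply (zsum_lim (fun L k => fst (Cmult (wN L k) (Cconj (c k))))).
    intros k. apply (clim_conj_re (fun L => wN L k)). now apply (mtrunc_lim f v k).
Qed.

(** * Asymptotic frequencies *)

Definition vanish (f : R -> C) : Prop :=
  forall eps, 0 < eps -> exists T, forall t, T <= t -> Cmod (f t) <= eps.

Definition cis (x : R) : C := (cos x, sin x).

(** Behaviour of [e^{i nu t}] up to an error vanishing at infinity.  The amplitude
    need not converge, so this is a condition on time shifts. *)
Definition freq (nu : R) (f : R -> C) : Prop :=
  forall s, 0 <= s -> vanish (fun t => Cminus (f (t + s)) (Cmult (cis (nu * s)) (f t))).

Lemma cis_plus x y : cis (x + y) = Cmult (cis x) (cis y).
Proof. unfold cis, Cmult; simpl. rewrite cos_plus, sin_plus. f_equal; ring. Qed.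

Lemma cis_0 : cis 0 = RtoC 1.
Proof. unfold cis. now rewrite cos_0, sin_0. Qed.

Lemma cis_mod x : Cmod (cis x) = 1.
Proof.
  replace (cis x) with (expi 1 x); [apply expi_mod|]. unfold expi, cis. now rewrite !Rmult_1_l.
Qed.

Lemma vanish_ext f g : (forall t, f t = g t) -> vanish f -> vanish g.
Proof.
  intros H Hf eps He. destruct (Hf eps He) as [T HT]. exists T.
  intros t Ht. rewrite <- H. auto.
Qed.

Lemma vanish_zero : vanish (fun _ => RtoC 0).
Proof. intros eps He; exists 0; intros; rewrite Cmod_0; lra. Qed.

Lemma vanish_plus f g : vanish f -> vanish g -> vanish (fun t => Cplus (f t) (g t)).
Proof.
  intros Hf Hg eps He.
  destruct (Hf (eps / 2) ltac:(lra)) as [T1 H1].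
  destruct (Hg (eps / 2) ltac:(lra)) as [T2 H2].
  exists (Rmax T1 T2). intros t Ht.
  pose proof (H1 t (Rmax_le_l _ _ _ Ht)).
  pose proof (H2 t (Rmax_le_r _ _ _ Ht)).
  eapply Rle_trans; [apply Cmod_triangle|]. lra.
Qed.

Lemma vanish_scal c f : vanish f -> vanish (fun t => Cmult c (f t)).
Proof.
  intros Hf eps He. pose proof (Cmod_ge_0 c).
  destruct (Hf (eps / (Cmod c + 1))) as [T HT].
  { apply Rdiv_lt_0_compat; lra. }
  exists T. intros t Ht. specialize (HT t Ht). rewrite Cmod_mult.
  pose proof (Cmod_ge_0 (f t)).
  apply Rle_trans with ((Cmod c + 1) * (eps / (Cmod c + 1))); [|right; field; lra].
  apply Rmult_le_compat; lra.
Qed.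

Lemma vanish_minus f g : vanish f -> vanish g -> vanish (fun t => Cminus (f t) (g t)).
Proof.
  intros Hf Hg. apply vanish_ext with (fun t => Cplus (f t) (Cmult (RtoC (-1)) (g t))).
  - intros t. cpair; ring.
  - apply vanish_plus; [exact Hf|now apply vanish_scal].
Qed.

Lemma vanish_shift s f : 0 <= s -> vanish f -> vanish (fun t => f (t + s)).
Proof.
  intros Hs Hf eps He. destruct (Hf eps He) as [T HT]. exists T.
  intros t Ht. apply HT. lra.
Qed.

Lemma vanish_csum (f : Z -> R -> C) N : (forall j, vanish (f j)) ->
  vanish (fun t => csum (fun j => f j t) N).
Proof.
  intros H. induction N as [|N IH]; [apply vanish_zero|].
  apply vanish_ext with (fun t => Cplus (csum (fun j => f j t) N)
    (Cplus (f (Z.of_nat N) t) (f (- Z.of_nat (S N))%Z t))).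
  - intros t; now rewrite csum_S.
  - auto using vanish_plus.
Qed.

Lemma vanish_csum_win (f : Z -> R -> C) N : (forall j, inwin N j -> vanish (f j)) ->
  vanish (fun t => csum (fun j => f j t) N).
Proof.
  intros H. apply vanish_ext with (fun t => csum (fun j => trunc (RtoC 0) N (fun j => f j t) j) N).
  - intros t. apply csum_ext. intros j Hj. now rewrite trunc_in.
  - apply (vanish_csum (fun j t => trunc (RtoC 0) N (fun j => f j t) j)). intros j.
    destruct (inwin_dec N j) as [Hj|Hj].
    + apply vanish_ext with (f j); [intros; now rewrite trunc_in|auto].
    + apply vanish_ext with (fun _ => RtoC 0); [intros; now rewrite trunc_out|apply vanish_zero].
Qed.

Lemma freq_zero nu : freq nu (fun _ => RtoC 0).
Proof.
  intros s _. apply vanish_ext with (fun _ => RtoC 0); [intros; ring|apply vanish_zero].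
Qed.

Lemma freq_scal nu c f : freq nu f -> freq nu (fun t => Cmult c (f t)).
Proof.
  intros H s Hs. apply vanish_ext with
    (fun t => Cmult c (Cminus (f (t + s)) (Cmult (cis (nu * s)) (f t)))).
  - intros; ring.
  - now apply vanish_scal, H.
Qed.

Lemma freq_of_vanish nu f : vanish f -> freq nu f.
Proof.
  intros H s Hs. apply vanish_minus; [now apply vanish_shift|now apply vanish_scal].
Qed.

(** Frequency [mu] is fixed, frequency [nu] is multiplied by
    [(1 + e^{i (nu - mu) tau}) / 2], which vanishes for a suitable [tau], and sup norms
    do not increase. *)
Definition avg (mu tau : R) (f : R -> C) (t : R) : C :=
  Cmult (RtoC (/ 2)) (Cplus (f t) (Cmult (cis (- (mu * tau))) (f (t + tau)))).

Definition avgs (mu : R) (L : list R) (f : R -> C) : R -> C :=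
  fold_right (avg mu) f L.

Lemma freq_avg nu mu tau f : 0 <= tau -> freq nu f -> freq nu (avg mu tau f).
Proof.
  intros Ht H s Hs. unfold avg.
  apply vanish_ext with (fun t => Cmult (RtoC (/ 2))
    (Cplus (Cminus (f (t + s)) (Cmult (cis (nu * s)) (f t)))
       (Cmult (cis (- (mu * tau)))
          (Cminus (f ((t + tau) + s)) (Cmult (cis (nu * s)) (f (t + tau))))))).
  - intros t. replace (t + tau + s) with (t + s + tau) by ring. ring.
  - apply vanish_scal, vanish_plus; [now apply H|]. apply vanish_scal.
    apply (vanish_shift tau (fun t => Cminus (f (t + s)) (Cmult (cis (nu * s)) (f t))) Ht).
    now apply H.
Qed.

Lemma cis_opp_l x : Cmult (cis (- x)) (cis x) = RtoC 1.
Proof. rewrite <- cis_plus. replace (- x + x) with 0 by ring. apply cis_0. Qed.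

Lemma half_half : Cplus (RtoC (/ 2)) (RtoC (/ 2)) = RtoC 1.
Proof. cpair; field. Qed.

Lemma avg_keep mu tau f : 0 <= tau -> freq mu f ->
  vanish (fun t => Cminus (avg mu tau f t) (f t)).
Proof.
  intros Ht H. apply vanish_ext with (fun t => Cmult (Cmult (RtoC (/ 2)) (cis (- (mu * tau))))
    (Cminus (f (t + tau)) (Cmult (cis (mu * tau)) (f t)))).
  - intros t. unfold avg.
    transitivity (Cminus (Cmult (RtoC (/ 2)) (Cmult (cis (- (mu * tau))) (f (t + tau))))
      (Cmult (Cmult (RtoC (/ 2)) (Cmult (cis (- (mu * tau))) (cis (mu * tau)))) (f t))); [ring|].
    rewrite cis_opp_l.
    transitivity (Cminus (Cplus (Cmult (RtoC (/ 2)) (f t)) 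
      (Cmult (RtoC (/ 2)) (Cmult (cis (- (mu * tau))) (f (t + tau)))))
      (Cmult (Cplus (RtoC (/ 2)) (RtoC (/ 2))) (f t))); [ring|].
    rewrite half_half. ring.
  - apply vanish_scal. now apply H.
Qed.

(** Time after which frequencies [mu] and [nu] are in phase opposition. *)
Definition killtime (mu nu : R) : R := PI / Rabs (nu - mu).

Lemma killtime_pos mu nu : nu <> mu -> 0 <= killtime mu nu.
Proof.
  intros H. left. apply Rdiv_lt_0_compat; [apply PI_RGT_0|]. apply Rabs_pos_lt. lra.
Qed.

Lemma killtime_spec mu nu : nu <> mu ->
  Cmult (cis (- (mu * killtime mu nu))) (cis (nu * killtime mu nu)) = RtoC (-1).
Proof.
  intros H. rewrite <- cis_plus. unfold killtime, cis.
  assert (Hn : Rabs (nu - mu) <> 0) by (apply Rabs_no_R0; lra).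
  destruct (Rle_dec 0 (nu - mu)) as [Hp|Hp].
  - rewrite Rabs_pos_eq in * by exact Hp.
    replace (- (mu * (PI / (nu - mu))) + nu * (PI / (nu - mu))) with PI by (field; exact Hn).
    now rewrite cos_PI, sin_PI.
  - rewrite Rabs_left in * by lra.
    replace (- (mu * (PI / - (nu - mu))) + nu * (PI / - (nu - mu))) with (- PI)
      by (field; lra).
    rewrite cos_neg, sin_neg, cos_PI, sin_PI. unfold RtoC. f_equal. ring.
Qed.

Lemma avg_kill mu nu f : nu <> mu -> freq nu f -> vanish (avg mu (killtime mu nu) f).
Proof.
  intros Hn H. set (tau := killtime mu nu).
  apply vanish_ext with (fun t => Cmult (Cmult (RtoC (/ 2)) (cis (- (mu * tau))))
    (Cminus (f (t + tau)) (Cmult (cis (nu * tau)) (f t)))).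
  - intros t. unfold avg.
    transitivity (Cminus (Cmult (RtoC (/ 2)) (Cmult (cis (- (mu * tau))) (f (t + tau))))
      (Cmult (Cmult (RtoC (/ 2)) (Cmult (cis (- (mu * tau))) (cis (nu * tau)))) (f t))); [ring|].
    unfold tau. rewrite (killtime_spec mu nu Hn).
    replace (RtoC (-1)) with (Copp (RtoC 1)) by (cpair; ring). ring.
  - apply vanish_scal, H. now apply killtime_pos.
Qed.

Lemma avg_vanish mu tau f : 0 <= tau -> vanish f -> vanish (avg mu tau f).
Proof.
  intros Ht H. apply vanish_scal, vanish_plus; [exact H|].
  apply vanish_scal. now apply (vanish_shift tau f).
Qed.

Definition nonneg_list (L : list R) : Prop := Forall (fun tau => 0 <= tau) L.

Lemma avgs_freq nu mu L f : nonneg_list L -> freq nu f -> freq nu (avgs mu L f).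
Proof.
  intros HL H; induction HL as [|tau L Ht HL IH]; [exact H|]. now apply freq_avg.
Qed.

Lemma avgs_keep mu L f : nonneg_list L -> freq mu f ->
  vanish (fun t => Cminus (avgs mu L f t) (f t)).
Proof.
  intros HL H; induction HL as [|tau L Ht HL IH].
  - apply vanish_ext with (fun _ => RtoC 0); [intros; simpl; ring|apply vanish_zero].
  - cbn [avgs fold_right]. fold (avgs mu L f).
    apply vanish_ext with (fun t => Cplus (Cminus (avg mu tau (avgs mu L f) t) (avgs mu L f t))
       (Cminus (avgs mu L f t) (f t))); [intros; ring|].
    apply vanish_plus; [|exact IH]. apply avg_keep; auto. now apply avgs_freq.
Qed.

Lemma avgs_vanish mu L f : nonneg_list L -> vanish f -> vanish (avgs mu L f).
Proof.
  intros HL H; induction HL as [|tau L Ht HL IH]; [exact H|]. now apply avg_vanish.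
Qed.

Lemma avgs_kill mu nu L f : nonneg_list L -> nu <> mu -> In (killtime mu nu) L ->
  freq nu f -> vanish (avgs mu L f).
Proof.
  intros HL Hn HI H; induction HL as [|tau L Ht HL IH]; [destruct HI|].
  cbn [avgs fold_right]. fold (avgs mu L f).
  destruct HI as [->|HI].
  - apply avg_kill; [exact Hn|now apply avgs_freq].
  - apply avg_vanish; auto.
Qed.

Lemma avgs_bound mu L f T B : nonneg_list L -> (forall t, T <= t -> Cmod (f t) <= B) ->
  forall t, T <= t -> Cmod (avgs mu L f t) <= B.
Proof.
  intros HL H; induction HL as [|tau L Ht HL IH]; [exact H|]. intros t Hte.
  cbn [avgs fold_right]. fold (avgs mu L f). unfold avg.
  rewrite Cmod_mult, Cmod_R, Rabs_pos_eq by lra.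
  pose proof (Cmod_triangle (avgs mu L f t) (Cmult (cis (- (mu * tau))) (avgs mu L f (t + tau)))) as K.
  rewrite Cmod_mult, cis_mod in K.
  pose proof (IH t Hte). pose proof (IH (t + tau) ltac:(lra)). lra.
Qed.

Lemma avgs_plus mu L f g t :
  avgs mu L (fun t => Cplus (f t) (g t)) t = Cplus (avgs mu L f t) (avgs mu L g t).
Proof.
  revert t; induction L as [|tau L IH]; intros t; [reflexivity|].
  cbn [avgs fold_right]. fold (avgs mu L f) (avgs mu L g)
    (avgs mu L (fun t => Cplus (f t) (g t))). unfold avg. rewrite !IH. ring.
Qed.

Lemma avgs_scal mu L c f t :
  avgs mu L (fun t => Cmult c (f t)) t = Cmult c (avgs mu L f t).
Proof.
  revert t; induction L as [|tau L IH]; intros t; [reflexivity|].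
  cbn [avgs fold_right]. fold (avgs mu L f)
    (avgs mu L (fun t => Cmult c (f t))). unfold avg. rewrite !IH. ring.
Qed.

Lemma avgs_csum mu L (f : Z -> R -> C) N t :
  avgs mu L (fun t => csum (fun j => f j t) N) t = csum (fun j => avgs mu L (f j) t) N.
Proof.
  revert t; induction N as [|N IH]; intros t.
  - rewrite csum_0. change (fun t => csum (fun j => f j t) 0) with (fun _ : R => RtoC 0).
    transitivity (avgs mu L (fun t => Cmult (RtoC 0) (RtoC 0)) t).
    + f_equal. apply functional_extensionality; intros; ring.
    + rewrite (avgs_scal mu L (RtoC 0) (fun _ => RtoC 0)). ring.
  - rewrite csum_S, <- IH, <- !avgs_plus. reflexivity.
Qed.

Fixpoint killtimes (mu : R) (nu : Z -> R) (N : nat) : list R :=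
  match N with
  | O => nil
  | S n => killtime mu (nu (Z.of_nat n)) :: killtime mu (nu (- Z.of_nat (S n))%Z)
             :: killtimes mu nu n
  end.

Lemma killtimes_nonneg mu nu N : (forall j, nu j <> mu) -> nonneg_list (killtimes mu nu N).
Proof.
  intros H; induction N as [|N IH]; constructor; [now apply killtime_pos|].
  constructor; [now apply killtime_pos|exact IH].
Qed.

Lemma killtimes_in mu nu N j : inwin N j -> In (killtime mu (nu j)) (killtimes mu nu N).
Proof.
  induction N as [|N IH]; intros Hj; [unfold inwin in Hj; lia|].
  cbn [killtimes In].
  destruct (Z.eq_dec j (Z.of_nat N)) as [->|H1]; [now left|].
  destruct (Z.eq_dec j (- Z.of_nat (S N))) as [->|H2]; [right; now left|].
  right; right. apply IH. unfold inwin in *. lia.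
Qed.

(** Finitely many averagings remove the frequencies other than [mu] from a large window
    of the sum, leave the [mu] part unchanged up to a vanishing error and do not amplify
    the small tail. *)
Lemma frequency_separation mu (nu1 nu2 : Z -> R) (e r1 r2 : Z -> R -> C)
    (c : Z -> C) (F : R -> C) B C0 N0 :
  (forall j, nu1 j <> mu) -> (forall j, nu2 j <> mu) ->
  (forall j, freq mu (e j)) -> (forall j, freq (nu1 j) (r1 j)) ->
  (forall j, freq (nu2 j) (r2 j)) ->
  (forall j t, 0 <= t -> Cmod (Cplus (e j t) (Cplus (r1 j t) (r2 j t))) <= B) ->
  (forall N, zsum (fun j => Cmod (c j)) N <= C0) ->
  (forall t, 0 <= t -> clim (fun N =>
     csum (fun j => Cmult (c j) (Cplus (e j t) (Cplus (r1 j t) (r2 j t)))) N) (F t)) ->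
  vanish F ->
  (forall j, ~ inwin N0 j -> forall t, e j t = RtoC 0) ->
  vanish (fun t => csum (fun j => Cmult (c j) (e j t)) N0).
Proof.
  intros Hn1 Hn2 He H1 H2 HB HC HF HFv He0 eps Heps.
  assert (HB0 : 0 <= B).
  { eapply Rle_trans; [apply Cmod_ge_0|apply (HB 0%Z 0); lra]. }
  set (tail := eps / (2 * (B + 1))).
  assert (Htail : 0 < tail) by (apply Rdiv_lt_0_compat; lra).
  destruct (zsum_cauchy (fun j => Cmod (c j)) C0 tail) as [N1 HN1]; auto.
  { intros; apply Cmod_ge_0. }
  set (N := (N0 + N1)%nat).
  assert (HN : forall L, (N <= L)%nat ->
     zsum (fun j => Cmod (c j)) L - zsum (fun j => Cmod (c j)) N <= tail).
  { intros L HL. pose proof (HN1 L ltac:(unfold N in HL; lia)).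
    pose proof (zsum_mono (fun j => Cmod (c j)) N1 N (fun _ => Cmod_ge_0 _) ltac:(unfold N; lia)).
    lra. }
  set (L := (killtimes mu nu1 N ++ killtimes mu nu2 N)%list).
  assert (HL : nonneg_list L).
  { apply Forall_app. split; now apply killtimes_nonneg. }
  set (g := fun j t => Cplus (e j t) (Cplus (r1 j t) (r2 j t))).
  set (S := fun t => csum (fun j => Cmult (c j) (g j t)) N).
  set (tl := fun t => Cminus (F t) (S t)).
  assert (Htl : forall t, 0 <= t -> Cmod (avgs mu L tl t) <= B * tail).
  { apply avgs_bound; [exact HL|]. intros t Ht.
    apply (series_tail_bound c (fun j => g j t)); auto.
    - intros j. now apply HB.
    - now apply HF. }
  assert (Hrest : vanish (fun t => Cminus (avgs mu L F t)
    (csum (fun j => Cmult (c j) (Cplus (Cminus (avgs mu L (e j) t) (e j t))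
        (Cplus (avgs mu L (r1 j) t) (avgs mu L (r2 j) t)))) N))).
  { apply vanish_minus; [now apply avgs_vanish|].
    apply (vanish_csum_win (fun j t => Cmult (c j) (Cplus (Cminus (avgs mu L (e j) t) (e j t))
        (Cplus (avgs mu L (r1 j) t) (avgs mu L (r2 j) t))))).
    intros j Hj. apply vanish_scal, vanish_plus; [now apply avgs_keep|].
    apply vanish_plus.
    - apply (avgs_kill mu (nu1 j)); auto. apply in_or_app. left. now apply killtimes_in.
    - apply (avgs_kill mu (nu2 j)); auto. apply in_or_app. right. now apply killtimes_in. }
  destruct (Hrest (eps / 2) ltac:(lra)) as [T HT].
  exists (Rmax T 0). intros t Ht.
  specialize (HT t (Rmax_le_l _ _ _ Ht)).
  specialize (Htl t (Rmax_le_r _ _ _ Ht)).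
  set (rest := Cminus (avgs mu L F t) _) in HT.
  replace (csum (fun j => Cmult (c j) (e j t)) N0) with (Cminus rest (avgs mu L tl t)).
  - eapply Rle_trans; [apply Cmod_triangle_minus|].
    assert (B * tail <= eps / 2).
    { unfold tail. replace (B * (eps / (2 * (B + 1)))) with (eps / 2 * (B / (B + 1)))
        by (field; lra).
      assert (B / (B + 1) <= 1) by now apply div_succ_le_1.
      nra. }
    lra.
  - assert (EF : avgs mu L F t = Cplus (avgs mu L tl t) (avgs mu L S t)).
    { rewrite <- avgs_plus. f_equal. apply functional_extensionality. intros u.
      unfold tl. ring. }
    assert (ES : avgs mu L S t = csum (fun j => Cmult (c j) (Cplus (avgs mu L (e j) t)
        (Cplus (avgs mu L (r1 j) t) (avgs mu L (r2 j) t)))) N).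
    { unfold S. rewrite (avgs_csum mu L (fun j t => Cmult (c j) (g j t))).
      apply csum_ext. intros j _. rewrite (avgs_scal mu L (c j) (g j)).
      unfold g. now rewrite !avgs_plus. }
    unfold rest. rewrite EF, ES.
    rewrite <- (csum_vanish_out (fun j => Cmult (c j) (e j t)) N0 N).
    + match goal with |- Cminus (Cminus (Cplus ?a ?x) ?y) ?a = ?z =>
        transitivity (Cminus x y); [ring|] end.
      rewrite <- csum_minus. apply csum_ext. intros; ring.
    + intros j Hj. rewrite He0 by exact Hj. ring.
    + unfold N; lia.
Qed.

Lemma cis_small eps : 0 < eps -> exists d, 0 < d /\ forall x, Rabs x < d ->
  Cmod (Cminus (cis x) (1, x)) <= eps * Rabs x.
Proof.
  intros He.
  destruct (derivable_pt_lim_sin 0 (eps / 2) ltac:(lra)) as [[d1 P1] H1].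
  destruct (derivable_pt_lim_cos 0 (eps / 2) ltac:(lra)) as [[d2 P2] H2].
  exists (Rmin d1 d2). split; [now apply Rmin_glb_lt|]. intros x Hx.
  destruct (Req_dec x 0) as [->|Hn].
  - rewrite cis_0. replace (Cminus (RtoC 1) (1, 0)) with (RtoC 0) by (cpair; ring).
    rewrite Cmod_0, Rabs_R0. lra.
  - specialize (H1 x Hn (Rlt_le_trans _ _ _ Hx (Rmin_l _ _))).
    specialize (H2 x Hn (Rlt_le_trans _ _ _ Hx (Rmin_r _ _))).
    rewrite Rplus_0_l, sin_0, cos_0 in *. 
    eapply Rle_trans; [apply Cmod_le_sum|]. simpl.
    replace (cos x + - (1)) with (((cos x - 1) / x - - 0) * x) by (field; exact Hn).
    replace (sin x + - x) with (((sin x - 0) / x - 1) * x) by (field; exact Hn).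
    rewrite !Rabs_mult. pose proof (Rabs_pos x). nra.
Qed.

(** [f' = i mu f + o(1)] in the form of Euler steps.  The rotation [e^{i mu s}] is an
    isometry, so the errors of [n] steps of length [s/n] add up to [n o(s/n)]. *)
Lemma freq_of_ode mu f B : (forall t, 0 <= t -> Cmod (f t) <= B) ->
  (forall eps, 0 < eps -> exists s0, 0 < s0 /\ forall s, 0 < s <= s0 ->
     exists T, forall t, T <= t ->
       Cmod (Cminus (f (t + s)) (Cmult (1, s * mu) (f t))) <= s * eps) ->
  freq mu f.
Proof.
  intros HB H S HS.
  destruct HS as [HS|<-].
  2:{ apply vanish_ext with (fun _ => RtoC 0); [|apply vanish_zero].
      intros t. rewrite Rmult_0_r, cis_0, Rplus_0_r. ring. }
  assert (HB0 : 0 <= B) by (eapply Rle_trans; [apply Cmod_ge_0|apply (HB 0); lra]).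
  assert (G : forall eps, 0 < eps -> exists s0, 0 < s0 /\ forall s, 0 < s <= s0 ->
     exists T, forall t, T <= t ->
       Cmod (Cminus (f (t + s)) (Cmult (cis (mu * s)) (f t))) <= s * eps).
  { intros eps He. destruct (H (eps / 2) ltac:(lra)) as [s1 [P1 H1]].
    assert (HK : 0 < (Rabs mu + 1) * (B + 1)).
    { pose proof (Rabs_pos mu). nra. }
    destruct (cis_small (eps / (2 * ((Rabs mu + 1) * (B + 1))))) as [d [Pd Hd]].
    { apply Rdiv_lt_0_compat; lra. }
    exists (Rmin s1 (d / (2 * (Rabs mu + 1)))).
    assert (Hm := Rabs_pos mu).
    split.
    { apply Rmin_glb_lt; [exact P1|]. apply Rdiv_lt_0_compat; lra. }
    intros s [Ps Hs].
    assert (Hs1 : s <= s1) by (eapply Rle_trans; [exact Hs|apply Rmin_l]).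
    assert (Hs2 : s <= d / (2 * (Rabs mu + 1))) by (eapply Rle_trans; [exact Hs|apply Rmin_r]).
    destruct (H1 s ltac:(lra)) as [T HT]. exists (Rmax T 0). intros t Ht.
    specialize (HT t (Rmax_le_l _ _ _ Ht)).
    pose proof (HB t (Rmax_le_r _ _ _ Ht)) as HBt.
    replace (Cminus (f (t + s)) (Cmult (cis (mu * s)) (f t))) with
      (Cminus (Cminus (f (t + s)) (Cmult (1, s * mu) (f t)))
         (Cmult (Cminus (cis (mu * s)) (1, s * mu)) (f t))) by ring.
    unfold Cminus at 1. eapply Rle_trans; [apply Cmod_triangle|]. rewrite Cmod_opp, Cmod_mult.
    assert (Hx : Rabs (mu * s) < d).
    { rewrite Rabs_mult, (Rabs_pos_eq s) by lra.
      apply Rmult_le_compat_l with (r := Rabs mu) in Hs2; [|exact Hm].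
      assert (Rabs mu * (d / (2 * (Rabs mu + 1))) < d).
      { replace (Rabs mu * (d / (2 * (Rabs mu + 1)))) with (d * (Rabs mu / (2 * (Rabs mu + 1))))
          by (field; lra).
        assert (Rabs mu / (2 * (Rabs mu + 1)) < 1).
        { apply Rmult_lt_reg_r with (2 * (Rabs mu + 1)); [lra|].
          unfold Rdiv. rewrite Rmult_assoc, Rinv_l by lra. lra. }
        nra. }
      lra. }
    specialize (Hd _ Hx). rewrite Rabs_mult, (Rabs_pos_eq s) in Hd by lra.
    rewrite (Rmult_comm s mu).
    set (X := Cmod (Cminus (cis (mu * s)) (1, mu * s))) in *.
    assert (X * Cmod (f t) <= s * (eps / 2)).
    { apply Rle_trans with ((eps / (2 * ((Rabs mu + 1) * (B + 1))) * (Rabs mu * s)) * (B + 1)).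
      - apply Rmult_le_compat; [apply Cmod_ge_0|apply Cmod_ge_0|exact Hd|lra].
      - replace ((eps / (2 * ((Rabs mu + 1) * (B + 1))) * (Rabs mu * s)) * (B + 1))
          with (s * (eps / 2) * (Rabs mu / (Rabs mu + 1))) by (field; lra).
        assert (Rabs mu / (Rabs mu + 1) <= 1) by now apply div_succ_le_1.
        assert (0 < s * (eps / 2)) by nra. nra. }
    rewrite (Rmult_comm s mu) in HT. fold X. 
    unfold Cminus in HT |- *. lra. }
  intros eps He. destruct (G (eps / S)) as [s0 [P0 H0]].
  { now apply Rdiv_lt_0_compat. }
  destruct (archimedean_mult S s0 P0) as [n0 Hn0].
  set (n := Datatypes.S n0).
  assert (Hn : 0 < INR n) by (apply lt_0_INR; unfold n; lia).
  set (s := S / INR n).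
  assert (Hs : 0 < s <= s0).
  { split; [now apply Rdiv_lt_0_compat|]. unfold s.
    apply Rmult_le_reg_r with (INR n); [exact Hn|].
    unfold Rdiv. rewrite Rmult_assoc, Rinv_l, Rmult_1_r by lra.
    unfold n. rewrite S_INR. lra. }
  destruct (H0 s Hs) as [T HT]. exists T.
  assert (K : forall m t, T <= t ->
    Cmod (Cminus (f (t + INR m * s)) (Cmult (cis (mu * (INR m * s))) (f t)))
    <= INR m * (s * (eps / S))).
  { induction m as [|m IH]; intros t Ht.
    - simpl INR. rewrite Rmult_0_l, Rmult_0_r, cis_0, Rplus_0_r, Rmult_0_l.
      replace (Cminus (f t) (Cmult (RtoC 1) (f t))) with (RtoC 0) by ring.
      rewrite Cmod_0. lra.
    - rewrite S_INR.
      assert (0 <= INR m * s) by (apply Rmult_le_pos; [apply pos_INR|lra]).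
      replace (t + (INR m + 1) * s) with ((t + INR m * s) + s) by ring.
      replace (mu * ((INR m + 1) * s)) with (mu * s + mu * (INR m * s)) by ring.
      rewrite cis_plus.
      replace (Cminus (f (t + INR m * s + s))
         (Cmult (Cmult (cis (mu * s)) (cis (mu * (INR m * s)))) (f t))) with
        (Cplus (Cminus (f (t + INR m * s + s)) (Cmult (cis (mu * s)) (f (t + INR m * s))))
           (Cmult (cis (mu * s)) (Cminus (f (t + INR m * s)) (Cmult (cis (mu * (INR m * s))) (f t)))))
        by ring.
      eapply Rle_trans; [apply Cmod_triangle|]. rewrite Cmod_mult, cis_mod.
      pose proof (HT (t + INR m * s) ltac:(lra)). pose proof (IH t Ht). lra. }
  intros t Ht. specialize (K n t Ht).
  replace (INR n * s) with S in K by (unfold s; field; lra).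
  replace (INR n * (s * (eps / S))) with eps in K by (unfold s; field; lra).
  exact K.
Qed.

(** * The symbols and the dispersion relation *)

Lemma tanh_exp x : tanh x = 1 - 2 / (exp x * exp x + 1).
Proof.
  unfold tanh, sinh, cosh. rewrite exp_Ropp. pose proof (exp_pos x).
  field. split; nra.
Qed.

Lemma tanh_0 : tanh 0 = 0.
Proof. rewrite tanh_exp, exp_0. field. Qed.

Lemma tanh_increasing x y : x < y -> tanh x < tanh y.
Proof.
  intros H. rewrite !tanh_exp. apply exp_increasing in H.
  pose proof (exp_pos x).
  assert (/ (exp y * exp y + 1) < / (exp x * exp x + 1)).
  { apply Rinv_lt_contravar; nra. }
  unfold Rdiv; lra.
Qed.

Lemma tanh_lt_1 x : tanh x < 1.
Proof.
  rewrite tanh_exp. pose proof (exp_pos x).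
  assert (0 < 2 / (exp x * exp x + 1)) by (apply Rdiv_lt_0_compat; nra). lra.
Qed.

Lemma tanh_opp x : tanh (- x) = - tanh x.
Proof. unfold tanh, sinh, cosh. rewrite Ropp_involutive. field.
  pose proof (exp_pos x); pose proof (exp_pos (- x)); lra. Qed.

Lemma tanh_pos x : 0 < x -> 0 < tanh x.
Proof. intros H. rewrite <- tanh_0. now apply tanh_increasing. Qed.

(** Squared frequency of the undamped mode [k]: [k tanh(beta k) / beta]. *)
Definition omega_sq (beta : R) (k : Z) : R := IZR k * m_sym beta k.

Lemma omega_sq_abs beta k : omega_sq beta k = Rabs (IZR k) * tanh (beta * Rabs (IZR k)) / beta.
Proof.
  unfold omega_sq, m_sym, Rabs. destruct Rcase_abs; [|unfold Rdiv; ring].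
  replace (beta * - IZR k) with (- (beta * IZR k)) by ring. rewrite tanh_opp.
  unfold Rdiv. ring.
Qed.

Lemma omega_sq_0 beta : omega_sq beta 0 = 0.
Proof. unfold omega_sq. ring. Qed.

Lemma omega_sq_lt beta j k : 0 < beta -> Rabs (IZR j) < Rabs (IZR k) -> omega_sq beta j < omega_sq beta k.
Proof.
  intros Hb H. rewrite !omega_sq_abs. apply Rmult_lt_compat_r; [now apply Rinv_0_lt_compat|].
  pose proof (Rabs_pos (IZR j)).
  assert (tanh (beta * Rabs (IZR j)) < tanh (beta * Rabs (IZR k))).
  { apply tanh_increasing. now apply Rmult_lt_compat_l. }
  assert (0 <= tanh (beta * Rabs (IZR j))).
  { destruct H0 as [H0|H0]; [left; apply tanh_pos; nra|].
    rewrite <- H0, Rmult_0_r, tanh_0. lra. }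
  nra.
Qed.

Lemma omega_sq_inj beta j k : 0 < beta -> omega_sq beta j = omega_sq beta k -> Z.abs j = Z.abs k.
Proof.
  intros Hb H.
  destruct (Rtotal_order (Rabs (IZR j)) (Rabs (IZR k))) as [L|[L|L]].
  - apply (omega_sq_lt beta) in L; auto. lra.
  - rewrite <- !abs_IZR in L. now apply eq_IZR.
  - apply (omega_sq_lt beta) in L; auto. lra.
Qed.

Lemma omega_sq_nonneg beta k : 0 < beta -> 0 <= omega_sq beta k.
Proof.
  intros Hb. destruct (Z.eq_dec k 0) as [->|Hk]; [rewrite omega_sq_0; lra|].
  left. rewrite <- (omega_sq_0 beta). apply omega_sq_lt; auto.
  rewrite Rabs_R0. pose proof (IZR_abs_ge1 k Hk). lra.
Qed.

Lemma omega_sq_pos beta k : 0 < beta -> k <> 0%Z -> 0 < omega_sq beta k.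
Proof.
  intros Hb Hk. rewrite <- (omega_sq_0 beta). apply omega_sq_lt; auto.
  rewrite Rabs_R0. pose proof (IZR_abs_ge1 k Hk). lra.
Qed.

Lemma omega_sq_ge beta k : 0 < beta -> k <> 0%Z -> tanh beta / beta * Rabs (IZR k) <= omega_sq beta k.
Proof.
  intros Hb Hk. pose proof (IZR_abs_ge1 k Hk). rewrite omega_sq_abs.
  assert (tanh beta <= tanh (beta * Rabs (IZR k))).
  { destruct (Req_dec (Rabs (IZR k)) 1) as [->|Hn]; [rewrite Rmult_1_r; lra|].
    left. apply tanh_increasing. nra. }
  unfold Rdiv.
  replace (tanh beta * / beta * Rabs (IZR k)) with (Rabs (IZR k) * tanh beta * / beta) by ring.
  apply Rmult_le_compat_r; [left; now apply Rinv_0_lt_compat|]. nra.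
Qed.

Lemma omega_sq_le beta k : 0 < beta -> omega_sq beta k <= IZR k ^ 2 / beta.
Proof.
  intros Hb. rewrite omega_sq_abs. apply Rmult_le_compat_r; [left; now apply Rinv_0_lt_compat|].
  destruct (Z.eq_dec k 0) as [->|Hk]; [rewrite Rabs_R0; simpl; lra|].
  pose proof (IZR_abs_ge1 k Hk). pose proof (tanh_lt_1 (beta * Rabs (IZR k))).
  rewrite <- pow2_abs. nra.
Qed.

Lemma p_symE beta k : IZR k * p_sym beta k = m_sym beta k.
Proof.
  unfold p_sym, m_sym. destruct Z.eq_dec as [->|Hk].
  - rewrite Rmult_0_r, tanh_0. unfold Rdiv. ring.
  - apply IZR_ne0 in Hk. unfold Rdiv. rewrite Rinv_mult.
    replace (IZR k * (tanh (beta * IZR k) * (/ beta * / IZR k))) with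
      (tanh (beta * IZR k) * / beta * (IZR k * / IZR k)) by ring.
    rewrite Rinv_r by exact Hk. ring.
Qed.

Lemma omega_sq_p beta k : omega_sq beta k = IZR k ^ 2 * p_sym beta k.
Proof. unfold omega_sq. rewrite <- p_symE. ring. Qed.

Lemma p_sym_pos beta k : 0 < beta -> 0 < p_sym beta k.
Proof.
  intros Hb. destruct (Z.eq_dec k 0) as [->|Hk].
  - unfold p_sym. destruct Z.eq_dec; [lra|lia].
  - pose proof (omega_sq_pos beta k Hb Hk) as H. rewrite omega_sq_p in H.
    pose proof (pow2_gt_0 (IZR k) (IZR_ne0 k Hk)). nra.
Qed.

Lemma p_sym_le_k beta k : 0 < beta -> k <> 0%Z -> p_sym beta k <= / beta / Rabs (IZR k).
Proof.
  intros Hb Hk. pose proof (IZR_abs_ge1 k Hk) as H1.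
  assert (H : IZR k ^ 2 * p_sym beta k <= Rabs (IZR k) / beta).
  { rewrite <- omega_sq_p, omega_sq_abs. apply Rmult_le_compat_r; [left; now apply Rinv_0_lt_compat|].
    pose proof (tanh_lt_1 (beta * Rabs (IZR k))). nra. }
  rewrite <- pow2_abs in H.
  apply Rmult_le_reg_l with (Rabs (IZR k) ^ 2); [nra|].
  replace (Rabs (IZR k) ^ 2 * (/ beta / Rabs (IZR k))) with (Rabs (IZR k) / beta)
    by (field; lra).
  exact H.
Qed.

Lemma p_sym_le beta k : 0 < beta -> p_sym beta k <= 1 + / beta.
Proof.
  intros Hb. assert (0 < / beta) by now apply Rinv_0_lt_compat.
  destruct (Z.eq_dec k 0) as [->|Hk].
  - unfold p_sym. destruct Z.eq_dec; [lra|lia].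
  - eapply Rle_trans; [now apply p_sym_le_k|].
    pose proof (IZR_abs_ge1 k Hk).
    apply Rle_trans with (/ beta); [|lra].
    apply Rmult_le_reg_r with (Rabs (IZR k)); [lra|].
    unfold Rdiv. rewrite Rmult_assoc, Rinv_l by lra. nra.
Qed.

Lemma japanese_ge1 k : 1 <= japanese k.
Proof.
  unfold japanese. rewrite <- sqrt_1 at 1. apply sqrt_le_1_alt.
  pose proof (pow2_ge_0 (IZR k)). lra.
Qed.

Lemma japanese_sq k : japanese k * japanese k = 1 + IZR k ^ 2.
Proof. apply sqrt_sqrt. pose proof (pow2_ge_0 (IZR k)). lra. Qed.

(** Ensures that the series of the energy converges on the energy space. *)
Lemma p_sym_weight beta k : 0 < beta ->
  p_sym beta k <= (1 + 2 / beta) * Rpower (japanese k) (2 * (- (1 / 2))).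
Proof.
  intros Hb. pose proof (japanese_ge1 k). pose proof (japanese_sq k).
  assert (0 < / beta) by now apply Rinv_0_lt_compat.
  replace (2 * (- (1 / 2))) with (-1) by field.
  replace (Rpower (japanese k) (-1)) with (/ japanese k).
  2:{ replace (-1) with (- (1)) by ring. rewrite Rpower_Ropp, Rpower_1 by lra. reflexivity. }
  apply Rmult_le_reg_r with (japanese k); [lra|].
  rewrite Rmult_assoc, Rinv_l, Rmult_1_r by lra.
  destruct (Z.eq_dec k 0) as [->|Hk].
  - unfold p_sym. destruct Z.eq_dec; [|lia].
    assert (japanese 0 = 1).
    { unfold japanese. replace (1 + 0 ^ 2) with 1 by ring. apply sqrt_1. }
    unfold Rdiv; lra.
  - pose proof (IZR_abs_ge1 k Hk). pose proof (p_sym_le_k beta k Hb Hk).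
    assert (Hj : japanese k <= 2 * Rabs (IZR k)).
    { rewrite <- pow2_abs in H0. nra. }
    apply Rle_trans with (/ beta / Rabs (IZR k) * (2 * Rabs (IZR k))).
    + apply Rmult_le_compat; try lra. left; now apply p_sym_pos.
    + replace (/ beta / Rabs (IZR k) * (2 * Rabs (IZR k))) with (2 / beta) by (field; lra).
      lra.
Qed.

(** * Energy of a state *)

Definition hhat (X : state) (k : Z) : C := fourier (fst X) k.
Definition uhat (X : state) (k : Z) : C := fourier (snd X) k.

Definition energy_at (beta : R) (X : state) (k : Z) : R :=
  Cmod (hhat X k) ^ 2 + p_sym beta k * Cmod (uhat X k) ^ 2.

Definition energy (beta : R) (Z : state) : R := H_norm beta Z ^ 2 / (2 * PI).

Lemma Rpower_ge_0 x y : 0 <= Rpower x y.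
Proof. left; apply exp_pos. Qed.

Lemma Hs_term_nonneg s v k : 0 <= Rpower (japanese k) (2 * s) * Cmod (fourier v k) ^ 2.
Proof. apply Rmult_le_pos; [apply Rpower_ge_0|apply Cmod2_ge_0]. Qed.

Lemma in_Hs_intro s v B : is_distribution v ->
  (forall N, zsum (fun k => Rpower (japanese k) (2 * s) * Cmod (fourier v k) ^ 2) N <= B) ->
  in_Hs s v.
Proof.
  intros Hv HB. split; [exact Hv|]. apply zsum_ex_seriesZ with B; auto using Hs_term_nonneg.
Qed.

Lemma in_Hs_elim s v : in_Hs s v -> is_distribution v /\ exists B, 0 <= B /\
  forall N, zsum (fun k => Rpower (japanese k) (2 * s) * Cmod (fourier v k) ^ 2) N <= B.
Proof.
  intros [Hv Hs]. split; [exact Hv|].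
  apply ex_seriesZ_zsum in Hs; [|intros; apply Hs_term_nonneg].
  destruct Hs as [Hs _]. eexists. split; [|exact Hs].
  exact (Hs 0%nat).
Qed.

Lemma Rpower_L2 k : Rpower (japanese k) (2 * 0) = 1.
Proof.
  rewrite Rmult_0_r. apply Rpower_O. pose proof (japanese_ge1 k). lra.
Qed.

Lemma in_L2_intro v B : is_distribution v ->
  (forall N, zsum (fun k => Cmod (fourier v k) ^ 2) N <= B) -> in_L2 v.
Proof.
  intros Hv HB. apply in_Hs_intro with B; [exact Hv|].
  intros N. rewrite (zsum_ext _ (fun k => Cmod (fourier v k) ^ 2)); auto.
  intros k _. rewrite Rpower_L2. ring.
Qed.

Lemma in_L2_elim v : in_L2 v -> is_distribution v /\ exists B, 0 <= B /\
  forall N, zsum (fun k => Cmod (fourier v k) ^ 2) N <= B.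
Proof.
  intros H. destruct (in_Hs_elim 0 v H) as [Hv [B [HB0 HB]]].
  split; [exact Hv|]. exists B. split; [exact HB0|]. intros N.
  rewrite (zsum_ext _ (fun k => Rpower (japanese k) (2 * 0) * Cmod (fourier v k) ^ 2)); auto.
  intros k _. rewrite Rpower_L2. ring.
Qed.

Lemma is_distribution_plus v w :
  is_distribution v -> is_distribution w -> is_distribution (d_plus v w).
Proof.
  intros [P1 [S1 [N1 [M1 H1]]]] [P2 [S2 [N2 [M2 H2]]]]. unfold d_plus. split; [|split].
  - intros; rewrite P1, P2; ring.
  - intros; rewrite S1, S2; ring.
  - exists (N1 + N2)%nat, (M1 + M2). intros phi B HB.
    assert (Cmod (v phi) <= M1 * B) by (apply H1; intros; apply HB; lia).
    assert (Cmod (w phi) <= M2 * B) by (apply H2; intros; apply HB; lia).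
    eapply Rle_trans; [apply Cmod_triangle|]. lra.
Qed.

Lemma is_distribution_scal c v : is_distribution v -> is_distribution (d_scal c v).
Proof.
  intros [P1 [S1 [N1 [M1 H1]]]]. unfold d_scal. split; [|split].
  - intros; rewrite P1; ring.
  - intros; rewrite S1; ring.
  - exists N1, (Cmod c * M1). intros phi B HB. rewrite Cmod_mult, Rmult_assoc.
    apply Rmult_le_compat_l; [apply Cmod_ge_0|now apply H1].
Qed.

Lemma is_distribution_deriv v : is_distribution v -> is_distribution (d_deriv v).
Proof.
  intros [P1 [S1 [N1 [M1 H1]]]]. unfold d_deriv. split; [|split].
  - intros; rewrite t_deriv_plus, P1; ring.
  - intros; rewrite t_deriv_scal, S1; ring.
  - exists (S N1), M1. intros phi B HB. rewrite Cmod_opp. apply H1.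
    intros j x Hj. rewrite <- t_Derive_n_S. apply HB. lia.
Qed.

Lemma fourier_plus v w k : fourier (d_plus v w) k = Cplus (fourier v k) (fourier w k).
Proof. unfold fourier, d_plus. ring. Qed.

Lemma fourier_scal c v k : fourier (d_scal c v) k = Cmult c (fourier v k).
Proof. unfold fourier, d_scal. ring. Qed.

Lemma fourier_minus v w k : fourier (d_minus v w) k = Cminus (fourier v k) (fourier w k).
Proof. unfold fourier, d_minus. ring. Qed.

Lemma fourier_opp v k : fourier (d_opp v) k = Copp (fourier v k).
Proof. unfold fourier, d_opp. ring. Qed.

Lemma fourier_deriv v k : is_distribution v ->
  fourier (d_deriv v) k = Cmult (Cmult Ci (RtoC (IZR k))) (fourier v k).
Proof.
  intros [_ [S1 _]]. unfold fourier, d_deriv. rewrite t_deriv_expN, S1. ring.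
Qed.

Lemma d_minus_eq v w : d_minus v w = d_plus v (d_scal (RtoC (-1)) w).
Proof.
  apply functional_extensionality; intros phi. unfold d_minus, d_plus, d_scal.
  cpair; ring.
Qed.

Lemma d_opp_eq v : d_opp v = d_scal (RtoC (-1)) v.
Proof.
  apply functional_extensionality; intros phi. unfold d_opp, d_scal. cpair; ring.
Qed.

Lemma st_minus_eq Z W : st_minus Z W = st_plus Z (st_scal (RtoC (-1)) W).
Proof. unfold st_minus, st_plus, st_scal; simpl. now rewrite !d_minus_eq. Qed.

Lemma in_Hs_plus s v w : in_Hs s v -> in_Hs s w -> in_Hs s (d_plus v w).
Proof.
  intros Hv Hw. destruct (in_Hs_elim _ _ Hv) as [Dv [B1 [_ H1]]].
  destruct (in_Hs_elim _ _ Hw) as [Dw [B2 [_ H2]]].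
  apply in_Hs_intro with (2 * B1 + 2 * B2); [now apply is_distribution_plus|].
  intros N. eapply Rle_trans; [|apply Rplus_le_compat;
    (apply Rmult_le_compat_l; [|first [exact (H1 N)|exact (H2 N)]]; lra)].
  rewrite <- !zsum_scal, <- zsum_plus. apply zsum_le. intros k.
  rewrite fourier_plus. pose proof (Cmod2_plus (fourier v k) (fourier w k)).
  pose proof (Rpower_ge_0 (japanese k) (2 * s)). nra.
Qed.

Lemma in_Hs_scal s c v : in_Hs s v -> in_Hs s (d_scal c v).
Proof.
  intros Hv. destruct (in_Hs_elim _ _ Hv) as [Dv [B1 [_ H1]]].
  apply in_Hs_intro with (Cmod c ^ 2 * B1); [now apply is_distribution_scal|].
  intros N. eapply Rle_trans; [|apply Rmult_le_compat_l; [apply Cmod2_ge_0|exact (H1 N)]].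
  rewrite <- zsum_scal. apply zsum_le. intros k.
  rewrite fourier_scal, Cmod2_mult. right. ring.
Qed.

Lemma in_Hs_minus s v w : in_Hs s v -> in_Hs s w -> in_Hs s (d_minus v w).
Proof. intros. rewrite d_minus_eq. auto using in_Hs_plus, in_Hs_scal. Qed.

Lemma in_Hs_opp s v : in_Hs s v -> in_Hs s (d_opp v).
Proof. intros. rewrite d_opp_eq. auto using in_Hs_scal. Qed.

Lemma in_L2_Hm12 v : in_L2 v -> in_Hs (- (1 / 2)) v.
Proof.
  intros H. destruct (in_L2_elim v H) as [Hv [B [_ HB]]].
  apply in_Hs_intro with B; [exact Hv|]. intros N. eapply Rle_trans; [|exact (HB N)].
  apply zsum_le. intros k.
  assert (Rpower (japanese k) (2 * - (1 / 2)) <= 1).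
  { pose proof (japanese_ge1 k).
    rewrite <- (Rpower_O (japanese k)) at 2 by lra. apply Rle_Rpower; lra. }
  pose proof (Cmod2_ge_0 (fourier v k)). nra.
Qed.

Lemma in_H12_deriv v : in_Hs (1 / 2) v -> in_Hs (- (1 / 2)) (d_deriv v).
Proof.
  intros H. destruct (in_Hs_elim _ v H) as [Hv [B [_ HB]]].
  apply in_Hs_intro with B; [now apply is_distribution_deriv|].
  intros N. eapply Rle_trans; [|exact (HB N)]. apply zsum_le. intros k.
  rewrite fourier_deriv, Cmod2_mult by exact Hv. rewrite <- Rmult_assoc.
  apply Rmult_le_compat_r; [apply Cmod2_ge_0|].
  pose proof (japanese_ge1 k). pose proof (japanese_sq k).
  replace (2 * - (1 / 2)) with (- (1)) by field. replace (2 * (1 / 2)) with 1 by field.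
  rewrite Rpower_Ropp, !Rpower_1 by lra. rewrite Cmod2; simpl.
  apply Rmult_le_reg_l with (japanese k); [lra|].
  rewrite <- Rmult_assoc, Rinv_r by lra. nra.
Qed.

Lemma in_H_plus Z W : in_H Z -> in_H W -> in_H (st_plus Z W).
Proof. intros [] []; split; simpl; now apply in_Hs_plus. Qed.

Lemma in_H_scal c Z : in_H Z -> in_H (st_scal c Z).
Proof. intros []; split; simpl; now apply in_Hs_scal. Qed.

Lemma in_H_minus Z W : in_H Z -> in_H W -> in_H (st_minus Z W).
Proof. intros; rewrite st_minus_eq. auto using in_H_plus, in_H_scal. Qed.

Lemma energy_at_nonneg beta Z k : 0 < beta -> 0 <= energy_at beta Z k.
Proof.
  intros Hb. pose proof (p_sym_pos beta k Hb). unfold energy_at.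
  pose proof (Cmod2_ge_0 (hhat Z k)). pose proof (Cmod2_ge_0 (uhat Z k)). nra.
Qed.

Lemma SeriesZ_ext f g : (forall k, f k = g k) -> SeriesZ f = SeriesZ g.
Proof. intros H. f_equal. now apply functional_extensionality. Qed.

(** The link between the norm and partial sums, on which all estimates are made. *)
Lemma energy_sup beta Z : 0 < beta -> in_H Z ->
  (forall N, zsum (energy_at beta Z) N <= energy beta Z) /\
  (forall B, (forall N, zsum (energy_at beta Z) N <= B) -> energy beta Z <= B).
Proof.
  intros Hb [H1 H2].
  destruct (in_L2_elim _ H1) as [_ [B1 [_ K1]]].
  destruct (in_Hs_elim _ _ H2) as [_ [B2 [_ K2]]].
  assert (X1 : ex_seriesZ (fun k => Cmod (hhat Z k) ^ 2)).
  { apply zsum_ex_seriesZ with B1; auto. intros; apply Cmod2_ge_0. }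
  assert (X2 : ex_seriesZ (fun k => p_sym beta k * Cmod (uhat Z k) ^ 2)).
  { apply zsum_ex_seriesZ with ((1 + 2 / beta) * B2).
    - intros k. apply Rmult_le_pos; [left; now apply p_sym_pos|apply Cmod2_ge_0].
    - intros N. assert (0 < 2 / beta) by (apply Rdiv_lt_0_compat; lra).
      eapply Rle_trans; [|apply Rmult_le_compat_l; [|exact (K2 N)]; lra].
      rewrite <- zsum_scal. apply zsum_le. intros k. rewrite <- Rmult_assoc.
      apply Rmult_le_compat_r; [apply Cmod2_ge_0|now apply p_sym_weight]. }
  assert (S12 : SeriesZ (energy_at beta Z) = SeriesZ (fun k => Cmod (hhat Z k) ^ 2) +
     SeriesZ (fun k => p_sym beta k * Cmod (uhat Z k) ^ 2)).
  { destruct X1 as [X1 X1'], X2 as [X2 X2']. unfold SeriesZ, energy_at.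
    rewrite (Series_plus _ _ X1 X2), (Series_plus _ _ X1' X2'). ring. }
  assert (X : ex_seriesZ (energy_at beta Z)).
  { destruct X1 as [X1 X1'], X2 as [X2 X2'].
    split; [exact (ex_series_plus _ _ X1 X2)|exact (ex_series_plus _ _ X1' X2')]. }
  apply ex_seriesZ_zsum in X; [|intros; now apply energy_at_nonneg].
  replace (energy beta Z) with (SeriesZ (energy_at beta Z)); [exact X|].
  assert (HH : Re (H_inner beta Z Z) = 2 * PI * SeriesZ (energy_at beta Z)).
  { assert (Rs : forall r z w r', Re (Cplus (Cmult (RtoC r) z) (Cmult (RtoC r') w)) =
        r * Re z + r' * Re w) by (intros; unfold Re; simpl; ring).
    rewrite S12. unfold H_inner. rewrite Rs, <- Rmult_plus_distr_l. f_equal. f_equal.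
    - apply (SeriesZ_ext (fun k => Re (Cmult (hhat Z k) (Cconj (hhat Z k))))). intros k.
      now rewrite Cmult_conj_self.
    - apply (SeriesZ_ext (fun k => Re (Cmult (RtoC (p_sym beta k))
         (Cmult (uhat Z k) (Cconj (uhat Z k)))))). intros k.
      rewrite Cmult_conj_self. unfold Re; simpl. ring. }
  unfold energy, H_norm. rewrite HH, <- Rsqr_pow2, Rsqr_sqrt.
  - field. pose proof PI_RGT_0; lra.
  - apply Rmult_le_pos; [pose proof PI_RGT_0; lra|].
    eapply Rle_trans; [|exact (proj1 X 0%nat)]. simpl; lra.
Qed.

Lemma energy_nonneg beta Z : 0 <= energy beta Z.
Proof.
  unfold energy. apply Rmult_le_pos; [apply pow2_ge_0|].
  left. apply Rinv_0_lt_compat, twoPI_pos.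
Qed.

Lemma H_norm_nonneg beta Z : 0 <= H_norm beta Z.
Proof. apply sqrt_pos. Qed.

Lemma H_norm_energy beta Z : H_norm beta Z ^ 2 = 2 * PI * energy beta Z.
Proof. unfold energy. field. pose proof PI_RGT_0; lra. Qed.

Lemma energy_le_of_norm beta Z W : H_norm beta Z <= H_norm beta W -> energy beta Z <= energy beta W.
Proof.
  intros H. unfold energy. apply Rmult_le_compat_r.
  - left. apply Rinv_0_lt_compat, twoPI_pos.
  - apply pow_incr. split; [apply H_norm_nonneg|exact H].
Qed.

Lemma energy_approx beta Z eps : 0 < beta -> in_H Z -> 0 < eps ->
  exists N0, forall N, (N0 <= N)%nat -> energy beta Z - eps <= zsum (energy_at beta Z) N.
Proof.
  intros Hb HZ He. destruct (energy_sup beta Z Hb HZ) as [_ H].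
  apply NNPP. intros Hn.
  assert (energy beta Z <= energy beta Z - eps); [|lra].
  apply H. intros N. apply Rnot_lt_le. intros HN. apply Hn. exists N.
  intros L HL. pose proof (zsum_mono (energy_at beta Z) N L (fun k => energy_at_nonneg beta Z k Hb) HL). lra.
Qed.

Lemma energy_at_plus_le beta Z W k : 0 < beta ->
  energy_at beta (st_plus Z W) k <= 2 * energy_at beta Z k + 2 * energy_at beta W k.
Proof.
  intros Hb. unfold energy_at, hhat, uhat, st_plus; cbn [fst snd]. rewrite !fourier_plus.
  pose proof (Cmod2_plus (fourier (fst Z) k) (fourier (fst W) k)).
  pose proof (Cmod2_plus (fourier (snd Z) k) (fourier (snd W) k)).
  pose proof (p_sym_pos beta k Hb). nra.
Qed.

Lemma energy_plus_le beta Z W : 0 < beta -> in_H Z -> in_H W ->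
  energy beta (st_plus Z W) <= 2 * energy beta Z + 2 * energy beta W.
Proof.
  intros Hb HZ HW. apply (energy_sup beta _ Hb (in_H_plus _ _ HZ HW)). intros N.
  pose proof (proj1 (energy_sup beta Z Hb HZ) N). pose proof (proj1 (energy_sup beta W Hb HW) N).
  apply Rle_trans with (zsum (fun k => 2 * energy_at beta Z k + 2 * energy_at beta W k) N).
  - apply zsum_le. intros; now apply energy_at_plus_le.
  - rewrite zsum_plus, !zsum_scal. lra.
Qed.

Lemma energy_at_le_energy beta Z k : 0 < beta -> in_H Z -> energy_at beta Z k <= energy beta Z.
Proof.
  intros Hb HZ. destruct (zsum_term (energy_at beta Z) k (fun k => energy_at_nonneg beta Z k Hb)) as [N HN].
  pose proof (proj1 (energy_sup beta Z Hb HZ) N). lra.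
Qed.

Lemma hhat_sq_le beta Z k : 0 < beta -> Cmod (hhat Z k) ^ 2 <= energy_at beta Z k.
Proof.
  intros Hb. unfold energy_at. pose proof (p_sym_pos beta k Hb). pose proof (Cmod2_ge_0 (uhat Z k)). nra.
Qed.

Lemma uhat_sq_le beta Z k : 0 < beta -> p_sym beta k * Cmod (uhat Z k) ^ 2 <= energy_at beta Z k.
Proof. intros Hb. unfold energy_at. pose proof (Cmod2_ge_0 (hhat Z k)). lra. Qed.

(** * Trigonometric states lie in the domain and are dense *)

Definition dist_of (G : R -> C) : functional :=
  fun phi => Cmult (RtoC (2 * PI)) (cmean (fun x => Cmult (G x) (tfun phi x))).

Lemma is_distribution_dist_of G : ccont G -> is_distribution (dist_of G).
Proof.
  intros HG. unfold dist_of. split; [|split].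
  - intros phi psi. rewrite <- Cmult_plus_distr_l. f_equal.
    rewrite <- cmean_plus by auto with cont.
    apply cmean_ext. intros x _. rewrite tfun_plus. ring.
  - intros c phi. rewrite Cmult_assoc, (Cmult_comm c), <- Cmult_assoc. f_equal.
    rewrite <- cmean_scal by auto with cont.
    apply cmean_ext. intros x _. rewrite tfun_scal. ring.
  - destruct (ccont_bounded G HG) as [K [HK HGK]].
    exists 0%nat, (2 * PI * (2 * K)). intros phi B HB.
    rewrite Cmod_mult, Cmod_R, Rabs_pos_eq by (left; apply twoPI_pos).
    rewrite !Rmult_assoc. pose proof PI_RGT_0.
    apply Rmult_le_compat_l; [lra|]. apply Rmult_le_compat_l; [lra|].
    apply cmean_mod_le; [auto with cont|].
    intros x Hx. rewrite Cmod_mult. apply Rmult_le_compat; try apply Cmod_ge_0.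
    + auto.
    + exact (HB 0%nat x (le_n _)).
Qed.

Lemma fourier_dist_of G k : fourier (dist_of G) k = fhat G k.
Proof.
  unfold fourier, dist_of, fhat. rewrite Cmult_assoc.
  replace (Cmult (RtoC (/ (2 * PI))) (RtoC (2 * PI))) with (RtoC 1).
  2:{ rewrite <- RtoC_mult. f_equal. field. pose proof PI_RGT_0; lra. }
  rewrite Cmult_1_l. apply cmean_ext. intros x _. now rewrite tfun_expN.
Qed.

Lemma in_L2_dist_of G : ccont G -> in_L2 (dist_of G).
Proof.
  intros HG. apply in_L2_intro with (mean (fun x => Cmod (G x) ^ 2)).
  - now apply is_distribution_dist_of.
  - intros N. rewrite (zsum_ext _ (fun k => Cmod (fhat G k) ^ 2))
      by (intros; now rewrite fourier_dist_of).
    now apply Bessel.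
Qed.

Lemma d_mult_dist_of (f : smoothT) G :
  d_mult f (dist_of G) = dist_of (fun x => Cmult (RtoC (f x)) (G x)).
Proof.
  apply functional_extensionality. intros phi. unfold d_mult, dist_of. f_equal.
  apply cmean_ext. intros x _. cpair; ring.
Qed.

Definition trig (c : Z -> C) (N : nat) : functional := dist_of (trigpoly c N).

Lemma fourier_trig c N k : fourier (trig c N) k = trunc (RtoC 0) N c k.
Proof. unfold trig. rewrite fourier_dist_of. apply fhat_trigpoly. Qed.

Lemma in_Hs_trig s c N : in_Hs s (trig c N).
Proof.
  apply in_Hs_intro with (zsum (fun k => Rpower (japanese k) (2 * s) * Cmod (fourier (trig c N) k) ^ 2) N).
  - apply is_distribution_dist_of, ccont_trigpoly.
  - intros L. destruct (le_lt_dec N L) as [HL|HL].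
    + right. apply zsum_vanish_out; [|exact HL]. intros k Hk.
      rewrite fourier_trig, trunc_out, Cmod_0 by exact Hk. ring.
    + apply zsum_mono; [|lia]. intros; apply Hs_term_nonneg.
Qed.

Definition trig_state (Z : state) (N : nat) : state := (trig (hhat Z) N, trig (uhat Z) N).

Lemma in_H_trig_state Z N : in_H (trig_state Z N).
Proof. split; apply in_Hs_trig. Qed.

Lemma is_multiplier_trig sigma c N :
  is_multiplier sigma (trig c N) (trig (fun k => Cmult (sigma k) (c k)) N).
Proof.
  split; [apply is_distribution_dist_of, ccont_trigpoly|]. intros k. rewrite !fourier_trig.
  destruct (inwin_dec N k); [now rewrite !trunc_in|].
  rewrite !trunc_out by assumption. ring.
Qed.

Lemma trig_in_domain beta a b Z N :
  exists W, in_H W /\ Ad beta a b (trig_state Z N) W.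
Proof.
  set (Tu := trig (fun k => Cmult (Copp (Cmult Ci (RtoC (m_sym beta k)))) (uhat Z k)) N).
  set (Pu := trig (fun k => Cmult (RtoC (p_sym beta k)) (uhat Z k)) N).
  assert (HM : forall f c, in_L2 (d_mult f (trig c N))).
  { intros f c. unfold trig. rewrite d_mult_dist_of. apply in_L2_dist_of.
    apply ccont_mult; [apply ccont_real, cont_sfun|apply ccont_trigpoly]. }
  exists (d_minus Tu (d_mult (s_mult a a) (trig (hhat Z) N)),
     d_minus (d_opp (d_deriv (trig (hhat Z) N))) (d_mult (s_mult b b) Pu)).
  split.
  - split; simpl.
    + apply in_Hs_minus; [apply in_Hs_trig|apply HM].
    + apply in_Hs_minus; [apply in_Hs_opp, in_H12_deriv, in_Hs_trig|].
      apply in_L2_Hm12, HM.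
  - split; [split; apply in_Hs_trig|].
    exists Tu, Pu. split; [apply is_multiplier_trig|]. split; [apply is_multiplier_trig|].
    reflexivity.
Qed.

Lemma trig_dense beta Z eps : 0 < beta -> in_H Z -> 0 < eps ->
  exists N, energy beta (st_minus Z (trig_state Z N)) <= eps.
Proof.
  intros Hb HZ He. pose proof (energy_sup beta Z Hb HZ) as [H1 _].
  destruct (zsum_cauchy (energy_at beta Z) (energy beta Z) eps) as [N HN]; auto.
  { intros; now apply energy_at_nonneg. }
  exists N. apply (energy_sup beta _ Hb (in_H_minus _ _ HZ (in_H_trig_state Z N))).
  set (D := st_minus Z (trig_state Z N)).
  assert (G : forall L, (N <= L)%nat -> zsum (energy_at beta D) L <= eps).
  { intros L HL. replace (zsum (energy_at beta D) L) with (zsum (energy_at beta Z) L - zsum (energy_at beta Z) N);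
      [now apply HN|].
    rewrite <- (zsum_trunc (energy_at beta Z) N L HL), <- zsum_minus. apply zsum_ext. intros k _.
    unfold energy_at at 3, D, hhat, uhat, st_minus, trig_state; cbn [fst snd].
    rewrite !fourier_minus, !fourier_trig. fold (hhat Z k) (uhat Z k).
    destruct (inwin_dec N k).
    - rewrite !trunc_in by assumption. unfold hhat, uhat.
      replace (Cminus (fourier (fst Z) k) (fourier (fst Z) k)) with (RtoC 0) by ring.
      replace (Cminus (fourier (snd Z) k) (fourier (snd Z) k)) with (RtoC 0) by ring.
      rewrite Cmod_0. ring.
    - rewrite !trunc_out by assumption. unfold energy_at.
      replace (Cminus (hhat Z k) (RtoC 0)) with (hhat Z k) by ring.
      replace (Cminus (uhat Z k) (RtoC 0)) with (uhat Z k) by ring. ring. }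
  intros L. destruct (le_lt_dec N L) as [HL|HL]; [now apply G|].
  eapply Rle_trans; [|exact (G N (le_n _))].
  apply zsum_mono; [intros; now apply energy_at_nonneg|lia].
Qed.

(** * Energy dissipation along an orbit *)

Definition damp_h (a : smoothT) (X : state) (k : Z) : C :=
  fourier (d_mult (s_mult a a) (fst X)) k.

(** Coefficients of [b^2 P u] when [(X, Y)] is in the graph of the generator, read off
    its second line; this avoids naming the distribution [P u]. *)
Definition damp_u (X Y : state) (k : Z) : C :=
  Cminus (Copp (Cmult (Cmult Ci (RtoC (IZR k))) (hhat X k))) (uhat Y k).

Definition pairing (beta : R) (X Y : state) (k : Z) : R :=
  fst (Cmult (hhat Y k) (Cconj (hhat X k))) +
  p_sym beta k * fst (Cmult (uhat Y k) (Cconj (uhat X k))).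

Lemma Ad_coef beta a b X Y : in_H X -> Ad beta a b X Y ->
  (forall k, hhat Y k = Cminus (Copp (Cmult (Cmult Ci (RtoC (m_sym beta k))) (uhat X k))) (damp_h a X k)) /\
  exists Pu, is_distribution Pu /\
    (forall k, fourier Pu k = Cmult (RtoC (p_sym beta k)) (uhat X k)) /\
    (forall k, fourier (d_mult (s_mult b b) Pu) k = damp_u X Y k).
Proof.
  intros [[Hd _] _] [_ [Tu [Pu [[_ HT] [[DP HP] HY]]]]]. subst Y. split.
  - intros k. unfold hhat at 1; cbn [fst]. rewrite fourier_minus, HT. unfold damp_h, uhat. ring.
  - exists Pu. split; [exact DP|]. split; [exact HP|]. intros k.
    unfold damp_u, uhat; cbn [snd].
    rewrite fourier_minus, fourier_opp, fourier_deriv by exact Hd. unfold hhat. ring.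
Qed.

Lemma Pu_l2 beta X Pu N : 0 < beta -> in_H X ->
  (forall k, fourier Pu k = Cmult (RtoC (p_sym beta k)) (uhat X k)) ->
  zsum (fun k => Cmod (fourier Pu k) ^ 2) N <= (1 + / beta) * energy beta X.
Proof.
  intros Hb HX HP. assert (0 < / beta) by now apply Rinv_0_lt_compat.
  apply Rle_trans with ((1 + / beta) * zsum (energy_at beta X) N);
    [|apply Rmult_le_compat_l; [lra|apply (proj1 (energy_sup beta X Hb HX))]].
  rewrite <- zsum_scal. apply zsum_le. intros k.
  rewrite HP, Cmod2_mult. pose proof (p_sym_pos beta k Hb).
  rewrite Cmod_R, Rabs_pos_eq by lra.
  pose proof (p_sym_le beta k Hb). pose proof (uhat_sq_le beta X k Hb).
  pose proof (Cmod2_ge_0 (uhat X k)).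
  apply Rle_trans with ((1 + / beta) * (p_sym beta k * Cmod (uhat X k) ^ 2)).
  - replace (p_sym beta k ^ 2 * Cmod (uhat X k) ^ 2)
      with (p_sym beta k * (p_sym beta k * Cmod (uhat X k) ^ 2)) by ring.
    apply Rmult_le_compat_r; [nra|lra].
  - apply Rmult_le_compat_l; lra.
Qed.

Lemma hhat_l2 beta X N : 0 < beta -> in_H X ->
  zsum (fun k => Cmod (fourier (fst X) k) ^ 2) N <= energy beta X.
Proof.
  intros Hb HX. eapply Rle_trans; [|exact (proj1 (energy_sup beta X Hb HX) N)].
  apply zsum_le. intros k. now apply hhat_sq_le.
Qed.

(** The conservative part of the generator cancels term by term because
    [m_beta(k) = k p_beta(k)]. *)
Lemma pairingE beta a b X Y Pu k : in_H X -> Ad beta a b X Y ->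
  (forall k, fourier Pu k = Cmult (RtoC (p_sym beta k)) (uhat X k)) ->
  pairing beta X Y k =
  - (fst (Cmult (damp_h a X k) (Cconj (hhat X k))) + fst (Cmult (damp_u X Y k) (Cconj (fourier Pu k)))).
Proof.
  intros HX HA HP. destruct (Ad_coef _ _ _ _ _ HX HA) as [H1 _].
  assert (H2 : uhat Y k = Cminus (Copp (Cmult (Cmult Ci (RtoC (IZR k))) (hhat X k))) (damp_u X Y k))
    by (unfold damp_u; ring).
  unfold pairing. rewrite H1, H2, HP, <- p_symE. simpl. ring.
Qed.

Lemma dissipation beta a b Ma Mb X Y K eps : 0 < beta ->
  bounded_by (s_mult a a) Ma -> bounded_by (s_mult b b) Mb ->
  in_H X -> Ad beta a b X Y -> 0 < eps ->
  exists N0, forall N, (N0 <= N)%nat ->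
    zsum (pairing beta X Y) N <=
    eps - (/ Ma * zsum (fun k => Cmod (damp_h a X k) ^ 2) K + / Mb * zsum (fun k => Cmod (damp_u X Y k) ^ 2) K).
Proof.
  intros Hb Ba Bb HX HA He.
  destruct (Ad_coef _ _ _ _ _ HX HA) as [_ [Pu [DP [HP HB]]]].
  destruct (mult_coercive (s_mult a a) Ma (fst X) (energy beta X) K (eps / 2)) as [N1 H1]; auto.
  { apply HX. } { intros; now apply hhat_l2. } { lra. }
  destruct (mult_coercive (s_mult b b) Mb Pu ((1 + / beta) * energy beta X) K (eps / 2)) as [N2 H2]; auto.
  { intros; now apply Pu_l2. } { lra. }
  exists (N1 + N2)%nat. intros N HN. specialize (H1 N ltac:(lia)). specialize (H2 N ltac:(lia)).
  rewrite (zsum_ext (pairing beta X Y) (fun k => - (fst (Cmult (damp_h a X k) (Cconj (hhat X k))) +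
     fst (Cmult (damp_u X Y k) (Cconj (fourier Pu k)))))) by (intros; now apply (pairingE beta a b)).
  rewrite zsum_opp, zsum_plus.
  rewrite (zsum_ext (fun k => Cmod (fourier (d_mult (s_mult b b) Pu) k) ^ 2)
     (fun k => Cmod (damp_u X Y k) ^ 2)) in H2 by (intros; now rewrite HB).
  rewrite (zsum_ext (fun k => fst (Cmult (fourier (d_mult (s_mult b b) Pu) k) _))
     (fun k => fst (Cmult (damp_u X Y k) (Cconj (fourier Pu k))))) in H2
    by (intros; now rewrite HB).
  change (zsum (fun k => Cmod (damp_h a X k) ^ 2) K) with
    (zsum (fun k => Cmod (fourier (d_mult (s_mult a a) (fst X)) k) ^ 2) K).
  change (zsum (fun k => fst (Cmult (damp_h a X k) (Cconj (hhat X k)))) N) with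
    (zsum (fun k => fst (Cmult (fourier (d_mult (s_mult a a) (fst X)) k)
       (Cconj (fourier (fst X) k)))) N).
  lra.
Qed.

Definition step_rem (X Y : R -> state) (s t : R) : state :=
  st_minus (st_scal (RtoC (/ s)) (st_minus (X (t + s)) (X t))) (Y t).

(** What the semigroup gives for an initial datum in the domain: [X] is the orbit,
    [Y] its time derivative.  The difference quotients converge uniformly in time,
    because the remainder at time [t] is the image by the contraction [S(t)] of the
    remainder at time 0. *)
Record classical_orbit (beta : R) (a b : smoothT) (X Y : R -> state) (E1 : R) : Prop := {
  orb_in : forall t, 0 <= t -> in_H (X t);
  orb_in' : forall t, 0 <= t -> in_H (Y t);
  orb_dec : forall t s, 0 <= t -> 0 <= s -> energy beta (X (t + s)) <= energy beta (X t);
  orb_der : forall t, 0 <= t -> energy beta (Y t) <= E1;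
  orb_gen : forall t, 0 <= t -> Ad beta a b (X t) (Y t);
  orb_step_rem : forall rho, 0 < rho -> exists s0, 0 < s0 /\ forall s, 0 < s <= s0 ->
    forall t, 0 <= t -> energy beta (step_rem X Y s t) <= rho
}.

Arguments orb_in {beta a b X Y E1} _ t _.
Arguments orb_in' {beta a b X Y E1} _ t _.
Arguments orb_dec {beta a b X Y E1} _ t s _ _.
Arguments orb_der {beta a b X Y E1} _ t _.
Arguments orb_gen {beta a b X Y E1} _ t _.
Arguments orb_step_rem {beta a b X Y E1} _ rho _.

Lemma step_rem_in_H {beta a b X Y E1} s t : classical_orbit beta a b X Y E1 ->
  0 <= t -> 0 < s -> in_H (step_rem X Y s t).
Proof.
  intros HO Ht Hs. destruct HO.
  apply in_H_minus; [|auto]. apply in_H_scal, in_H_minus; apply orb_in0; lra.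
Qed.

Lemma difference_quotient (s : R) (p q r : C) : 0 < s ->
  p = Cplus q (Cmult (RtoC s) (Cplus r (Cminus (Cmult (RtoC (/ s)) (Cminus p q)) r))).
Proof.
  intros Hs.
  transitivity (Cplus q (Cmult (Cmult (RtoC s) (RtoC (/ s))) (Cminus p q))); [|ring].
  rewrite <- RtoC_mult, Rinv_r by lra. ring.
Qed.

Lemma step_rem_h X Y s t k : 0 < s -> hhat (X (t + s)) k =
  Cplus (hhat (X t) k) (Cmult (RtoC s) (Cplus (hhat (Y t) k) (hhat (step_rem X Y s t) k))).
Proof.
  intros Hs. unfold hhat, step_rem, st_minus, st_scal; cbn [fst snd].
  rewrite fourier_minus, fourier_scal, fourier_minus. now apply difference_quotient.
Qed.

Lemma step_rem_u X Y s t k : 0 < s -> uhat (X (t + s)) k =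
  Cplus (uhat (X t) k) (Cmult (RtoC s) (Cplus (uhat (Y t) k) (uhat (step_rem X Y s t) k))).
Proof.
  intros Hs. unfold uhat, step_rem, st_minus, st_scal; cbn [fst snd].
  rewrite fourier_minus, fourier_scal, fourier_minus. now apply difference_quotient.
Qed.

(** Expansion of one squared modulus along a step, cross term with the remainder
    split by Young's inequality with weight [d]. *)
Lemma step_sq (x y r : C) s d : 0 < s -> 0 < d ->
  Cmod (Cplus x (Cmult (RtoC s) (Cplus y r))) ^ 2 <=
  Cmod x ^ 2 + 2 * s * fst (Cmult y (Cconj x)) + s * (d * Cmod x ^ 2 + Cmod r ^ 2 / d)
  + s ^ 2 * (2 * Cmod y ^ 2 + 2 * Cmod r ^ 2).
Proof.
  intros Hs Hd. rewrite !Cmod2, Cmult_conj_re. destruct x as [x1 x2], y as [y1 y2], r as [r1 r2].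
  simpl.
  assert (Y : forall p q, 2 * (p * q) <= d * (q * q) + p * p / d).
  { intros p q. apply Rmult_le_reg_l with d; [exact Hd|].
    replace (d * (d * (q * q) + p * p / d)) with ((d * q) * (d * q) + p * p) by (field; lra).
    pose proof (pow2_ge_0 (d * q - p)). nra. }
  pose proof (Y r1 x1) as H1. pose proof (Y r2 x2) as H2.
  apply Rmult_le_compat_l with (r := s) in H1; [|lra].
  apply Rmult_le_compat_l with (r := s) in H2; [|lra].
  assert (Q : forall p q, (p + q) * (p + q) <= 2 * (p * p) + 2 * (q * q))
    by (intros p q; pose proof (pow2_ge_0 (p - q)); nra).
  pose proof (Q y1 r1) as H3. pose proof (Q y2 r2) as H4.
  apply Rmult_le_compat_l with (r := s * s) in H3; [|nra].
  apply Rmult_le_compat_l with (r := s * s) in H4; [|nra].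
  unfold Rdiv in *. nra.
Qed.

Lemma step_energy_at beta X Y s t d k : 0 < beta -> 0 < s -> 0 < d ->
  energy_at beta (X (t + s)) k <=
  energy_at beta (X t) k + 2 * s * pairing beta (X t) (Y t) k
  + s * (d * energy_at beta (X t) k + / d * energy_at beta (step_rem X Y s t) k)
  + s ^ 2 * (2 * energy_at beta (Y t) k + 2 * energy_at beta (step_rem X Y s t) k).
Proof.
  intros Hb Hs Hd. unfold energy_at at 1. rewrite (step_rem_h X Y), (step_rem_u X Y) by exact Hs.
  pose proof (step_sq (hhat (X t) k) (hhat (Y t) k) (hhat (step_rem X Y s t) k) s d Hs Hd) as H1.
  pose proof (step_sq (uhat (X t) k) (uhat (Y t) k) (uhat (step_rem X Y s t) k) s d Hs Hd) as H2.
  pose proof (p_sym_pos beta k Hb).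
  apply Rmult_le_compat_l with (r := p_sym beta k) in H2; [|lra].
  unfold energy_at, pairing, Rdiv in *. lra.
Qed.

Lemma energy_drop {beta a b Ma Mb X Y E1} s t d K : 0 < beta ->
  bounded_by (s_mult a a) Ma -> bounded_by (s_mult b b) Mb ->
  classical_orbit beta a b X Y E1 -> 0 < s -> 0 <= t -> 0 < d ->
  2 * s * (/ Ma * zsum (fun k => Cmod (damp_h a (X t) k) ^ 2) K
           + / Mb * zsum (fun k => Cmod (damp_u (X t) (Y t) k) ^ 2) K) <=
  energy beta (X t) - energy beta (X (t + s))
  + s * (d * energy beta (X t) + / d * energy beta (step_rem X Y s t))
  + s ^ 2 * (2 * E1 + 2 * energy beta (step_rem X Y s t)).
Proof.
  intros Hb Ba Bb HO Hs Ht Hd.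
  pose proof (step_rem_in_H s t HO Ht Hs) as HR.
  set (D := / Ma * _ + / Mb * _). apply Rnot_lt_le. intros Hlt.
  set (rhs := _ + _ + _) in Hlt.
  set (eps := (2 * s * D - rhs) / (2 * s + 2)).
  assert (He : 0 < eps) by (apply Rdiv_lt_0_compat; lra).
  assert (HX := orb_in HO t Ht).
  destruct (dissipation beta a b Ma Mb (X t) (Y t) K eps Hb Ba Bb HX
    (orb_gen HO t Ht) He) as [N1 H1].
  destruct (energy_approx beta (X (t + s)) eps Hb) as [N2 H2]; auto.
  { apply (orb_in HO). lra. }
  set (N := (N1 + N2)%nat).
  specialize (H1 N ltac:(unfold N; lia)). specialize (H2 N ltac:(unfold N; lia)).
  fold D in H1.
  assert (H3 : zsum (energy_at beta (X (t + s))) N <= zsum (fun k =>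
    energy_at beta (X t) k + 2 * s * pairing beta (X t) (Y t) k
  + s * (d * energy_at beta (X t) k + / d * energy_at beta (step_rem X Y s t) k)
  + s ^ 2 * (2 * energy_at beta (Y t) k + 2 * energy_at beta (step_rem X Y s t) k)) N)
    by (apply zsum_le; intros; now apply step_energy_at).
  repeat (rewrite ?zsum_plus, ?zsum_scal in H3).
  pose proof (proj1 (energy_sup beta _ Hb HX) N) as B1.
  pose proof (proj1 (energy_sup beta _ Hb HR) N) as B2.
  pose proof (proj1 (energy_sup beta _ Hb (orb_in' HO t Ht)) N) as B3.
  pose proof (orb_der HO t Ht) as B4.
  assert (Hid : 0 < / d) by now apply Rinv_0_lt_compat.
  apply Rmult_le_compat_l with (r := 2 * s) in H1; [|lra].
  assert (C1 : s * (d * zsum (energy_at beta (X t)) N + / d * zsum (energy_at beta (step_rem X Y s t)) N) <=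
    s * (d * energy beta (X t) + / d * energy beta (step_rem X Y s t))).
  { apply Rmult_le_compat_l; [lra|]. apply Rplus_le_compat; apply Rmult_le_compat_l; lra. }
  assert (C2 : s ^ 2 * (2 * zsum (energy_at beta (Y t)) N + 2 * zsum (energy_at beta (step_rem X Y s t)) N) <=
     s ^ 2 * (2 * E1 + 2 * energy beta (step_rem X Y s t))).
  { apply Rmult_le_compat_l; [apply pow2_ge_0|lra]. }
  assert (Heps : eps * (2 * s + 2) = 2 * s * D - rhs) by (unfold eps; field; lra).
  assert (2 * s * D - rhs <= 2 * s * eps + eps); [|nra].
  unfold rhs. nra.
Qed.

Lemma energy_settles {beta a b X Y E1} eps : classical_orbit beta a b X Y E1 -> 0 < eps ->
  exists T, 0 <= T /\ forall t s, T <= t -> 0 <= s -> energy beta (X t) - energy beta (X (t + s)) <= eps.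
Proof.
  intros HO He. apply NNPP. intros Hn.
  assert (Hn' : forall T, 0 <= T -> exists t s, T <= t /\ 0 <= s /\
     eps < energy beta (X t) - energy beta (X (t + s))).
  { intros T HT. apply NNPP. intros H. apply Hn. exists T. split; [exact HT|].
    intros t s Ht Hs. apply Rnot_lt_le. intros HH. apply H. now exists t, s. }
  assert (G : forall n : nat, exists t, 0 <= t /\ energy beta (X t) <= energy beta (X 0) - INR n * eps).
  { induction n as [|n [t [Ht IH]]].
    - exists 0. simpl. split; lra.
    - destruct (Hn' t Ht) as [t' [s [H1 [H2 H3]]]]. exists (t' + s). split; [lra|].
      pose proof (orb_dec HO t (t' - t) Ht ltac:(lra)) as H4.
      replace (t + (t' - t)) with t' in H4 by ring. rewrite S_INR. lra. }
  destruct (archimedean_mult (energy beta (X 0)) eps He) as [n Hn2].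
  destruct (G n) as [t [_ Ht]]. pose proof (energy_nonneg beta (X t)). lra.
Qed.

Lemma orbit_bound {beta a b X Y E1} t : classical_orbit beta a b X Y E1 -> 0 <= t ->
  energy beta (X t) <= energy beta (X 0).
Proof.
  intros HO Ht. pose proof (orb_dec HO 0 t (Rle_refl _) Ht) as H.
  now rewrite Rplus_0_l in H.
Qed.

Lemma sq_bounded (f : smoothT) : exists M, bounded_by (s_mult f f) M.
Proof.
  destruct (cont_bounded _ (cont_sfun (s_mult f f))) as [M [HM H]].
  exists M. split; [exact HM|]. intros x Hx. specialize (H x Hx).
  pose proof (Rle_abs ((s_mult f f) x)). split; [simpl; nra|lra].
Qed.

(** The energy converges, so over a short fixed step it eventually drops by an
    arbitrarily small amount; the step expansion, uniform in time, turns this into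
    pointwise decay of the damping terms. *)
Lemma damping_vanishes {beta a b X Y E1} eps : 0 < beta ->
  classical_orbit beta a b X Y E1 -> 0 < eps ->
  exists T, 0 <= T /\ forall t K, T <= t ->
    zsum (fun k => Cmod (damp_h a (X t) k) ^ 2) K <= eps /\
    zsum (fun k => Cmod (damp_u (X t) (Y t) k) ^ 2) K <= eps.
Proof.
  intros Hb HO He.
  destruct (sq_bounded a) as [Ma Ba]. destruct (sq_bounded b) as [Mb Bb].
  assert (HMa : 0 < / Ma) by (apply Rinv_0_lt_compat, Ba).
  assert (HMb : 0 < / Mb) by (apply Rinv_0_lt_compat, Bb).
  set (E0 := energy beta (X 0)). assert (HE0 : 0 <= E0) by apply energy_nonneg.
  assert (HE1 : 0 <= E1).
  { eapply Rle_trans; [apply energy_nonneg|apply (orb_der HO 0 (Rle_refl _))]. }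
  set (kap := eps * Rmin (/ Ma) (/ Mb)).
  assert (Hk : 0 < kap) by (apply Rmult_lt_0_compat; [lra|now apply Rmin_glb_lt]).
  set (d := kap / (2 * (E0 + 1))).
  assert (Hd : 0 < d) by (apply Rdiv_lt_0_compat; lra).
  set (rho := Rmin 1 (d * kap / 2)).
  assert (Hrho : 0 < rho) by (apply Rmin_glb_lt; [lra|nra]).
  destruct (orb_step_rem HO rho Hrho) as [s0 [Hs0 HR]].
  set (s := Rmin s0 (kap / (4 * (E1 + 1)))).
  assert (Hs : 0 < s) by (apply Rmin_glb_lt; [exact Hs0|apply Rdiv_lt_0_compat; lra]).
  assert (Hss0 : s <= s0) by apply Rmin_l.
  assert (Hs2 : s * (2 * E1 + 2) <= kap / 2).
  { apply Rle_trans with (kap / (4 * (E1 + 1)) * (2 * E1 + 2)).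
    - apply Rmult_le_compat_r; [lra|apply Rmin_r].
    - right. field. lra. }
  destruct (energy_settles (s * kap / 2) HO) as [T [HT0 HT]]; [nra|].
  exists T. split; [exact HT0|]. intros t K Ht.
  assert (Ht0 : 0 <= t) by lra.
  pose proof (energy_drop s t d K Hb Ba Bb HO Hs Ht0 Hd) as H.
  specialize (HT t s Ht (Rlt_le _ _ Hs)).
  pose proof (HR s (conj Hs Hss0) t Ht0) as Hr.
  pose proof (orbit_bound t HO Ht0) as HXb. fold E0 in HXb.
  assert (r1 : energy beta (step_rem X Y s t) <= 1) by (eapply Rle_trans; [exact Hr|apply Rmin_l]).
  assert (r2 : energy beta (step_rem X Y s t) <= d * kap / 2) by (eapply Rle_trans; [exact Hr|apply Rmin_r]).
  set (za := zsum (fun k => Cmod (damp_h a (X t) k) ^ 2) K) in *.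
  set (zb := zsum (fun k => Cmod (damp_u (X t) (Y t) k) ^ 2) K) in *.
  assert (Za : 0 <= za) by (apply zsum_nonneg; intros; apply Cmod2_ge_0).
  assert (Zb : 0 <= zb) by (apply zsum_nonneg; intros; apply Cmod2_ge_0).
  assert (A1 : d * energy beta (X t) <= kap / 2).
  { apply Rle_trans with (d * (E0 + 1)); [apply Rmult_le_compat_l; lra|].
    right. unfold d. field. lra. }
  assert (A2 : / d * energy beta (step_rem X Y s t) <= kap / 2).
  { apply Rmult_le_reg_l with d; [exact Hd|]. rewrite <- Rmult_assoc, Rinv_r by lra. lra. }
  assert (A3 : s ^ 2 * (2 * E1 + 2 * energy beta (step_rem X Y s t)) <= s * (kap / 2)).
  { replace (s ^ 2 * (2 * E1 + 2 * energy beta (step_rem X Y s t))) with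
      (s * (s * (2 * E1 + 2 * energy beta (step_rem X Y s t)))) by ring.
    apply Rmult_le_compat_l; [lra|]. eapply Rle_trans; [|exact Hs2].
    apply Rmult_le_compat_l; lra. }
  assert (D : / Ma * za + / Mb * zb <= kap).
  { apply Rmult_le_reg_l with (2 * s); [lra|]. eapply Rle_trans; [exact H|].
    assert (s * (d * energy beta (X t) + / d * energy beta (step_rem X Y s t)) <= s * kap)
      by (apply Rmult_le_compat_l; lra).
    lra. }
  assert (P : forall m z z', 0 < m -> Rmin (/ Ma) (/ Mb) <= m -> 0 <= z -> 0 <= z' ->
     m * z + z' <= kap -> z <= eps).
  { intros m z z' Hm Hmin Hz Hz' HH. apply Rmult_le_reg_l with m; [exact Hm|].
    unfold kap in HH. nra. }
  split.
  - apply (P (/ Ma) za (/ Mb * zb)); auto; [apply Rmin_l|nra].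
  - apply (P (/ Mb) zb (/ Ma * za)); auto; [apply Rmin_r|nra|lra].
Qed.

(** * Fourier coefficients of a nonnegative function *)

Definition fcoef (f : smoothT) (d : Z) : C := cmean (fun x => Cmult (RtoC (f x)) (expi d x)).

Lemma mcoef_fcoef f k j : mcoef f k j = fcoef f (j - k).
Proof. apply mcoefE. Qed.

Lemma fcoef_0 f : fcoef f 0 = RtoC (mean f).
Proof.
  unfold fcoef, cmean, RtoC. f_equal.
  - apply mean_ext. intros x _. rewrite expi_0. simpl. ring.
  - transitivity (mean (fun _ => 0)); [|apply mean_const].
    apply mean_ext. intros x _. rewrite expi_0. simpl. ring.
Qed.

Lemma fcoef_conj f d : fcoef f (- d) = Cconj (fcoef f d).
Proof.
  unfold fcoef, cmean, Cconj; cbn [fst snd].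
  assert (C1 := ccont_mult _ _ (ccont_real f (cont_sfun f)) (ccont_expi d)).
  rewrite <- mean_opp by apply C1.
  f_equal; apply mean_ext; intros x _; rewrite <- expi_conj; simpl; ring.
Qed.

Lemma mean_periodic_pos (f : R -> R) x0 :
  (forall x, continuous f x) -> (forall x, f (x + 2 * PI) = f x) ->
  (forall x, 0 <= f x) -> 0 < f x0 -> 0 < mean f.
Proof.
  intros Hc Hp H0 Hx. rewrite <- (mean_shift f x0 Hc Hp).
  pose proof PI_RGT_0. apply mean_pos with 0; try lra; auto.
  - intros y _. apply (continuous_comp (fun y => x0 + y) f); [|apply Hc].
    apply (ex_derive_continuous (fun y => x0 + y)). auto_derive. exact I.
  - now rewrite Rplus_0_r.
Qed.

(** Equality in the triangle inequality would force [e^{idx}] to have a constant phase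
    on the open set where [f] is positive. *)
Lemma fcoef_lt (f : smoothT) x0 d : (forall x, 0 <= f x) -> 0 < f x0 -> d <> 0%Z ->
  Cmod (fcoef f d) < mean f.
Proof.
  intros H0 Hx0 Hd. set (g := fcoef f d). set (n := Cmod g).
  assert (HRI : 0 < mean f).
  { apply (mean_periodic_pos f x0); auto; [apply sfun_continuous|apply (sfunP f)]. }
  destruct (Rle_lt_or_eq_dec 0 n (Cmod_ge_0 g)) as [Hn|Hn]; [|lra].
  set (z := fun x => Cmult (expi d x) (Cconj g)).
  assert (Zn : forall x, fst (z x) ^ 2 + snd (z x) ^ 2 = n ^ 2).
  { intros x. rewrite <- Cmod2. unfold z. rewrite Cmod2_mult, expi_mod2.
    unfold n. rewrite !Cmod2. simpl. ring. }
  set (w := fun x => n - fst (z x)).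
  assert (Hw : forall x, 0 <= w x).
  { intros x. unfold w. pose proof (Zn x). pose proof (pow2_ge_0 (snd (z x))). nra. }
  assert (Hpos : 0 < mean (fun x => f x * w x)).
  { assert (Hpt : exists x1, 0 < f x1 * w x1).
    { destruct (Rle_lt_or_eq_dec 0 (w x0) (Hw x0)) as [Hw0|Hw0].
      - exists x0. nra.
      - (* z is the positive number n at x0; a small rotation moves it away *)
        assert (Hz1 : fst (z x0) = n) by (unfold w in Hw0; lra).
        assert (Hz2 : snd (z x0) = 0) by (pose proof (Zn x0); rewrite Hz1 in *; nra).
        assert (Hl : locally x0 (fun x => 0 < f x)).
        { apply (sfun_continuous f x0 (fun y => 0 < y)). now apply (open_gt 0). }
        destruct Hl as [[dl Pdl] Hl].
        pose proof (IZR_abs_ge1 d Hd) as Hd1. pose proof PI_RGT_0.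
        set (h := Rmin (dl / 2) (PI / (2 * Rabs (IZR d)))).
        assert (Hh : 0 < h).
        { apply Rmin_glb_lt; [lra|apply Rdiv_lt_0_compat; lra]. }
        assert (Hh1 : h <= dl / 2) by apply Rmin_l.
        assert (Hh2 : Rabs (IZR d) * h <= PI / 2).
        { apply Rle_trans with (Rabs (IZR d) * (PI / (2 * Rabs (IZR d)))).
          - apply Rmult_le_compat_l; [lra|apply Rmin_r].
          - right. field. lra. }
        exists (x0 + h). apply Rmult_lt_0_compat.
        + apply Hl. unfold ball; simpl; unfold AbsRing_ball, abs, minus, plus, opp; simpl.
          replace (x0 + h + - x0) with h by ring. rewrite Rabs_pos_eq; lra.
        + unfold w.
          replace (z (x0 + h)) with (Cmult (expi d h) (z x0)).
          2:{ unfold z. rewrite expi_shift. ring. }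
          change (0 < n - (cos (IZR d * h) * fst (z x0) - sin (IZR d * h) * snd (z x0))).
          rewrite Hz1, Hz2.
          assert (cos (IZR d * h) < 1).
          { replace (cos (IZR d * h)) with (cos (Rabs (IZR d) * h)).
            - rewrite <- cos_0. apply cos_decreasing_1; nra.
            - unfold Rabs; destruct Rcase_abs; [|reflexivity].
              rewrite <- cos_neg. f_equal. ring. }
          nra. }
    destruct Hpt as [x1 Hx1].
    apply (mean_periodic_pos _ x1); auto.
    - intros x. apply (continuous_mult f w); [apply sfun_continuous|].
      apply (ex_derive_continuous w). unfold w, z, expi; simpl. auto_derive. exact I.
    - intros x. rewrite (proj2 (sfunP f)). f_equal. unfold w, z, expi; cbn [fst snd Cmult].
      rewrite (proj2 (sfunP (s_cos d)) x : cos (IZR d * (x + 2 * PI)) = cos (IZR d * x)).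
      rewrite (proj2 (sfunP (s_sin d)) x : sin (IZR d * (x + 2 * PI)) = sin (IZR d * x)).
      reflexivity.
    - intros x. apply Rmult_le_pos; auto. }
  assert (Hval : mean (fun x => f x * w x) = n * mean f - n ^ 2).
  { assert (C1 := ccont_mult _ _ (ccont_real f (cont_sfun f)) (ccont_expi d)).
    transitivity (mean (fun x => n * f x) - fst (cmean (fun x => Cmult (Cconj g) (Cmult (RtoC (f x)) (expi d x))))).
    - unfold cmean; cbn [fst]. rewrite <- mean_minus.
      + apply mean_ext. intros x _. unfold w, z. simpl. ring.
      + apply cont_mult; [apply cont_const|apply cont_sfun].
      + apply (ccont_mult _ _ (ccont_const (Cconj g)) C1).
    - rewrite cmean_scal, mean_scal by (exact C1 || apply cont_sfun). fold (fcoef f d). fold g.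
      unfold n. rewrite Cmod2. simpl. ring. }
  rewrite Hval in Hpos. nra.
Qed.

(** * Modes of the undamped system *)

Definition omega (beta : R) (k : Z) : R := sqrt (omega_sq beta k).
Definition theta (beta : R) (k : Z) : R := omega beta k / IZR k.

(** For [sg = 1] or [-1], the coordinate of the undamped mode [k] along the eigenvector
    of eigenvalue [i sg omega(k)]. *)
Definition eta (beta sg : R) (X : state) (k : Z) : C :=
  Cminus (hhat X k) (Cmult (RtoC (sg * theta beta k)) (uhat X k)).

Lemma omega_0 beta : omega beta 0 = 0.
Proof. unfold omega. rewrite omega_sq_0. apply sqrt_0. Qed.

Lemma omega_nonneg beta k : 0 <= omega beta k.
Proof. apply sqrt_pos. Qed.

Lemma omega_pos beta k : 0 < beta -> k <> 0%Z -> 0 < omega beta k.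
Proof. intros. apply sqrt_lt_R0. now apply omega_sq_pos. Qed.

Lemma omega_inj beta j k : 0 < beta -> omega beta j = omega beta k -> Z.abs j = Z.abs k.
Proof.
  intros Hb H. apply (omega_sq_inj beta); auto. apply sqrt_inj; auto using omega_sq_nonneg.
Qed.

Lemma omega_abs beta j k : Z.abs j = Z.abs k -> omega beta j = omega beta k.
Proof.
  intros H. unfold omega. f_equal. rewrite !omega_sq_abs, <- !abs_IZR, H. reflexivity.
Qed.

Lemma theta_0 beta : theta beta 0 = 0.
Proof. unfold theta. rewrite omega_0. unfold Rdiv. ring. Qed.

Lemma theta_k beta k : theta beta k * IZR k = omega beta k.
Proof.
  destruct (Z.eq_dec k 0) as [->|Hk]; [rewrite theta_0, omega_0; ring|].
  apply IZR_ne0 in Hk. unfold theta. now field.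
Qed.

Lemma omega_theta beta k : 0 < beta -> omega beta k * theta beta k = m_sym beta k.
Proof.
  intros Hb. destruct (Z.eq_dec k 0) as [->|Hk].
  - rewrite theta_0, <- p_symE. ring.
  - apply IZR_ne0 in Hk. unfold theta.
    replace (omega beta k * (omega beta k / IZR k)) with (omega beta k * omega beta k / IZR k) by (now field).
    unfold omega. rewrite sqrt_sqrt by now apply omega_sq_nonneg. unfold omega_sq. now field.
Qed.

Lemma theta_ne0 beta k : 0 < beta -> k <> 0%Z -> theta beta k <> 0.
Proof.
  intros Hb Hk H. pose proof (theta_k beta k) as H1. pose proof (omega_pos beta k Hb Hk).
  rewrite H in H1. lra.
Qed.

Lemma hhat_eta beta X k :
  hhat X k = Cplus (Cmult (RtoC (/ 2)) (eta beta 1 X k)) (Cmult (RtoC (/ 2)) (eta beta (-1) X k)).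
Proof. unfold eta. generalize (hhat X k) (uhat X k) (theta beta k). intros h u th. cpair; field. Qed.

Lemma uhat_eta beta X k : 0 < beta -> k <> 0%Z ->
  uhat X k = Cmult (RtoC (/ (2 * theta beta k))) (Cminus (eta beta (-1) X k) (eta beta 1 X k)).
Proof.
  intros Hb Hk. pose proof (theta_ne0 beta k Hb Hk) as H. unfold eta.
  revert H. generalize (hhat X k) (uhat X k) (theta beta k). intros h u th H. cpair; field; auto.
Qed.

Lemma Cmod_le_sqrt (z : C) M : Cmod z ^ 2 <= M -> Cmod z <= sqrt M.
Proof.
  intros H. rewrite <- (sqrt_pow2 (Cmod z)) by apply Cmod_ge_0. now apply sqrt_le_1_alt.
Qed.

Lemma hhat_bound {beta a b X Y E1} t k : 0 < beta -> classical_orbit beta a b X Y E1 -> 0 <= t ->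
  Cmod (hhat (X t) k) <= sqrt (energy beta (X 0)).
Proof.
  intros Hb HO Ht. apply Cmod_le_sqrt.
  pose proof (hhat_sq_le beta (X t) k Hb).
  pose proof (energy_at_le_energy beta (X t) k Hb (orb_in HO t Ht)).
  pose proof (orbit_bound t HO Ht). lra.
Qed.

Lemma uhat_bound {beta a b X Y E1} t k : 0 < beta -> classical_orbit beta a b X Y E1 -> 0 <= t ->
  Cmod (uhat (X t) k) <= sqrt (energy beta (X 0) / p_sym beta k).
Proof.
  intros Hb HO Ht. apply Cmod_le_sqrt. pose proof (p_sym_pos beta k Hb).
  pose proof (uhat_sq_le beta (X t) k Hb).
  pose proof (energy_at_le_energy beta (X t) k Hb (orb_in HO t Ht)).
  pose proof (orbit_bound t HO Ht).
  apply Rmult_le_reg_l with (p_sym beta k); [lra|].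
  replace (p_sym beta k * (energy beta (X 0) / p_sym beta k)) with (energy beta (X 0)) by (field; lra).
  lra.
Qed.

Lemma step_rem_mode_small {beta a b X Y E1} k eps : 0 < beta -> classical_orbit beta a b X Y E1 ->
  0 < eps -> exists s0, 0 < s0 /\ forall s, 0 < s <= s0 -> forall t, 0 <= t ->
    Cmod (hhat (step_rem X Y s t) k) <= eps /\ Cmod (uhat (step_rem X Y s t) k) <= eps.
Proof.
  intros Hb HO He. pose proof (p_sym_pos beta k Hb) as Hp.
  set (rho := Rmin (eps ^ 2) (p_sym beta k * eps ^ 2)).
  assert (He2 : 0 < eps ^ 2) by now apply pow_lt.
  assert (Hrho : 0 < rho) by (apply Rmin_glb_lt; [lra|now apply Rmult_lt_0_compat]).
  destruct (orb_step_rem HO rho Hrho) as [s0 [Hs0 H]].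
  exists s0. split; [exact Hs0|]. intros s Hs t Ht. specialize (H s Hs t Ht).
  assert (HR := step_rem_in_H s t HO Ht (proj1 Hs)).
  pose proof (energy_at_le_energy beta _ k Hb HR). pose proof (hhat_sq_le beta (step_rem X Y s t) k Hb).
  pose proof (uhat_sq_le beta (step_rem X Y s t) k Hb).
  split; apply Cmod_le_of_sq; try lra.
  - assert (rho <= eps ^ 2) by apply Rmin_l. lra.
  - assert (rho <= p_sym beta k * eps ^ 2) by apply Rmin_r.
    apply Rmult_le_reg_l with (p_sym beta k); [exact Hp|]. lra.
Qed.

Lemma damping_modes_vanish {beta a b X Y E1} k : 0 < beta -> classical_orbit beta a b X Y E1 ->
  vanish (fun t => damp_h a (X t) k) /\ vanish (fun t => damp_u (X t) (Y t) k).
Proof.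
  intros Hb HO.
  split; intros eps He;
    destruct (damping_vanishes (eps ^ 2) Hb HO (pow_lt _ 2 He)) as [T [_ H]];
    exists T; intros t Ht; (apply Cmod_le_of_sq; [lra|]).
  - destruct (zsum_term (fun k => Cmod (damp_h a (X t) k) ^ 2) k (fun _ => Cmod2_ge_0 _)) as [K HK].
    exact (Rle_trans _ _ _ HK (proj1 (H t K Ht))).
  - destruct (zsum_term (fun k => Cmod (damp_u (X t) (Y t) k) ^ 2) k (fun _ => Cmod2_ge_0 _)) as [K HK].
    exact (Rle_trans _ _ _ HK (proj2 (H t K Ht))).
Qed.

Lemma uhat_der X Y k : uhat Y k = Cminus (Copp (Cmult (Cmult Ci (RtoC (IZR k))) (hhat X k))) (damp_u X Y k).
Proof. unfold damp_u. ring. Qed.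

Lemma eta_step {beta a b X Y E1} sg s t k : 0 < beta -> (sg = 1 \/ sg = -1) ->
  classical_orbit beta a b X Y E1 -> 0 <= t -> 0 < s ->
  Cminus (eta beta sg (X (t + s)) k) (Cmult (1, s * (sg * omega beta k)) (eta beta sg (X t) k)) =
  Cmult (RtoC s) (Cplus (Cminus (hhat (step_rem X Y s t) k) (damp_h a (X t) k))
     (Cmult (RtoC (sg * theta beta k)) (Cminus (damp_u (X t) (Y t) k) (uhat (step_rem X Y s t) k)))).
Proof.
  intros Hb Hsg HO Ht Hs.
  destruct (Ad_coef _ _ _ _ _ (orb_in HO t Ht) (orb_gen HO t Ht)) as [H1 _].
  unfold eta. rewrite (step_rem_h X Y), (step_rem_u X Y) by exact Hs.
  rewrite H1, (uhat_der (X t) (Y t)), <- (omega_theta beta k Hb), <- (theta_k beta k).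
  destruct Hsg; subst sg; cpair; ring.
Qed.

Lemma eta_freq {beta a b X Y E1} sg k : 0 < beta -> (sg = 1 \/ sg = -1) ->
  classical_orbit beta a b X Y E1 -> freq (sg * omega beta k) (fun t => eta beta sg (X t) k).
Proof.
  intros Hb Hsg HO. set (th := Rabs (sg * theta beta k)).
  assert (Hth : 0 <= th) by apply Rabs_pos.
  apply freq_of_ode with (sqrt (energy beta (X 0)) + th * sqrt (energy beta (X 0) / p_sym beta k)).
  - intros t Ht. unfold eta. eapply Rle_trans; [apply Cmod_triangle_minus|].
    rewrite Cmod_mult, Cmod_R. fold th.
    apply Rplus_le_compat; [now apply (hhat_bound _ _ Hb HO)|].
    apply Rmult_le_compat_l; [exact Hth|now apply (uhat_bound _ _ Hb HO)].
  - intros eps He. set (kap := eps / (2 * (1 + th))).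
    assert (Hk : 0 < kap) by (apply Rdiv_lt_0_compat; lra).
    destruct (step_rem_mode_small k kap Hb HO Hk) as [s0 [Hs0 HR]].
    exists s0. split; [exact Hs0|]. intros s Hs.
    destruct (proj1 (damping_modes_vanish k Hb HO) kap Hk) as [T1 H1].
    destruct (proj2 (damping_modes_vanish k Hb HO) kap Hk) as [T2 H2].
    exists (Rmax 0 (Rmax T1 T2)). intros t Ht.
    assert (Ht0 : 0 <= t) by exact (Rmax_le_l _ _ _ Ht).
    assert (Ht12 : Rmax T1 T2 <= t) by exact (Rmax_le_r _ _ _ Ht).
    specialize (H1 t (Rmax_le_l _ _ _ Ht12)).
    specialize (H2 t (Rmax_le_r _ _ _ Ht12)).
    destruct (HR s Hs t Ht0) as [R1 R2].
    rewrite (eta_step sg s t k Hb Hsg HO Ht0 (proj1 Hs)).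
    rewrite Cmod_mult, Cmod_R, Rabs_pos_eq by lra.
    apply Rmult_le_compat_l; [lra|].
    apply Rle_trans with (2 * kap + th * (2 * kap)); [|right; unfold kap; field; lra].
    eapply Rle_trans; [apply Cmod_triangle|]. apply Rplus_le_compat.
    + eapply Rle_trans; [apply Cmod_triangle_minus|]. lra.
    + rewrite Cmod_mult, Cmod_R. fold th. apply Rmult_le_compat_l; [exact Hth|].
      eapply Rle_trans; [apply Cmod_triangle_minus|]. lra.
Qed.

Lemma uhat0_freq {beta a b X Y E1} : 0 < beta ->
  classical_orbit beta a b X Y E1 -> freq 0 (fun t => uhat (X t) 0).
Proof.
  intros Hb HO.
  apply freq_of_ode with (sqrt (energy beta (X 0) / p_sym beta 0)).
  - intros t Ht. now apply (uhat_bound _ _ Hb HO).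
  - intros eps He.
    destruct (step_rem_mode_small 0 (eps / 2) Hb HO ltac:(lra)) as [s0 [Hs0 HR]].
    exists s0. split; [exact Hs0|]. intros s Hs.
    destruct (proj2 (damping_modes_vanish 0 Hb HO) (eps / 2) ltac:(lra)) as [T2 H2].
    exists (Rmax 0 T2). intros t Ht.
    assert (Ht0 : 0 <= t) by exact (Rmax_le_l _ _ _ Ht).
    specialize (H2 t (Rmax_le_r _ _ _ Ht)).
    destruct (HR s Hs t Ht0) as [_ R2].
    rewrite (step_rem_u X Y) by lra. rewrite (uhat_der (X t) (Y t)).
    match goal with |- Cmod ?z <= _ => replace z with
      (Cmult (RtoC s) (Cminus (uhat (step_rem X Y s t) 0) (damp_u (X t) (Y t) 0))) by (cpair; ring) end.
    rewrite Cmod_mult, Cmod_R, Rabs_pos_eq by lra.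
    apply Rmult_le_compat_l; [lra|].
    eapply Rle_trans; [apply Cmod_triangle_minus|]. lra.
Qed.

(** * Decay of every mode *)

Lemma csum_pair (f : Z -> C) l : (1 <= l)%Z -> (forall j, Z.abs j <> l -> f j = RtoC 0) ->
  csum f (S (Z.to_nat l)) = Cplus (f l) (f (- l)%Z).
Proof.
  intros Hl H. set (N := S (Z.to_nat l)).
  transitivity (Cplus (csum (fun j => if Z.eq_dec j l then f j else RtoC 0) N)
     (csum (fun j => if Z.eq_dec j (- l) then f j else RtoC 0) N)).
  - rewrite <- csum_plus. apply csum_ext. intros j _.
    destruct (Z.eq_dec j l), (Z.eq_dec j (- l)); try lia; try ring.
    rewrite H by lia. ring.
  - rewrite (csum_single _ l), (csum_single _ (- l)%Z).
    + rewrite !trunc_in by (unfold inwin, N; lia).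
      destruct (Z.eq_dec l l), (Z.eq_dec (- l) (- l)); try lia. reflexivity.
    + intros k Hk. destruct Z.eq_dec; [contradiction|reflexivity].
    + intros k Hk. destruct Z.eq_dec; [contradiction|reflexivity].
Qed.

Lemma mcoef_summable f k : exists C0, forall N, zsum (fun j => Cmod (mcoef f k j)) N <= C0.
Proof.
  destruct (tcoef_decay (t_mult f (t_expN k))) as [C [HC H]].
  apply (decay_bounded _ C HC); [intros; apply Cmod_ge_0|exact H].
Qed.

(** Coefficient [k] of [a^2 h -> 0], seen at the frequency [sg omega(l)].  By strict
    monotonicity of the dispersion relation only the modes [l] and [-l] oscillate at it,
    through one of their two eigencoordinates. *)
Lemma pair_relation {beta a b X Y E1} sg l k : 0 < beta -> (sg = 1 \/ sg = -1) ->
  classical_orbit beta a b X Y E1 -> (1 <= l)%Z ->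
  vanish (fun t => Cplus (Cmult (mcoef (s_mult a a) k l) (eta beta sg (X t) l))
                         (Cmult (mcoef (s_mult a a) k (- l)) (eta beta sg (X t) (- l)%Z))).
Proof.
  intros Hb Hsg HO Hl.
  assert (Homl : 0 < omega beta l) by (apply omega_pos; auto; lia).
  assert (Hsg' : - sg = 1 \/ - sg = -1) by lra.
  set (half := RtoC (/ 2)).
  set (e := fun j t => if Z.eq_dec (Z.abs j) l then Cmult half (eta beta sg (X t) j) else RtoC 0).
  set (r1 := fun j t => if Z.eq_dec (Z.abs j) l then RtoC 0 else Cmult half (eta beta 1 (X t) j)).
  set (r2 := fun j t => if Z.eq_dec (Z.abs j) l then Cmult half (eta beta (- sg) (X t) j)
                        else Cmult half (eta beta (-1) (X t) j)).
  set (nu1 := fun j => if Z.eq_dec (Z.abs j) l then 0 else omega beta j).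
  set (nu2 := fun j => if Z.eq_dec (Z.abs j) l then - sg * omega beta j else - omega beta j).
  assert (Hne : forall j, Z.abs j <> l -> omega beta j <> omega beta l).
  { intros j Hj H. apply omega_inj in H; auto. lia. }
  assert (Hfr : forall s j, s = 1 \/ s = -1 -> freq (s * omega beta j) (fun t => Cmult half (eta beta s (X t) j))).
  { intros s j Hs. apply freq_scal. exact (eta_freq s j Hb Hs HO). }
  assert (Hsum : forall j t, Cplus (e j t) (Cplus (r1 j t) (r2 j t)) = hhat (X t) j).
  { intros j t. unfold e, r1, r2. rewrite (hhat_eta beta). fold half.
    destruct Z.eq_dec; [|ring]. assert (Hs : sg = 1 /\ - sg = -1 \/ sg = -1 /\ - sg = 1) by lra.
    destruct Hs as [[-> ->]|[-> ->]]; ring. }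
  destruct (mcoef_summable (s_mult a a) k) as [C0 HC0].
  assert (V : vanish (fun t => csum (fun j => Cmult (mcoef (s_mult a a) k j) (e j t)) (S (Z.to_nat l)))).
  { apply (frequency_separation (sg * omega beta l) nu1 nu2 e r1 r2 (mcoef (s_mult a a) k)
      (fun t => damp_h a (X t) k) (sqrt (energy beta (X 0))) C0); auto.
    - intros j. unfold nu1. destruct Z.eq_dec as [Hj|Hj]; [destruct Hsg; subst; lra|].
      pose proof (Hne j Hj). pose proof (omega_nonneg beta j). destruct Hsg; subst; lra.
    - intros j. unfold nu2. destruct Z.eq_dec as [Hj|Hj].
      + rewrite (omega_abs beta j l) by lia. destruct Hsg; subst; lra.
      + pose proof (Hne j Hj). pose proof (omega_nonneg beta j). destruct Hsg; subst; lra.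
    - intros j. unfold e. destruct Z.eq_dec as [Hj|Hj]; [|apply freq_zero].
      rewrite (omega_abs beta l j) by lia. now apply Hfr.
    - intros j. unfold nu1, r1. destruct Z.eq_dec as [Hj|Hj]; [apply freq_zero|].
      rewrite <- (Rmult_1_l (omega beta j)). apply Hfr. now left.
    - intros j. unfold nu2, r2. destruct Z.eq_dec as [Hj|Hj]; [now apply Hfr|].
      replace (- omega beta j) with (-1 * omega beta j) by ring. apply Hfr. now right.
    - intros j t Ht. rewrite Hsum. now apply (hhat_bound _ _ Hb HO).
    - intros t Ht.
      destruct (orb_in HO t Ht) as [[HD _] _].
      replace (fun N => csum (fun j => Cmult (mcoef (s_mult a a) k j) (Cplus (e j t) (Cplus (r1 j t) (r2 j t)))) N)
        with (fun N => csum (fun j => Cmult (mcoef (s_mult a a) k j) (fourier (fst (X t)) j)) N).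
      + now apply mult_coef_lim.
      + apply functional_extensionality; intros N. apply csum_ext. intros j _. now rewrite Hsum.
    - exact (proj1 (damping_modes_vanish _ Hb HO)).
    - intros j Hj t. unfold e. destruct Z.eq_dec; [|reflexivity].
      exfalso. apply Hj. unfold inwin. lia. }
  apply (vanish_scal (RtoC 2)) in V. revert V. apply vanish_ext. intros t.
  rewrite csum_pair; [|exact Hl|].
  - unfold e. destruct Z.eq_dec; [|lia]. destruct Z.eq_dec; [|lia].
    assert (H2 : Cmult (RtoC 2) half = RtoC 1) by (unfold half; cpair; field).
    match goal with |- _ = ?z => transitivity (Cmult (Cmult (RtoC 2) half) z) end;
      [ring|rewrite H2; ring].
  - intros j Hj. unfold e. destruct Z.eq_dec; [contradiction|]. ring.
Qed.

(** The relations for [k = l] and [k = -l] form a 2 by 2 system with determinant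
    [alpha_0^2 - |alpha_(2l)|^2], where [alpha] are the coefficients of [a^2]; it is
    positive by [fcoef_lt]. *)
Lemma eta_vanish {beta a b X Y E1} sg j x0 : 0 < beta -> (sg = 1 \/ sg = -1) ->
  classical_orbit beta a b X Y E1 -> a x0 <> 0 -> j <> 0%Z ->
  vanish (fun t => eta beta sg (X t) j).
Proof.
  intros Hb Hsg HO Hx0 Hj.
  set (f := s_mult a a).
  assert (Hf0 : forall x, 0 <= f x) by (intros; simpl; nra).
  assert (Hfx : 0 < f x0) by (simpl; nra).
  set (l := Z.abs j). assert (Hl : (1 <= l)%Z) by lia.
  set (al := mean f). set (g := fcoef f (2 * l)).
  assert (Hg : Cmod g < al) by (apply (fcoef_lt f x0); auto; lia).
  set (det := al ^ 2 - Cmod g ^ 2).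
  assert (Hdet : 0 < det).
  { unfold det. pose proof (Cmod_ge_0 g). nra. }
  pose proof (pair_relation sg l l Hb Hsg HO Hl) as V1.
  pose proof (pair_relation sg l (- l) Hb Hsg HO Hl) as V2.
  fold f in V1, V2.
  rewrite !mcoef_fcoef in V1. rewrite !mcoef_fcoef in V2.
  replace (l - l)%Z with 0%Z in V1 by lia. replace (- l - l)%Z with (- (2 * l))%Z in V1 by lia.
  replace (l - - l)%Z with (2 * l)%Z in V2 by lia. replace (- l - - l)%Z with 0%Z in V2 by lia.
  rewrite fcoef_0, fcoef_conj in V1. rewrite fcoef_0 in V2. fold g in V1, V2. fold al in V1, V2.
  assert (Hgg : Cmult g (Cconj g) = RtoC (Cmod g ^ 2)) by apply Cmult_conj_self.
  assert (Hd1 : Cmult (RtoC (/ det)) (Cminus (Cmult (RtoC al) (RtoC al)) (Cmult g (Cconj g))) = RtoC 1).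
  { rewrite Hgg, <- RtoC_mult, <- RtoC_minus, <- RtoC_mult. f_equal.
    unfold det. field. fold det. lra. }
  destruct (Z.eq_dec j l) as [Hjl|Hjl].
  - rewrite Hjl. apply vanish_ext with (fun t => Cmult (RtoC (/ det)) (Cminus
      (Cmult (RtoC al) (Cplus (Cmult (RtoC al) (eta beta sg (X t) l)) (Cmult (Cconj g) (eta beta sg (X t) (- l)%Z))))
      (Cmult (Cconj g) (Cplus (Cmult g (eta beta sg (X t) l)) (Cmult (RtoC al) (eta beta sg (X t) (- l)%Z)))))).
    + intros t. rewrite <- (Cmult_1_l (eta beta sg (X t) l)) at 3. rewrite <- Hd1. ring.
    + apply vanish_scal, vanish_minus; now apply vanish_scal.
  - replace j with (- l)%Z by lia.
    apply vanish_ext with (fun t => Cmult (RtoC (/ det)) (Cminus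
      (Cmult (RtoC al) (Cplus (Cmult g (eta beta sg (X t) l)) (Cmult (RtoC al) (eta beta sg (X t) (- l)%Z))))
      (Cmult g (Cplus (Cmult (RtoC al) (eta beta sg (X t) l)) (Cmult (Cconj g) (eta beta sg (X t) (- l)%Z)))))).
    + intros t. rewrite <- (Cmult_1_l (eta beta sg (X t) (- l)%Z)) at 3. rewrite <- Hd1. ring.
    + apply vanish_scal, vanish_minus; now apply vanish_scal.
Qed.

(** Frequency separation at frequency 0: the other modes, which decay, may be given
    any other frequency. *)
Lemma zero_mode (f : smoothT) x0 (g : Z -> R -> C) (F : R -> C) B :
  (forall x, 0 <= f x) -> 0 < f x0 ->
  freq 0 (g 0%Z) -> (forall j, j <> 0%Z -> vanish (g j)) ->
  (forall j t, 0 <= t -> Cmod (g j t) <= B) ->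
  (forall t, 0 <= t -> clim (fun N => csum (fun j => Cmult (mcoef f 0 j) (g j t)) N) (F t)) ->
  vanish F -> vanish (g 0%Z).
Proof.
  intros Hf Hx H0 Hj HB HF HFv.
  set (e := fun j t => if Z.eq_dec j 0 then g 0%Z t else RtoC 0).
  set (r := fun j t => if Z.eq_dec j 0 then RtoC 0 else g j t).
  assert (Hsum : forall j t, Cplus (e j t) (Cplus (r j t) (RtoC 0)) = g j t).
  { intros j t. unfold e, r. destruct Z.eq_dec as [->|]; ring. }
  destruct (mcoef_summable f 0) as [C0 HC0].
  assert (V : vanish (fun t => csum (fun j => Cmult (mcoef f 0 j) (e j t)) 1)).
  { apply (frequency_separation 0 (fun _ => 1) (fun _ => 1) e r (fun _ _ => RtoC 0)
      (mcoef f 0) F B C0); auto.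
    - intros j. unfold e. destruct Z.eq_dec; [exact H0|apply freq_zero].
    - intros j. unfold r. destruct Z.eq_dec; [apply freq_zero|]. apply freq_of_vanish; auto.
    - intros j. apply freq_zero.
    - intros j t Ht. rewrite Hsum. now apply HB.
    - intros t Ht.
      replace (fun N => csum (fun j => Cmult (mcoef f 0 j) (Cplus (e j t) (Cplus (r j t) (RtoC 0)))) N)
        with (fun N => csum (fun j => Cmult (mcoef f 0 j) (g j t)) N); [now apply HF|].
      apply functional_extensionality; intros N. apply csum_ext. intros j _. now rewrite Hsum.
    - intros j Hj0 t. unfold e. destruct Z.eq_dec as [->|]; [|reflexivity].
      exfalso. apply Hj0. unfold inwin. lia. }
  assert (HRI : 0 < mean f).
  { apply (mean_periodic_pos f x0); auto; [apply sfun_continuous|apply (sfunP f)]. }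
  apply (vanish_scal (RtoC (/ mean f))) in V. revert V. apply vanish_ext. intros t.
  rewrite (csum_single _ 0%Z).
  - rewrite trunc_in by (unfold inwin; lia). unfold e. destruct Z.eq_dec; [|lia].
    rewrite mcoef_fcoef, Z.sub_diag, fcoef_0, Cmult_assoc, <- RtoC_mult, Rinv_l by lra.
    ring.
  - intros j Hj0. unfold e. destruct Z.eq_dec; [contradiction|ring].
Qed.

Lemma hhat_vanish {beta a b X Y E1} j x0 : 0 < beta ->
  classical_orbit beta a b X Y E1 -> a x0 <> 0 -> vanish (fun t => hhat (X t) j).
Proof.
  intros Hb HO Hx0.
  assert (Hnz : forall j, j <> 0%Z -> vanish (fun t => hhat (X t) j)).
  { clear j. intros j Hj. apply vanish_ext with (fun t =>
      Cplus (Cmult (RtoC (/ 2)) (eta beta 1 (X t) j)) (Cmult (RtoC (/ 2)) (eta beta (-1) (X t) j))).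
    - intros t. symmetry. apply hhat_eta.
    - apply vanish_plus; apply vanish_scal;
        refine (eta_vanish _ j x0 Hb _ HO Hx0 Hj); auto. }
  destruct (Z.eq_dec j 0) as [->|Hj]; [|now apply Hnz].
  apply (zero_mode (s_mult a a) x0 (fun j t => hhat (X t) j) (fun t => damp_h a (X t) 0)
    (sqrt (energy beta (X 0)))); auto.
  - intros; simpl; nra.
  - simpl; nra.
  - pose proof (eta_freq 1 0 Hb (or_introl eq_refl) HO) as H.
    rewrite omega_0, Rmult_0_r in H.
    replace (fun t => hhat (X t) 0) with (fun t => eta beta 1 (X t) 0); [exact H|].
    apply functional_extensionality; intros t. unfold eta. rewrite theta_0, Rmult_0_r. ring.
  - intros k t Ht. now apply (hhat_bound _ _ Hb HO).
  - intros t Ht. destruct (orb_in HO t Ht) as [[HD _] _].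
    now apply mult_coef_lim.
  - exact (proj1 (damping_modes_vanish _ Hb HO)).
Qed.

(** Only the mean of [u] escapes the damping by [a]; the second damping controls it. *)
Lemma uhat_vanish {beta a b X Y E1} j x0 x1 : 0 < beta ->
  classical_orbit beta a b X Y E1 -> a x0 <> 0 -> b x1 <> 0 -> vanish (fun t => uhat (X t) j).
Proof.
  intros Hb HO Hx0 Hx1.
  assert (Hnz : forall j, j <> 0%Z -> vanish (fun t => uhat (X t) j)).
  { clear j. intros j Hj. apply vanish_ext with (fun t =>
      Cmult (RtoC (/ (2 * theta beta j))) (Cminus (eta beta (-1) (X t) j) (eta beta 1 (X t) j))).
    - intros t. symmetry. now apply uhat_eta.
    - apply vanish_scal, vanish_minus;
        refine (eta_vanish _ j x0 Hb _ HO Hx0 Hj); auto. }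
  destruct (Z.eq_dec j 0) as [->|Hj]; [|now apply Hnz].
  assert (Hp0 : p_sym beta 0 = 1) by (unfold p_sym; destruct Z.eq_dec; [reflexivity|lia]).
  assert (Hib : 0 < / beta) by now apply Rinv_0_lt_compat.
  assert (V : vanish (fun t => Cmult (RtoC (p_sym beta 0)) (uhat (X t) 0))).
  { apply (zero_mode (s_mult b b) x1 (fun j t => Cmult (RtoC (p_sym beta j)) (uhat (X t) j))
      (fun t => damp_u (X t) (Y t) 0) (sqrt ((1 + / beta) * energy beta (X 0)))); auto.
    - intros; simpl; nra.
    - simpl; nra.
    - apply freq_scal. exact (uhat0_freq Hb HO).
    - intros k Hk. apply vanish_scal. now apply Hnz.
    - intros k t Ht. apply Cmod_le_sqrt. assert (HX := orb_in HO t Ht).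
      rewrite Cmod2_mult, Cmod_R, Rabs_pos_eq by (left; now apply p_sym_pos).
      pose proof (uhat_sq_le beta (X t) k Hb). pose proof (energy_at_le_energy beta (X t) k Hb HX).
      pose proof (orbit_bound t HO Ht). pose proof (p_sym_le beta k Hb).
      pose proof (p_sym_pos beta k Hb).
      replace (p_sym beta k ^ 2 * Cmod (uhat (X t) k) ^ 2)
        with (p_sym beta k * (p_sym beta k * Cmod (uhat (X t) k) ^ 2)) by ring.
      pose proof (Cmod2_ge_0 (uhat (X t) k)).
      apply Rmult_le_compat; nra.
    - intros t Ht. assert (HX := orb_in HO t Ht).
      destruct (Ad_coef _ _ _ _ _ HX (orb_gen HO t Ht)) as [_ [Pu [DP [HP HB]]]].
      rewrite <- HB.
      replace (fun N => csum (fun j => Cmult (mcoef (s_mult b b) 0 j) (Cmult (RtoC (p_sym beta j)) (uhat (X t) j))) N)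
        with (fun N => csum (fun j => Cmult (mcoef (s_mult b b) 0 j) (fourier Pu j)) N).
      + now apply mult_coef_lim.
      + apply functional_extensionality; intros N. apply csum_ext. intros k _. now rewrite HP.
    - exact (proj2 (damping_modes_vanish _ Hb HO)). }
  revert V. apply vanish_ext. intros t. rewrite Hp0. ring.
Qed.

(** * Smoothing and conclusion *)

(** Solving the two lines of the generator for [u] and [h] gains a factor
    [1 / omega(k)^2], of order [1 / |k|]: the resolvent is compact, and the tails of an
    orbit with bounded derivative are uniformly small. *)
Lemma smoothing_bound beta a b X Y k : 0 < beta -> in_H X -> Ad beta a b X Y -> k <> 0%Z ->
  energy_at beta X k <= 2 / omega_sq beta k *
    (energy_at beta Y k + Cmod (damp_h a X k) ^ 2 + / beta * Cmod (damp_u X Y k) ^ 2).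
Proof.
  intros Hb HX HA Hk. destruct (Ad_coef _ _ _ _ _ HX HA) as [H1 _].
  pose proof (uhat_der X Y k) as H2.
  pose proof (omega_sq_pos beta k Hb Hk) as Hw. pose proof (p_sym_pos beta k Hb) as Hp.
  pose proof (omega_sq_p beta k) as Hwp. pose proof (omega_sq_le beta k Hb) as Hwl.
  assert (Hib : 0 < / beta) by now apply Rinv_0_lt_compat.
  assert (Hh : IZR k ^ 2 * Cmod (hhat X k) ^ 2 <= 2 * Cmod (uhat Y k) ^ 2 + 2 * Cmod (damp_u X Y k) ^ 2).
  { eapply Rle_trans; [|apply Cmod2_plus]. right.
    replace (Cplus (uhat Y k) (damp_u X Y k)) with (Cmult (Copp (Cmult Ci (RtoC (IZR k)))) (hhat X k))
      by (rewrite H2; ring).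
    rewrite Cmod2_mult. f_equal. rewrite Cmod2. simpl. ring. }
  assert (Hu : m_sym beta k ^ 2 * Cmod (uhat X k) ^ 2 <= 2 * Cmod (hhat Y k) ^ 2 + 2 * Cmod (damp_h a X k) ^ 2).
  { eapply Rle_trans; [|apply Cmod2_plus]. right.
    replace (Cplus (hhat Y k) (damp_h a X k)) with (Cmult (Copp (Cmult Ci (RtoC (m_sym beta k)))) (uhat X k))
      by (rewrite H1; ring).
    rewrite Cmod2_mult. f_equal. rewrite Cmod2. simpl. ring. }
  apply Rmult_le_reg_l with (omega_sq beta k); [exact Hw|].
  match goal with |- _ <= omega_sq beta k * (2 / omega_sq beta k * ?z) =>
    replace (omega_sq beta k * (2 / omega_sq beta k * z)) with (2 * z) by (field; lra) end.
  unfold energy_at.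
  assert (Ht1 : omega_sq beta k * Cmod (hhat X k) ^ 2 <=
     2 * (p_sym beta k * Cmod (uhat Y k) ^ 2) + 2 * (/ beta * Cmod (damp_u X Y k) ^ 2)).
  { apply Rle_trans with (p_sym beta k * (2 * Cmod (uhat Y k) ^ 2 + 2 * Cmod (damp_u X Y k) ^ 2)).
    - rewrite Hwp. rewrite (Rmult_comm (IZR k ^ 2)), Rmult_assoc.
      apply Rmult_le_compat_l; lra.
    - assert (p_sym beta k <= / beta).
      { rewrite Hwp in Hwl. unfold Rdiv in Hwl.
        pose proof (pow2_gt_0 _ (IZR_ne0 k Hk)).
        apply Rmult_le_reg_l with (IZR k ^ 2); lra. }
      pose proof (Cmod2_ge_0 (damp_u X Y k)). nra. }
  assert (Ht2 : omega_sq beta k * (p_sym beta k * Cmod (uhat X k) ^ 2) = m_sym beta k ^ 2 * Cmod (uhat X k) ^ 2).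
  { rewrite Hwp, <- p_symE. ring. }
  nra.
Qed.

Lemma zsum_tail_le (f g : Z -> R) c N L : 0 <= c -> (forall k, 0 <= g k) ->
  (forall k, ~ inwin N k -> f k <= c * g k) -> (N <= L)%nat ->
  zsum f L <= zsum f N + c * zsum g L.
Proof.
  intros Hc Hg H HL. rewrite <- (zsum_trunc f N L HL), <- zsum_scal, <- zsum_plus.
  apply zsum_le. intros k. destruct (inwin_dec N k) as [Hk|Hk].
  - rewrite trunc_in by exact Hk. pose proof (Hg k). nra.
  - rewrite trunc_out by exact Hk. specialize (H k Hk). lra.
Qed.

Lemma window_decay beta (X : R -> state) N eps : 0 < beta ->
  (forall k, vanish (fun t => hhat (X t) k)) -> (forall k, vanish (fun t => uhat (X t) k)) ->
  0 < eps -> exists T, forall t, T <= t -> zsum (energy_at beta (X t)) N <= eps.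
Proof.
  intros Hb Hh Hu He.
  assert (G : forall k e, 0 < e -> exists T, forall t, T <= t -> energy_at beta (X t) k <= e).
  { intros k e He'. pose proof (p_sym_pos beta k Hb) as Hp.
    set (d := sqrt (e / (1 + p_sym beta k))).
    assert (Hd : 0 < d) by (apply sqrt_lt_R0, Rdiv_lt_0_compat; lra).
    assert (Hd2 : d ^ 2 = e / (1 + p_sym beta k)).
    { unfold d. apply pow2_sqrt. left. apply Rdiv_lt_0_compat; lra. }
    destruct (Hh k d Hd) as [T1 H1]. destruct (Hu k d Hd) as [T2 H2].
    exists (Rmax T1 T2). intros t Ht.
    specialize (H1 t (Rmax_le_l _ _ _ Ht)).
    specialize (H2 t (Rmax_le_r _ _ _ Ht)).
    assert (Cmod (hhat (X t) k) ^ 2 <= d ^ 2) by (apply pow_incr; split; [apply Cmod_ge_0|exact H1]).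
    assert (Cmod (uhat (X t) k) ^ 2 <= d ^ 2) by (apply pow_incr; split; [apply Cmod_ge_0|exact H2]).
    unfold energy_at. apply Rle_trans with ((1 + p_sym beta k) * d ^ 2); [nra|].
    rewrite Hd2. right. field. lra. }
  revert eps He. induction N as [|N IH]; intros eps He; cbn [zsum].
  - exists 0. intros; lra.
  - destruct (IH (eps / 3) ltac:(lra)) as [T1 H1].
    destruct (G (Z.of_nat N) (eps / 3) ltac:(lra)) as [T2 H2].
    destruct (G (- Z.of_nat (S N))%Z (eps / 3) ltac:(lra)) as [T3 H3].
    exists (Rmax T1 (Rmax T2 T3)). intros t Ht.
    assert (Ht' : Rmax T2 T3 <= t) by exact (Rmax_le_r _ _ _ Ht).
    specialize (H1 t (Rmax_le_l _ _ _ Ht)).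
    specialize (H2 t (Rle_trans _ _ _ (Rmax_l _ _) Ht')).
    specialize (H3 t (Rle_trans _ _ _ (Rmax_r _ _) Ht')). lra.
Qed.

Lemma orbit_decay {beta a b X Y E1} x0 x1 eps : 0 < beta ->
  classical_orbit beta a b X Y E1 -> a x0 <> 0 -> b x1 <> 0 -> 0 < eps ->
  exists T, forall t, T <= t -> energy beta (X t) <= eps.
Proof.
  intros Hb HO Hx0 Hx1 He.
  assert (Hib : 0 < / beta) by now apply Rinv_0_lt_compat.
  assert (HE1 : 0 <= E1).
  { eapply Rle_trans; [apply energy_nonneg|apply (orb_der HO 0 (Rle_refl _))]. }
  set (c := tanh beta / beta).
  assert (Hc : 0 < c) by (apply Rdiv_lt_0_compat; auto using tanh_pos).
  set (G0 := E1 + 1 + / beta).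
  destruct (eps_over_INR (2 / c * G0) (eps / 2) ltac:(lra)) as [N [HN1 HN]].
  specialize (HN N (le_n _)).
  destruct (window_decay beta X N (eps / 2) Hb) as [T1 H1]; [| |lra|].
  { intros k. exact (hhat_vanish k x0 Hb HO Hx0). }
  { intros k. exact (uhat_vanish k x0 x1 Hb HO Hx0 Hx1). }
  destruct (damping_vanishes 1 Hb HO Rlt_0_1) as [T2 [HT2 H2]].
  exists (Rmax T1 T2). intros t Ht.
  specialize (H1 t (Rmax_le_l _ _ _ Ht)).
  assert (Ht2 : T2 <= t) by exact (Rmax_le_r _ _ _ Ht).
  assert (Ht0 : 0 <= t) by lra.
  assert (HX := orb_in HO t Ht0). assert (HA := orb_gen HO t Ht0).
  apply (energy_sup beta (X t) Hb HX). intros L.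
  apply Rle_trans with (zsum (energy_at beta (X t)) (N + L)).
  { apply zsum_mono; [intros; now apply energy_at_nonneg|lia]. }
  assert (HNp : 0 < INR N) by (apply lt_0_INR; lia).
  set (g := fun k => energy_at beta (Y t) k + Cmod (damp_h a (X t) k) ^ 2 + / beta * Cmod (damp_u (X t) (Y t) k) ^ 2).
  assert (Hg : forall k, 0 <= g k).
  { intros k. unfold g. pose proof (energy_at_nonneg beta (Y t) k Hb).
    pose proof (Cmod2_ge_0 (damp_h a (X t) k)). pose proof (Cmod2_ge_0 (damp_u (X t) (Y t) k)). nra. }
  assert (Hcn : 0 <= 2 / (c * INR N)) by (left; apply Rdiv_lt_0_compat; nra).
  pose proof (zsum_tail_le (energy_at beta (X t)) g (2 / (c * INR N)) N (N + L) Hcn Hg) as HT.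
  assert (HT' : zsum (energy_at beta (X t)) (N + L) <=
     zsum (energy_at beta (X t)) N + 2 / (c * INR N) * zsum g (N + L)).
  { apply HT; [|lia]. intros k Hk.
    assert (Hk0 : k <> 0%Z) by (intros ->; apply Hk; unfold inwin; lia).
    eapply Rle_trans; [now apply (smoothing_bound beta a b (X t) (Y t))|]. fold (g k).
    apply Rmult_le_compat_r; [apply Hg|]. apply Rmult_le_compat_l; [lra|].
    apply Rinv_le_contravar; [nra|].
    eapply Rle_trans; [|now apply omega_sq_ge]. fold c.
    apply Rmult_le_compat_l; [lra|now apply tail_outside]. }
  assert (HG : zsum g (N + L) <= G0).
  { unfold g. rewrite !zsum_plus, zsum_scal.
    destruct (H2 t (N + L)%nat Ht2) as [D1 D2].
    pose proof (proj1 (energy_sup beta _ Hb (orb_in' HO t Ht0)) (N + L)%nat).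
    pose proof (orb_der HO t Ht0). unfold G0. nra. }
  assert (HG' : 2 / (c * INR N) * zsum g (N + L) <= 2 / c * G0 / INR N).
  { apply Rle_trans with (2 / (c * INR N) * G0); [now apply Rmult_le_compat_l|].
    right. field. lra. }
  lra.
Qed.

(** * From the semigroup to its orbits *)

Lemma semigroup_minus beta Sd t Z W : is_C0_contraction_semigroup beta Sd ->
  0 <= t -> in_H Z -> in_H W -> Sd t (st_minus Z W) = st_minus (Sd t Z) (Sd t W).
Proof.
  intros [_ [Hp [Hs _]]] Ht HZ HW.
  rewrite !st_minus_eq, Hp, Hs; auto using in_H_scal.
Qed.

Lemma step_rem_semigroup beta Sd s t Z W : is_C0_contraction_semigroup beta Sd ->
  0 <= t -> 0 < s -> in_H Z -> in_H W ->
  step_rem (fun t => Sd t Z) (fun t => Sd t W) s t =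
  Sd t (st_minus (st_scal (RtoC (/ s)) (st_minus (Sd s Z) Z)) W).
Proof.
  intros HS Ht Hs HZ HW. pose proof HS as [Hin [_ [Hsc [_ [Hsg _]]]]].
  assert (HsZ : in_H (Sd s Z)) by (apply Hin; [lra|exact HZ]).
  rewrite (semigroup_minus beta), Hsc, (semigroup_minus beta), <- Hsg;
    auto using in_H_scal, in_H_minus. lra.
Qed.

Lemma semigroup_orbit beta a b Sd Z W : 0 < beta ->
  is_C0_contraction_semigroup beta Sd -> is_generator beta Sd (Ad beta a b) ->
  in_H Z -> in_H W -> Ad beta a b Z W ->
  classical_orbit beta a b (fun t => Sd t Z) (fun t => Sd t W) (energy beta W).
Proof.
  intros Hb HS Hgen HZ HW HA.
  pose proof HS as [Hin [_ [_ [_ [Hsg [_ Hc]]]]]].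
  set (R0 := fun s => st_minus (st_scal (RtoC (/ s)) (st_minus (Sd s Z) Z)) W).
  assert (Hlim := proj2 (Hgen Z W HZ HW) HA).
  assert (HR0 : forall s, 0 < s -> in_H (R0 s)).
  { intros s Hs. apply in_H_minus; auto. apply in_H_scal, in_H_minus; auto.
    apply Hin; [lra|exact HZ]. }
  assert (Hev : forall eps, 0 < eps -> exists d, 0 < d /\ forall s, 0 < s < d ->
     H_norm beta (R0 s) < eps).
  { intros eps He. apply filterlim_locally with (eps := mkposreal eps He) in Hlim.
    destruct Hlim as [[d Pd] Hd]. exists d. split; [exact Pd|]. intros s [Hs1 Hs2].
    specialize (Hd s). unfold ball in Hd; simpl in Hd.
    unfold AbsRing_ball, abs, minus, plus, opp in Hd; simpl in Hd.
    assert (K : Rabs (H_norm beta (R0 s) + - 0) < eps).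
    { apply Hd; [|exact Hs1]. rewrite Ropp_0, Rplus_0_r, Rabs_pos_eq; lra. }
    apply Rabs_def2 in K. lra. }
  assert (Hrem : forall s t, 0 < s -> 0 <= t ->
     H_norm beta (step_rem (fun t => Sd t Z) (fun t => Sd t W) s t) <= H_norm beta (R0 s)).
  { intros s t Hs Ht. rewrite (step_rem_semigroup beta) by auto. apply Hc; [exact Ht|now apply HR0]. }
  split.
  - auto.
  - auto.
  - intros t s Ht Hs. rewrite Rplus_comm, Hsg by auto. apply energy_le_of_norm. auto.
  - intros t Ht. apply energy_le_of_norm. auto.
  - intros t Ht. apply Hgen; auto. apply filterlim_locally. intros [eps He].
    destruct (Hev eps He) as [d [Hd H]]. exists (mkposreal d Hd).
    intros s Hs1 Hs2. unfold ball in *; simpl in *.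
    unfold AbsRing_ball, abs, minus, plus, opp in *; simpl in *.
    rewrite Ropp_0, Rplus_0_r in Hs1 |- *.
    apply Rabs_def2 in Hs1.
    rewrite Rabs_pos_eq by apply H_norm_nonneg.
    eapply Rle_lt_trans; [|apply (H s); lra].
    rewrite <- Hsg by (auto; lra). rewrite (Rplus_comm s t).
    now apply Hrem.
  - intros rho Hrho. assert (Hsr : 0 < sqrt (2 * PI * rho)).
    { apply sqrt_lt_R0. pose proof twoPI_pos. nra. }
    destruct (Hev _ Hsr) as [d [Hd H]]. exists (d / 2). split; [lra|].
    intros s Hs t Ht. unfold energy. pose proof twoPI_pos as HP.
    apply Rmult_le_reg_l with (2 * PI); [exact HP|].
    replace (2 * PI * (H_norm beta (step_rem (fun t => Sd t Z) (fun t => Sd t W) s t) ^ 2 / (2 * PI)))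
      with (H_norm beta (step_rem (fun t => Sd t Z) (fun t => Sd t W) s t) ^ 2) by (field; lra).
    rewrite <- (pow2_sqrt (2 * PI * rho)) by nra.
    apply pow_incr. split; [apply H_norm_nonneg|].
    eapply Rle_trans; [apply Hrem; lra|]. left. apply H. lra.
Qed.

Lemma st_minus_plus Z W : st_plus (st_minus Z W) W = Z.
Proof.
  destruct Z as [h u], W as [h' u']. unfold st_plus, st_minus; cbn [fst snd].
  f_equal; apply functional_extensionality; intros phi; unfold d_plus, d_minus; ring.
Qed.

Theorem theorem4p7 (beta : R) (hbeta : 0 < beta) (a b : smoothT)
    (ha : forall x : R, 0 <= a x) (hb : forall x : R, 0 <= b x)
    (ha0 : ~ (forall x : R, a x = 0)) (hb0 : ~ (forall x : R, b x = 0))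
    (Sd : R -> state -> state)
    (hSd : is_C0_contraction_semigroup beta Sd)
    (hgen : is_generator beta Sd (Ad beta a b)) :
    forall Z0 : state, in_H Z0 ->
      is_lim (fun t => H_norm beta (Sd t Z0)) p_infty 0.
Proof.
  intros Z0 HZ0. apply is_lim_spec. intros [eps He].
  apply not_all_ex_not in ha0. destruct ha0 as [x0 Hx0].
  apply not_all_ex_not in hb0. destruct hb0 as [x1 Hx1].
  pose proof twoPI_pos as HP.
  set (kap := eps ^ 2 / (8 * (2 * PI))).
  assert (Hk : 0 < kap) by (apply Rdiv_lt_0_compat; [now apply pow_lt|lra]).
  destruct (trig_dense beta Z0 kap hbeta HZ0 Hk) as [N HN].
  set (ZN := trig_state Z0 N). fold ZN in HN.
  assert (HZN : in_H ZN) by apply in_H_trig_state.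
  destruct (trig_in_domain beta a b Z0 N) as [W [HW HA]]. fold ZN in HA.
  pose proof (semigroup_orbit beta a b Sd ZN W hbeta hSd hgen HZN HW HA) as HO.
  destruct (orbit_decay x0 x1 kap hbeta HO Hx0 Hx1 Hk) as [T HT].
  exists (Rmax T 0). intros t Ht. cbn [pos].
  assert (HtT : T <= t) by (eapply Rle_trans; [apply Rmax_l|left; exact Ht]).
  assert (Ht0 : 0 <= t) by (eapply Rle_trans; [apply Rmax_r|left; exact Ht]).
  rewrite Rminus_0_r, Rabs_pos_eq by apply H_norm_nonneg.
  pose proof hSd as [Hin [Hpl [_ [_ [_ [_ Hc]]]]]].
  assert (HD : in_H (st_minus Z0 ZN)) by now apply in_H_minus.
  assert (K : energy beta (Sd t Z0) <= 4 * kap).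
  { rewrite <- (st_minus_plus Z0 ZN) at 1. rewrite Hpl by assumption.
    eapply Rle_trans; [apply energy_plus_le; auto|].
    specialize (HT t HtT).
    assert (energy beta (Sd t (st_minus Z0 ZN)) <= energy beta (st_minus Z0 ZN))
      by (apply energy_le_of_norm; auto).
    lra. }
  apply Rsqr_incrst_0; [|apply H_norm_nonneg|lra]. rewrite !Rsqr_pow2, H_norm_energy.
  apply Rle_lt_trans with (2 * PI * (4 * kap)); [apply Rmult_le_compat_l; lra|].
  unfold kap. replace (2 * PI * (4 * (eps ^ 2 / (8 * (2 * PI))))) with (eps ^ 2 / 2)
    by (field; pose proof PI_RGT_0; lra).
  pose proof (pow_lt eps 2 He). lra.
Qed.
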